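(* Let $A\in\mathbb{R}^{n\times n}$ be a symmetric positive definite matrix with eigenvalues $\lambda_1\ge\dots\ge\lambda_n$, let $\mu\ge0$ and $A_\mu=A+\mu I$. Let $k$ be an integer with $l=2k+2\ge8$, and draw a Gaussian matrix $X\in\mathbb{R}^{l\times n}$. Let $q\ge1$ be an integer, $\Omega=A^qX^{\mathrm T}$, and let $\Pi$ be the orthogonal projector onto $\mathrm{range}(A_\mu\Omega)$. Then with probability at least $1-6^{-k}$, $$\|(I-\Pi)A_\mu\|\le\mu+\left(C_1+C_2\sqrt{\frac{\mathrm{sr}_k(A_\mu^2A^{2q})}{k}}\right)^{\frac1{q+1}}\lambda_k^{\frac q{q+1}}(\lambda_k+\mu)^{\frac1{q+1}}$$ with $C_1=18$ and $C_2=8\sqrt2$. Furthermore, $\mathbb{E}\big[\|(I-\Pi)A_\mu\|\big]$ is bounded by the same right-hand side with $C_1=2$ and $C_2=\sqrt2\,\mathrm e$.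
   Context: $\|\cdot\|$ is the spectral norm. For a matrix $C\in\mathbb{R}^{n\times n}$ with singular values $\sigma_1(C)\ge\dots\ge\sigma_n(C)$, the $k$-stable rank is $\mathrm{sr}_k(C)=\sum_{j\ge k}\sigma_j(C)/\sigma_k(C)$. A matrix $X\in\mathbb{R}^{l\times n}$ is called Gaussian if its entries are i.i.d. normal with mean $0$ and variance $l^{-1}$. *)

(* Defs.v *)
From HB Require Import structures.
From mathcomp Require Import all_boot all_order all_algebra.
From mathcomp Require Import all_classical all_reals all_analysis.
From mathcomp Require Import complex.

Set Implicit Arguments.
Unset Strict Implicit.
Unset Printing Implicit Defensive.

Import Order.TTheory GRing.Theory Num.Theory.

Local Open Scope classical_set_scope.
Local Open Scope ring_scope.

Section LinearAlgebra.
Context {R : realType}.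

Definition pos_def (n : nat) (A : 'M[R]_n) : Prop :=
  A^T = A /\ forall x : 'cV[R]_n, x != 0 -> 0 < (x^T *m A *m x) 0 0.

Definition enorm (n : nat) (x : 'cV[R]_n) : R :=
  Num.sqrt (\sum_i x i 0 ^+ 2).

(* Operator norm for the Euclidean norm; the library's norm on matrices is the
   entrywise maximum. *)
Definition spectral_norm (m n : nat) (C : 'M[R]_(m, n)) : R :=
  sup [set enorm (C *m x) | x in [set x : 'cV[R]_n | enorm x <= 1]].

Definition is_spectrum (n : nat) (A : 'M[R]_n) (s : seq R) : Prop :=
  sorted (fun x y => y <= x) s /\ char_poly A = \prod_(x <- s) ('X - x%:P).

(* Eigenvalues with multiplicity, in nonincreasing order.  The value is [::]
   when the characteristic polynomial does not split over R; this never happens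
   for symmetric matrices, see [eigenvaluesP]. *)
Definition eigenvalues (n : nat) (A : 'M[R]_n) : seq R :=
  xget [::] [set s | is_spectrum A s].

Definition singular_values (n : nat) (C : 'M[R]_n) : seq R :=
  [seq Num.sqrt x | x <- eigenvalues (C^T *m C)].

(* The index j is 1-based in [eigval] and [sigma]. *)
Definition eigval (n : nat) (A : 'M[R]_n) (j : nat) : R :=
  (eigenvalues A)`_j.-1.

Definition sigma (n : nat) (C : 'M[R]_n) (j : nat) : R :=
  (singular_values C)`_j.-1.

Definition stable_rank (n : nat) (k : nat) (C : 'M[R]_n) : R :=
  (\sum_(k <= j < n.+1) sigma C j) / sigma C k.

(* Matrices in mxalgebra act on row vectors, so the ranges (column spaces) of
   Pi and M are the row spaces of their transposes. *)
Definition is_orth_projector (n m : nat) (Pi : 'M[R]_n) (M : 'M[R]_(n, m))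
    : Prop :=
  [/\ Pi^T = Pi, Pi *m Pi = Pi & (Pi^T == M^T)%MS].

Lemma eigenvaluesP (n : nat) (A : 'M[R]_n) :
  A^T = A -> is_spectrum A (eigenvalues A).
Proof.
move=> symA; suff [s sP] : exists s, is_spectrum A s by exact: (xgetI [::] sP).
pose f : {rmorphism R -> complex.complex R} := complex.real_complex R.
pose B := map_mx f A.
have BrealE : B \is a mxOver Num.real.
  by apply/mxOverP => i j; rewrite mxE complex.complex_real.
have hB : B \is hermitianmx _ false Num.conj.
  apply: realsym_hermsym => //.
  apply/is_hermitianmxP; rewrite expr0 scale1r map_mx_id //.
  by rewrite /B map_trmx symA.
have /mxOverP dR := hermitian_spectral_diag_real hB.
have /hermitian_normalmx /orthomx_spectralP := hB.
set U := spectralmx B; set d := spectral_diag B => BE.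
have Uu : U \in unitmx by exact: spectral_unit.
pose t := [seq complex.Re (d 0 i) | i <- enum 'I_n].
exists (sort (fun x y => y <= x) t); split.
  by apply: sort_sorted => x y; exact: le_total.
rewrite (perm_big t) /=; last by rewrite perm_sort.
apply: (map_poly_inj f); rewrite map_char_poly -/B.
have -> : char_poly B = char_poly (diag_mx d).
  have BE' : char_poly_mx B
      = map_mx polyC (invmx U) *m char_poly_mx (diag_mx d) *m map_mx polyC U.
    rewrite /char_poly_mx mulmxBr mulmxBl -!map_mxM -BE; congr (_ - _).
    by rewrite scalar_mxC -mulmxA -map_mxM mulVmx // map_mx1 mulmx1.
  rewrite /char_poly BE' !det_mulmx mulrAC -det_mulmx -map_mxM mulVmx //.
  by rewrite map_mx1 det1 mul1r.
rewrite char_poly_trig; last first.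
  by apply/is_trig_mxP => i j ij; rewrite mxE -val_eqE ltn_eqF.
rewrite big_map big_enum rmorph_prod; apply: eq_bigr => i _ /=.
rewrite mxE eqxx mulr1n rmorphB /= map_polyX map_polyC /=.
by have /complex.complex_realP[x ->] := dR 0 i.
Qed.

End LinearAlgebra.

Section Gaussian.
Context {d : measure_display} {T : measurableType d} {R : realType}
  (P : probability T R).

Definition mutually_independent (I : finType) (X : I -> {RV P >-> R}) : Prop :=
  forall (J : {set I}) (B : I -> set R), (forall i, measurable (B i)) ->
    P (\bigcap_(i in [set` J]) (X i @^-1` B i))
    = (\prod_(i in J) P (X i @^-1` B i))%E.

(* [normal_prob m s] has standard deviation s, hence variance s ^+ 2. *)
Definition gaussian_matrix (l n : nat) (X : 'I_l -> 'I_n -> {RV P >-> R})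
    : Prop :=
  mutually_independent (fun ij : 'I_l * 'I_n => X ij.1 ij.2) /\
  forall i j (B : set R), measurable B ->
    distribution P (X i j) B = normal_prob 0 (Num.sqrt l%:R^-1) B.

Definition random_mx (l n : nat) (X : 'I_l -> 'I_n -> {RV P >-> R}) (w : T)
    : 'M[R]_(l, n) :=
  \matrix_(i, j) X i j w.

End Gaussian.

(* Main.v *)
(** Write [B = A_mu A^q = V diag(s) V^T] and [G = V^T X^T], a Gaussian matrix; call
    the first [k - 1] coordinates the head and the others the tail.  For [y] in
    the range of [1 - Pi], [B y] is orthogonal to the rows of [X], i.e.
    [G^T diag(s) nu = 0] with [nu = V^T y].  By convexity
    [|A y|^(q+1) <= y^T B y] for a unit [y], and if the head of [diag(s) nu] has norm
    at most [u] times that of the tail of [nu], then [y^T B y <= s_k + u / 2]; this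
    gives [|(1 - Pi) A_mu| <= mu + (s_k + u/2)^(1/(q+1))].

    The ratio [u] is controlled by moments of order [2p].  Testing
    [G^T diag(s) nu = 0] against the regularised pseudo-inverse of the head of [G]
    applied to an independent Gaussian column, and averaging over that column, bounds
    [u^(2p)] by a random variable [Psi].  Gaussian integration by parts alone
    bounds the mean of [Psi] by an explicit product: no inverse Wishart law and no
    rotation invariance are needed.  Taking [p] about [k/2] and Markov's inequality
    yields the tail bound; taking [p] about [k/8] and a tangent line of the concave
    function [Psi |-> (s_k + u/2)^(1/(q+1))] yields the bound in expectation. *)

From HB Require Import structures.
From mathcomp Require Import all_boot all_order all_algebra.
From mathcomp Require Import all_classical all_reals all_analysis.
From mathcomp Require Import measurable_realfun ring lra zify.
Require Import Defs.

Set Implicit Arguments.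
Unset Strict Implicit.
Unset Printing Implicit Defensive.

Import Order.TTheory GRing.Theory Num.Theory.
Import numFieldNormedType.Exports.

Local Open Scope classical_set_scope.
Local Open Scope ring_scope.

(** * Gaussian integration by parts *)

(** The bound on [u] must hold at once for all [y] in the kernel of the projector, a subspace that
    varies with the sample. Cauchy-Schwarz makes it uniform: the squared pairing of the
    (regularised) head of [diag(s) nu] with the test column is at most the squared norm of the tail
    of [nu] times [Qform], which depends on the sample and the test column alone. Averaging over the
    test column, taken from a second copy of the sample space, turns the pairing into a scalar
    Gaussian moment and [Qform] into a function of the sample.

    The inverse Gram matrix of the head is neither everywhere defined nor of polynomial growth, so
    integration by parts does not apply to it. Adding [eps] makes it a rational function with
    entries at most [eps^-1], and every term in [eps] has the sign that lets it be dropped: the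
    moment bounds are uniform in [eps], and Fatou's lemma passes to the limit.

    With [k - 1] head rows and [l = 2k + 2] columns, the successive integrations by parts divide by
    [l - (k - 1) - 1 - 2j = k + 2 - 2j]; orders up to [p = k %/ 2 + 1] keep these factors
    positive. *)

Section NormalDensity.
Context {R : realType}.
Local Notation mu := (@lebesgue_measure R).
Implicit Types (s t : R) (f : R -> R).

Lemma expR_dominates_pow (c : R) (N : nat) : 0 < c ->
  exists C : R, 0 <= C /\
    forall t : R, (1 + `|t|) ^+ N <= C * expR (c * t ^+ 2).
Proof.
move=> c0.
(* Splitting [c] into equal parts lets the quadratic bound [1 + c' t^2 <= expR (c' t^2)] be raised
   to a power; [N.+1] parts also cover [N = 0]. *)
pose c' := c / N.+1%:R.
have c'0 : 0 < c' by rewrite divr_gt0.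
pose K := 1 + c'^-1.
have K1 : 1 <= K by rewrite lerDl invr_ge0 ltW.
have K0 : 0 <= K by exact: le_trans ler01 K1.
have Kb t : 1 + t ^+ 2 <= K * expR (c' * t ^+ 2).
  apply: (@le_trans _ _ (K * (1 + c' * t ^+ 2))).
    rewrite mulrDr mulr1 lerD// mulrA ler_peMl ?sqr_ge0//.
    by rewrite /K mulrDl mul1r mulVf ?gt_eqF// lerDr ltW.
  by rewrite ler_wpM2l// expR_ge1Dx.
clearbody K; exists ((2 * K) ^+ N.+1); split; first by rewrite exprn_ge0// mulr_ge0.
move=> t; have t0 : 0 <= t ^+ 2 by exact: sqr_ge0.
have h1 : 1 + `|t| <= 2 * (1 + t ^+ 2).
  have := sqr_ge0 (`|t| - 1); rewrite sqrrB1 real_normK ?num_real//.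
  have := normr_ge0 t; lra.
apply: (@le_trans _ _ ((1 + `|t|) ^+ N.+1)).
  by rewrite exprSr ler_peMr ?exprn_ge0// ?lerDl// addr_ge0.
apply: (@le_trans _ _ ((2 * (1 + t ^+ 2)) ^+ N.+1)).
  by apply: lerXn2r => //; rewrite nnegrE ?mulr_ge0 ?addr_ge0.
apply: (@le_trans _ _ ((2 * (K * expR (c' * t ^+ 2))) ^+ N.+1)).
  apply: lerXn2r => //; rewrite ?nnegrE ?mulr_ge0 ?mulr_ge0 ?addr_ge0 ?expR_ge0//.
  by rewrite ler_wpM2l.
rewrite mulrA exprMn -expRM_natl ler_wpM2l ?exprn_ge0 ?mulr_ge0//.
rewrite (_ : N.+1%:R * (c' * t ^+ 2) = c * t ^+ 2)// /c'.
by field; rewrite addrC natr1 pnatr_eq0.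
Qed.

Lemma normal_fun_split s t : s != 0 ->
  normal_fun 0 s t = expR (- (3 / (8 * s ^+ 2)) * t ^+ 2) * normal_fun 0 (2 * s) t.
Proof.
move=> s0; rewrite /normal_fun -expRD; congr expR; rewrite !subr0.
by field.
Qed.

(** Doubling the standard deviation absorbs any polynomial, since the two densities differ by a
    factor [expR (- 3 t^2 / (8 s^2))]. The dominating function is again a normal density, whose
    integrability and limits are known. *)
Lemma normal_pdf_dominates_pow s (N : nat) : s != 0 ->
  exists C : R, 0 <= C /\ forall t : R,
    (1 + `|t|) ^+ N * normal_pdf 0 s t <= C * normal_pdf 0 (2 * s) t.
Proof.
move=> s0; have s20 : 2 * s != 0 by rewrite mulf_neq0.
have c0 : 0 < 3 / (8 * s ^+ 2) by rewrite divr_gt0// mulr_gt0// exprn_even_gt0.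
have [C [C0 HC]] := expR_dominates_pow N c0.
exists (C * (normal_peak s / normal_peak (2 * s))); split.
  by rewrite mulr_ge0// divr_ge0 ?normal_peak_ge0.
move=> t; rewrite !normal_pdfE//.
rewrite [leRHS]mulrA mulrCA -(mulrA C) divfK ?gt_eqF ?normal_peak_gt0//.
rewrite (mulrC C) -mulrA ler_wpM2l ?normal_peak_ge0//.
rewrite (normal_fun_split _ s0) mulrA ler_wpM2r ?expR_ge0//.
rewrite -ler_pdivlMr ?expR_gt0//; apply: le_trans (HC t) _.
by rewrite mulNr expRN invrK.
Qed.

(** The change of variables is stated for the Radon-Nikodym derivative, which agrees almost
    everywhere with the explicit density because both have the same integral over every measurable
    set. *)
Lemma ge0_integral_normal_prob s (f : R -> \bar R) : s != 0 ->
  measurable_fun setT f -> (forall t, (0 <= f t)%E) ->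
  (\int[normal_prob 0 s]_t f t = \int[mu]_t (f t * (normal_pdf 0 s t)%:E))%E.
Proof.
move=> s0 mf f0; have dom := @normal_prob_dominates R 0 s.
rewrite -(Radon_Nikodym_SigmaFinite.change_of_variables dom)//.
apply: ae_eq_integral => //.
- apply: emeasurable_funM => //; apply: (measurable_int mu).
  exact: Radon_Nikodym_SigmaFinite.f_integrable.
- apply: emeasurable_funM => //; apply/measurable_EFinP.
  exact: measurable_normal_pdf.
- apply: ae_eqe_mul2l => /=; apply: integral_ae_eq => //=.
  + exact: Radon_Nikodym_SigmaFinite.f_integrable.
  + by apply/measurable_EFinP; exact: measurable_normal_pdf.
  + by move=> E _ mE; rewrite -Radon_Nikodym_SigmaFinite.f_integral.
Qed.

Lemma integrable_normal_prob s (f : R -> R) : s != 0 ->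
  measurable_fun setT f ->
  (normal_prob 0 s).-integrable setT (EFin \o f) <->
  mu.-integrable setT (fun t => (f t * normal_pdf 0 s t)%:E).
Proof.
move=> s0 mf; have mp := @measurable_normal_pdf R 0 s.
have mfp : measurable_fun setT (fun t => f t * normal_pdf 0 s t).
  exact: measurable_funM.
have E : (\int[normal_prob 0 s]_t `|(f t)%:E| =
          \int[mu]_t `|(f t * normal_pdf 0 s t)%:E|)%E.
  rewrite ge0_integral_normal_prob//; last first.
    by apply: measurableT_comp => //; exact/measurable_EFinP.
  apply: eq_integral => t _ /=.
  by rewrite normrM (ger0_norm (normal_pdf_ge0 _ _ _)).
split=> /integrableP[_ fin]; apply/integrableP; split.
- exact/measurable_EFinP.
- by rewrite -E.
- exact/measurable_EFinP.
- by rewrite E.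
Qed.

Lemma integral_normal_prob s (f : R -> R) : s != 0 ->
  (normal_prob 0 s).-integrable setT (EFin \o f) ->
  (\int[normal_prob 0 s]_t (f t)%:E =
   \int[mu]_t (f t * normal_pdf 0 s t)%:E)%E.
Proof.
move=> s0 intf.
have mf : measurable_fun setT f by apply/measurable_EFinP; apply: measurable_int intf.
have H (g : R -> \bar R) t : ((g t * (normal_pdf 0 s t)%:E)%E = g t * (normal_pdf 0 s t)%:E)%E by [].
rewrite integralE [RHS]integralE !ge0_integral_normal_prob//; last 2 first.
  by apply: measurable_funeneg; exact/measurable_EFinP.
  by apply: measurable_funepos; exact/measurable_EFinP.
congr (_ - _)%E; apply: eq_integral => t _ /=;
  rewrite ?funeposE ?funenegE -?EFinN -!EFin_max -EFinM;
  by rewrite maxr_pMl ?normal_pdf_ge0// mul0r ?mulNr.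
Qed.

Definition poly_bounded (f : R -> R) :=
  exists C N, forall t, `|f t| <= C * (1 + `|t|) ^+ N.

Lemma integrable_poly_bounded s f : s != 0 -> measurable_fun setT f ->
  poly_bounded f -> (normal_prob 0 s).-integrable setT (EFin \o f).
Proof.
move=> s0 mf [C [N fb]]; apply/integrable_normal_prob => //.
have [D [D0 HD]] := normal_pdf_dominates_pow N s0.
have C0 : 0 <= C.
  by have := fb 0; rewrite normr0 addr0 expr1n mulr1; exact: le_trans.
have iD : mu.-integrable setT
    (fun t => (C * D)%:E * (normal_pdf 0 (2 * s) t)%:E)%E.
  by apply: integrableZl => //; exact: integrable_normal_pdf.
apply: le_integrable iD => //.
  by apply/measurable_EFinP/measurable_funM => //; exact: measurable_normal_pdf.
move=> t _ /=; rewrite lee_fin normrM (ger0_norm (normal_pdf_ge0 _ _ _)).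
rewrite [leRHS]ger0_norm; last by rewrite mulr_ge0 ?normal_pdf_ge0// mulr_ge0.
apply: le_trans (_ : C * (1 + `|t|) ^+ N * normal_pdf 0 s t <= _).
  by rewrite ler_wpM2r// normal_pdf_ge0.
by rewrite -!mulrA ler_wpM2l.
Qed.

Lemma normal_pdf_cvg0 s : s != 0 ->
  normal_pdf 0 s n%:R @[n --> \oo] --> 0 /\
  normal_pdf 0 s (- n%:R) @[n --> \oo] --> 0.
Proof.
move=> s0; have E n : normal_pdf 0 s (- n%:R) = normal_pdf 0 s n%:R.
  by rewrite !normal_pdfE// /normal_fun !subr0 sqrrN.
suff H : normal_pdf 0 s n%:R @[n --> \oo] --> 0.
  by split => //; under eq_fun do rewrite E.
pose c := (s ^+ 2 *+ 2)^-1.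
have c0 : 0 < c by rewrite invr_gt0 pmulrn_lgt0// exprn_even_gt0.
(* The upper sequence comes from [expR (c n^2) >= 1 + c n^2] and [2 n^2 >= n + 1] for [n >= 1]. *)
apply: (@squeeze_cvgr _ _ _ _ (fun=> 0)
  (fun n => (normal_peak s * c^-1) * n.+1%:R^-1 * 2)).
- near=> n; rewrite normal_pdf_ge0/= normal_pdfE// /normal_fun subr0 mulNr expRN.
  rewrite -!mulrA ler_wpM2l ?normal_peak_ge0//.
  have n0 : (0 < n)%N by near: n; exact: nbhs_infty_gt.
  have n1 : 1 <= n%:R :> R by rewrite ler1n.
  rewrite -/c -[leLHS]mul1r ler_pdivrMr ?expR_gt0//.
  clearbody c; have p0 : 0 < n.+1%:R :> R by [].
  have q0 : 0 <= c^-1 * (n.+1%:R^-1 * 2).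
    by rewrite !mulr_ge0 ?invr_ge0 ?(ltW c0) ?(ltW p0).
  apply: (le_trans _ (ler_wpM2l q0 (expR_ge1Dx _))).
  rewrite [leRHS](_ : _ = (2 * (c^-1 + n%:R ^+ 2)) / n.+1%:R); last first.
    by field; rewrite (gt_eqF c0) addrC natr1 pnatr_eq0.
  rewrite ler_pdivlMr// mul1r -natr1.
  have : 0 <= c^-1 by rewrite invr_ge0 ltW.
  by nra.
- exact: cvg_cst.
- rewrite -[X in _ --> X](mul0r 2); apply: cvgMr_tmp.
  rewrite -(mulr0 (normal_peak s * c^-1)); apply: cvgMl_tmp.
  exact: cvg_harmonic.
Unshelve. all: by end_near. Qed.

(** The function [s^2 f p], with [p] the density, is a primitive of the difference of the two
    integrands and vanishes at both infinities. The fundamental theorem is applied on [[-n, n]], and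
    dominated convergence reaches the whole line. *)
Lemma normal_prob_ibp s (f f' : R -> R) : s != 0 ->
  (forall t, is_derive t 1 f (f' t)) -> continuous f' ->
  poly_bounded f -> poly_bounded f' ->
  (\int[normal_prob 0 s]_t (t * f t)%:E =
   \int[normal_prob 0 s]_t (s ^+ 2 * f' t)%:E)%E.
Proof.
move=> s0 df cf' pf pf'.
have cf : continuous f.
  move=> t; apply: differentiable_continuous; apply/derivable1_diffP.
  by case: (df t).
have mf : measurable_fun setT f by exact: continuous_measurable_fun.
have mf' : measurable_fun setT f' by exact: continuous_measurable_fun.
have ptf : poly_bounded (fun t => t * f t).
  have [C [N H]] := pf; exists C, N.+1 => t; rewrite normrM exprS mulrCA.
  by apply: ler_pM => //; rewrite lerDr.
have psf : poly_bounded (fun t => s ^+ 2 * f' t).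
  have [C [N H]] := pf'; exists (s ^+ 2 * C), N => t.
  rewrite normrM (ger0_norm (sqr_ge0 _)) -[leRHS]mulrA.
  by apply: ler_wpM2l; rewrite ?sqr_ge0.
have mtf : measurable_fun setT (fun t => t * f t) by exact: measurable_funM.
have msf : measurable_fun setT (fun t => s ^+ 2 * f' t) by exact: measurable_funM.
have itf := integrable_poly_bounded s0 mtf ptf.
have isf := integrable_poly_bounded s0 msf psf.
rewrite !integral_normal_prob//.
move/(integrable_normal_prob s0 mtf) : itf => itf.
move/(integrable_normal_prob s0 msf) : isf => isf.
pose p := normal_pdf 0 s.
pose h t := s ^+ 2 * f' t * p t - t * f t * p t.
have ih : mu.-integrable setT (EFin \o h).
  by have := integrableB measurableT isf itf; apply: eq_integrable => // t _ /=.
suff h0 : (\int[mu]_t (h t)%:E = 0)%E.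
  move: h0; rewrite /h; under eq_integral do rewrite EFinB.
  rewrite integralB_EFin// => /eqP; rewrite sube_eq ?add0e.
    by move/eqP => ->.
  - exact: integrable_fin_num.
  - by rewrite fin_num_adde_defl// integrable_fin_num.
pose F t := s ^+ 2 * (f t * p t).
have dp t : is_derive t 1 p (- (t / s ^+ 2) * p t).
  have -> : p = (fun x => normal_peak s * expR (- x ^+ 2 / (s ^+ 2 *+ 2))).
    by apply/funext => x; rewrite /p normal_pdfE// /normal_fun subr0.
  apply: is_derive_eq; rewrite /= /GRing.scale/=.
  by field; rewrite s0.
have dF t : is_derive t 1 F (h t).
  apply: is_derive_eq; rewrite /= /GRing.scale/= /h.
  by field; rewrite s0.
have cp : continuous p by exact: continuous_normal_pdf.
have ch : continuous h.
  move=> t; apply: cvgB.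
    by apply: cvgM; [apply: cvgM; [exact: cvg_cst|exact: cf']|exact: cp].
  by apply: cvgM; [apply: cvgM; [exact: cvg_id|exact: cf]|exact: cp].
have Fcvg (u : nat -> R) : normal_pdf 0 (2 * s) (u n) @[n --> \oo] --> 0 ->
    F (u n) @[n --> \oo] --> 0.
  move=> u0; have [C [N fb]] := pf.
  have [D [D0 HD]] := normal_pdf_dominates_pow N s0.
  have C0 : 0 <= C.
    by have := fb 0; rewrite normr0 addr0 expr1n mulr1; exact: le_trans.
  apply/norm_cvg0P.
  apply: (@squeeze_cvgr _ _ _ _ (fun=> 0)
    (fun n => s ^+ 2 * (C * (D * normal_pdf 0 (2 * s) (u n))))).
  - apply: nearW => n; rewrite normr_ge0/= /F normrM (ger0_norm (sqr_ge0 _)).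
    apply: ler_wpM2l; first exact: sqr_ge0.
    rewrite normrM.
    rewrite (ger0_norm (normal_pdf_ge0 _ _ _)).
    apply: (le_trans (ler_wpM2r (normal_pdf_ge0 _ _ _) (fb _))).
    by rewrite -mulrA ler_wpM2l.
  - exact: cvg_cst.
  - rewrite -[X in _ --> X](mulr0 (s ^+ 2)); apply: cvgMl_tmp.
    rewrite -[X in _ --> X](mulr0 C); apply: cvgMl_tmp.
    by rewrite -[X in _ --> X](mulr0 D); apply: cvgMl_tmp.
have [pn pNn] : normal_pdf 0 (2 * s) n%:R @[n --> \oo] --> 0 /\
  normal_pdf 0 (2 * s) (- n%:R) @[n --> \oo] --> 0.
  by apply: normal_pdf_cvg0; rewrite mulf_neq0.
have intF (n : nat) : (0 < n)%N ->
    (\int[mu]_(x in `[(- n%:R)%R, n%:R%R]) (h x)%:E = (F n%:R - F (- n%:R))%:E)%E.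
  move=> n0; rewrite EFinB; apply: continuous_FTC2.
  - by rewrite gtrN// ltr0n.
  - exact: continuous_subspaceT.
  - have cF : continuous F.
      move=> t; apply: differentiable_continuous; apply/derivable1_diffP.
      by case: (dF t).
    split; first by move=> t _; case: (dF t).
    + by apply: cvg_at_right_filter; exact: cF.
    + by apply: cvg_at_left_filter; exact: cF.
  - by move=> t _; rewrite derive1E; case: (dF t).
have cvF : (\int[mu]_(x in `[(- n%:R)%R, n%:R%R]) (h x)%:E)%E @[n --> \oo]
    --> 0%E.
  apply: (@cvg_trans _ ((F n%:R - F (- n%:R))%:E @[n --> \oo])).
    apply: near_eq_cvg; near=> n; rewrite intF//.
    by near: n; exact: nbhs_infty_gt.
  apply: cvg_EFin; first exact: nearW.
  rewrite -[X in _ --> X](subr0 0).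
  by apply: cvgB; [exact: Fcvg|exact: Fcvg].
pose hn (n : nat) := (EFin \o h) \_ `[(- n%:R)%R, n%:R%R].
have mh : measurable_fun setT (EFin \o h) by exact: measurable_int ih.
have mhn n : measurable_fun setT (hn n).
  by apply/(measurable_restrictT _ _).1 => //; exact: measurable_funTS.
have hncvg : {ae mu, forall t, setT t -> hn ^~ t @ \oo --> (EFin \o h) t}.
  apply: aeW => /= t _; apply: cvg_near_cst; near=> n; rewrite /hn patchE mem_set//= in_itv/= -ler_norml.
  near: n; exact: nbhs_infty_ger.
have hnle : {ae mu, forall t n, setT t -> (`|hn n t| <= `|(h t)%:E|)%E}.
  by apply: aeW => /= t n _; rewrite /hn patchE; case: ifPn => // _; rewrite abse0.
have [_ _ lim] := @dominated_convergence _ _ _ mu setT measurableT hn (EFin \o h)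
  (fun t => `|(h t)%:E|%E) mhn mh hncvg (integrable_abse ih) hnle.
have E : (fun n => (\int[mu]_t hn n t)%E) =
    (fun n => (\int[mu]_(x in `[(- n%:R)%R, n%:R%R]) (h x)%:E)%E).
  by apply/funext => n; rewrite [RHS]integral_mkcond.
by move: lim; rewrite E => lim; exact: (cvg_unique _ lim cvF).
Unshelve. all: by end_near. Qed.

End NormalDensity.

(** * Resampling one variable of an independent family *)

Section Resample.
Context {d : measure_display} {T : measurableType d} {R : realType}
  (P : probability T R).
Variables (I : finType) (Y : I -> {RV P >-> R}) (i0 : I).
Hypothesis indepY : mutually_independent Y.

Local Notation tuple_of f := [tuple f (enum_val k) | k < #|I|].

(** The family is packed into a tuple because tuples carry the product sigma-algebra; [enum_val] and
    [enum_rank] translate the indices. *)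
Let tY (w : T) : #|I|.-tuple R := tuple_of (fun i => Y i w).

Let rY (z : R * T) : #|I|.-tuple R :=
  tuple_of (fun i => if i == i0 then z.1 else Y i z.2).

Let mtY : measurable_fun setT tY.
Proof.
apply/measurable_fun_tnthP => k; rewrite /comp.
by under eq_fun do rewrite tnth_mktuple; exact: measurable_funPT.
Qed.

Let mrY : measurable_fun setT rY.
Proof.
apply/measurable_fun_tnthP => k; rewrite /comp.
under eq_fun do rewrite tnth_mktuple; case: eqP => _; first exact: measurable_fst.
by apply: measurableT_comp => //; exact: measurable_funPT.
Qed.

Let box (B : 'I_#|I| -> set R) : set (#|I|.-tuple R) :=
  [set y | forall k, B k (tnth y k)].

Let boxes : set (set (#|I|.-tuple R)) :=
  [set A | exists2 B, (forall k, measurable (B k)) & A = box B].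

(** Boxes are stable under intersection and generate, and on them independence turns both laws into
    the same product; uniqueness of measures extends the equality. *)
Let measurable_boxes : @measurable _ (#|I|.-tuple R) = <<s boxes >>.
Proof.
apply/seteqP; split; last first.
  apply: smallest_sub; first exact: sigma_algebra_measurable.
  move=> _ [B mB ->].
  have -> : box B = \big[setI/setT]_(k < #|I|) ((@tnth _ R) ^~ k @^-1` B k).
    apply/seteqP; split=> y.
      move=> yB; apply: (big_ind (fun S : set _ => S y)) => [//|S1 S2 yS1 yS2|k _].
        by split.
      exact: yB.
    move=> + k; rewrite (bigD1 k)//= => -[yk _]; exact: yk.
  apply: bigsetI_measurable => k _; rewrite -[X in measurable X]setTI.
  exact: measurable_tnth.
rewrite {1}/measurable/=; apply: smallest_sub; first exact: smallest_sigma_algebra.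
move=> A; elim/big_ind : _ => //; first by move=> ? ? h1 h2 [/h1|/h2].
move=> k _ [B mB <-]; apply: sub_sigma_algebra; rewrite setTI.
exists (fun k' => if k' == k then B else setT); first by move=> k'; case: ifP.
apply/seteqP; split=> y /=; last by move=> /(_ k); rewrite eqxx.
by move=> Bk k'; case: eqP => // ->.
Qed.

#[local] HB.instance Definition _ := isMeasurableFun.Build _ _ _ _ tY mtY.
#[local] HB.instance Definition _ := isMeasurableFun.Build _ _ _ _ rY mrY.

Let Q : probability R R := distribution P (Y i0).

Let resample_box (B : 'I_#|I| -> set R) : (forall k, measurable (B k)) ->
  P (tY @^-1` box B) = (Q \x P)%E (rY @^-1` box B).
Proof.
move=> mB; pose C i := B (enum_rank i).
have EB (J : {set I}) := @indepY J C (fun i => mB (enum_rank i)).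
have mYC i : measurable (Y i @^-1` C i).
  by rewrite -[X in measurable X]setTI; apply: measurable_funPT => //; exact: mB.
have -> : tY @^-1` box B = \bigcap_(i in [set` [set: I]%SET]) (Y i @^-1` C i).
  apply/seteqP; split=> w /=.
    by move=> H i _; have := H (enum_rank i); rewrite tnth_mktuple enum_rankK.
  move=> H k; rewrite tnth_mktuple.
  by have := H (enum_val k); rewrite /C enum_valK; apply; rewrite /= inE.
have -> : rY @^-1` box B =
    C i0 `*` \bigcap_(i in [set` [set~ i0]%SET]) (Y i @^-1` C i).
  apply/seteqP; split=> -[t w] /=.
    move=> H; split; first by have := H (enum_rank i0);
      rewrite tnth_mktuple enum_rankK eqxx.
    move=> i /=; rewrite !inE => ii0.
    by have := H (enum_rank i); rewrite tnth_mktuple enum_rankK (negbTE ii0).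
  move=> [H1 H2] k; rewrite tnth_mktuple; case: eqP => [ki0|/eqP ki0].
    by move: H1; rewrite /C -ki0 enum_valK.
  by have := H2 (enum_val k); rewrite /C enum_valK; apply; rewrite /= !inE.
rewrite product_measure1E; last 2 first.
  - exact: mB.
  - by apply: fin_bigcap_measurable => // i _; exact: mYC.
rewrite (EB [set: I]%SET) (bigD1 i0)//=; congr (_ * _)%E.
by apply: etrans (esym (EB [set~ i0]%SET)); apply: eq_bigl => i; rewrite !inE.
Qed.

(* Replacing [Y i0] by an independent copy does not change the joint law; this is
   how one integrates over a single entry. *)
Lemma resample_measure (A : set (#|I|.-tuple R)) : measurable A ->
  pushforward P tY A = pushforward (Q \x P)%E rY A.
Proof.
move=> mA.
apply: (measure_unique boxes (fun=> setT) measurable_boxes _ _ _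
  (pushforward P tY) (pushforward (Q \x P)%E rY)) => //.
- move=> _ _ [B mB ->] [C mC ->]; exists (fun k => B k `&` C k).
    by move=> k; exact: measurableI.
  by apply/seteqP; split=> y /=; [move=> [? ?] k; split|move=> H; split=> k; have [] := H k].
- by move=> k; exists (fun=> setT) => //; apply/seteqP; split.
- by rewrite bigcup_const.
- by move=> _ [B mB ->]; exact: resample_box.
- move=> _; change (P (tY @^-1` setT) < +oo)%E.
  by rewrite preimage_setT probability_setT ltry.
Qed.

Lemma integrable_resample (f : #|I|.-tuple R -> R) : measurable_fun setT f ->
  P.-integrable setT (EFin \o (f \o tY)) ->
  (Q \x P)%E.-integrable setT (EFin \o (f \o rY)).
Proof.
move=> mf /integrableP[_ fin]; apply/integrableP; split.
  by apply/measurable_EFinP; apply: measurableT_comp.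
have mnf : measurable_fun setT (fun y => `|(f y)%:E|%E).
  by apply: measurableT_comp => //; exact/measurable_EFinP.
have E : (\int[pushforward P tY]_y `|(f y)%:E| =
    \int[pushforward (Q \x P)%E rY]_y `|(f y)%:E|)%E.
  by apply: eq_measure_integral => A mA _; exact: resample_measure.
move: fin; have -> : (\int[P]_w `|(EFin \o (f \o tY)) w| =
    \int[pushforward P tY]_y `|(f y)%:E|)%E by rewrite ge0_integral_pushforward.
by rewrite E ge0_integral_pushforward.
Qed.

Lemma integral_resample (f : #|I|.-tuple R -> R) : measurable_fun setT f ->
  P.-integrable setT (EFin \o (f \o tY)) ->
  (\int[P]_w (f (tY w))%:E = \int[P]_w \int[Q]_t (f (rY (t, w)))%:E)%E.
Proof.
move=> mf intf; have intr := integrable_resample mf intf.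
rewrite (@integral21_prod_meas1 _ _ _ _ _ Q P _ intr).
have mfE : measurable_fun setT (fun y => (f y)%:E) by exact/measurable_EFinP.
have E : (\int[pushforward P tY]_y (f y)%:E =
    \int[pushforward (Q \x P)%E rY]_y (f y)%:E)%E.
  by apply: eq_measure_integral => A mA _; exact: resample_measure.
transitivity (\int[pushforward P tY]_y (f y)%:E)%E.
  by rewrite integral_pushforward.
by rewrite E integral_pushforward.
Qed.

End Resample.

(** * Smooth functions of a matrix with polynomial growth *)

Section MatrixFunctions.
Context {R : realType} {m n : nat}.
Local Notation M := 'M[R]_(m, n).
Implicit Types (f g : M -> R) (A B D : M).

(* The sigma-algebra of matrices is avoided: measurability is tested on matrices
   of random variables. *)
Definition entrywise_measurable f := forall d (S : measurableType d) (Z : S -> M),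
  (forall i j, measurable_fun setT (fun s => Z s i j)) ->
  measurable_fun setT (fun s => f (Z s)).

Definition abs_sum (A : M) : R := \sum_i \sum_j `|A i j|.

Definition poly_growth f :=
  exists C N, 0 <= C /\ forall A, `|f A| <= C * (1 + abs_sum A) ^+ N.

(** These are the properties that integration by parts consumes: continuity along lines,
    measurability on random matrices, integrability against Gaussian entries. They are stable under
    sums and products. *)
Definition tame f := [/\ continuous f, entrywise_measurable f & poly_growth f].

Definition gradient f (L : M -> M) := forall A D : M,
  is_derive A D f (\sum_i \sum_j L A i j * D i j).

Definition smooth f := tame f /\
  exists2 L : M -> M, gradient f L & forall i j, tame (fun A => L A i j).

Lemma abs_sum_ge0 A : 0 <= abs_sum A.
Proof. by apply: sumr_ge0 => i _; exact: sumr_ge0. Qed.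

Lemma abs_sum_ge A i j : `|A i j| <= abs_sum A.
Proof.
rewrite /abs_sum (bigD1 i)//= (bigD1 j)//= -addrA lerDl addr_ge0//.
  exact: sumr_ge0.
by apply: sumr_ge0 => i' _; exact: sumr_ge0.
Qed.

Lemma abs_sumD A B : abs_sum (A + B) <= abs_sum A + abs_sum B.
Proof.
rewrite /abs_sum -big_split; apply: ler_sum => i _ /=.
by rewrite -big_split; apply: ler_sum => j _; rewrite mxE ler_normD.
Qed.

Lemma abs_sumZ c A : abs_sum (c *: A) = `|c| * abs_sum A.
Proof.
rewrite /abs_sum mulr_sumr; apply: eq_bigr => i _.
by rewrite mulr_sumr; apply: eq_bigr => j _; rewrite mxE normrM.
Qed.

Let base_ge1 A : 1 <= 1 + abs_sum A.
Proof. by rewrite lerDl abs_sum_ge0. Qed.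

Lemma poly_growthD f g : poly_growth f -> poly_growth g ->
  poly_growth (fun A => f A + g A).
Proof.
move=> [C [N [C0 fC]]] [D [K [D0 gD]]].
exists (C + D), (N + K)%N; split; first exact: addr_ge0.
move=> A; apply: (le_trans (ler_normD _ _)); rewrite mulrDl exprD.
have h k : 1 <= (1 + abs_sum A) ^+ k by rewrite exprn_ege1.
have p k : 0 <= (1 + abs_sum A) ^+ k by exact: le_trans ler01 (h k).
apply: lerD; [apply: (le_trans (fC A))|apply: (le_trans (gD A))];
  by rewrite ler_wpM2l// (ler_peMr, ler_peMl).
Qed.

Lemma poly_growthM f g : poly_growth f -> poly_growth g ->
  poly_growth (fun A => f A * g A).
Proof.
move=> [C [N [C0 fC]]] [D [K [D0 gD]]].
exists (C * D), (N + K)%N; split; first exact: mulr_ge0.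
by move=> A; rewrite normrM exprD mulrACA; apply: ler_pM.
Qed.

Lemma poly_growth_bounded f (C : R) : (forall A, `|f A| <= C) -> poly_growth f.
Proof.
move=> fC; exists C, 0%N; split; first exact: le_trans (normr_ge0 _) (fC 0).
by move=> A; rewrite expr0 mulr1.
Qed.

Lemma tame_cst (c : R) : tame (fun=> c).
Proof.
split; first exact: cst_continuous.
  by move=> d S Z _; exact: measurable_cst.
exact: (@poly_growth_bounded _ `|c|).
Qed.

Lemma tame_coord i j : tame (fun A : M => A i j).
Proof.
split; first exact: coord_continuous.
  by move=> d S Z mZ; exact: mZ.
exists 1, 1%N; split => // A; rewrite mul1r expr1.
by apply: (le_trans (abs_sum_ge _ i j)); rewrite lerDr.
Qed.

Lemma tameD f g : tame f -> tame g -> tame (fun A => f A + g A).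
Proof.
move=> [cf mf pf] [cg mg pg]; split; last exact: poly_growthD.
  by move=> A; exact: (continuousD (cf A) (cg A)).
by move=> d S Z mZ; apply: measurable_funD; [exact: mf|exact: mg].
Qed.

Lemma tameM f g : tame f -> tame g -> tame (fun A => f A * g A).
Proof.
move=> [cf mf pf] [cg mg pg]; split; last exact: poly_growthM.
  by move=> A; exact: (continuousM (cf A) (cg A)).
by move=> d S Z mZ; apply: measurable_funM; [exact: mf|exact: mg].
Qed.

Lemma tame_sum (I : Type) (r : seq I) (p : pred I) (F : I -> M -> R) :
  (forall i, p i -> tame (F i)) -> tame (fun A => \sum_(i <- r | p i) F i A).
Proof.
move=> tF; elim: r => [|i r IH].
  by under eq_fun do rewrite big_nil; exact: tame_cst.
under eq_fun do rewrite big_cons.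
by case: (boolP (p i)) => // pi; apply: tameD => //; exact: tF.
Qed.

Lemma tameX f k : tame f -> tame (fun A => f A ^+ k).
Proof.
move=> tf; elim: k => [|k IH]; first by under eq_fun do rewrite expr0; exact: tame_cst.
by under eq_fun do rewrite exprS; exact: tameM.
Qed.

Lemma smooth_tame f : smooth f -> tame f. Proof. by case. Qed.

Lemma is_derive_coord (A D : M) i j : is_derive A D (fun A : M => A i j) (D i j).
Proof.
have H : h^-1 *: (((fun A : M => A i j) \o shift A) (h *: D) - A i j)
    @[h --> 0^'] --> (D i j : R).
  apply: cvg_near_cst; near=> h.
  rewrite /= !mxE addrK /GRing.scale/= mulKf//.
  by near: h; exact: nbhs_dnbhs_neq.
split; first by apply/cvg_ex; exists (D i j).
exact: cvg_lim.
Unshelve. all: by end_near. Qed.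

Lemma smooth_cst c : smooth (fun=> c).
Proof.
split; first exact: tame_cst.
exists (fun=> 0) => [A D|i j].
  rewrite big1 => [|i _]; first exact: is_derive_cst.
  by rewrite big1 => // j _; rewrite mxE mul0r.
by under eq_fun do rewrite mxE; exact: tame_cst.
Qed.

Lemma smooth_coord i j : smooth (fun A : M => A i j).
Proof.
split; first exact: tame_coord.
exists (fun=> delta_mx i j) => [A D|i' j'].
  apply: is_derive_eq; first exact: is_derive_coord.
  rewrite (bigD1 i)//= (bigD1 j)//= !mxE !eqxx mul1r big1 => [|j' /negbTE nj].
    rewrite addr0 big1 ?addr0 // => i' /negbTE ni.
    by rewrite big1 // => j' _; rewrite mxE ni mul0r.
  by rewrite mxE nj andbF mul0r.
by under eq_fun do rewrite mxE; exact: tame_cst.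
Qed.

Lemma smoothD f g : smooth f -> smooth g -> smooth (fun A => f A + g A).
Proof.
move=> [tf [L fL tL]] [tg [K gK tK]]; split; first exact: tameD.
exists (fun A => L A + K A) => [A D|i j].
  apply: is_derive_eq; first exact: is_deriveD (fL A D) (gK A D).
  rewrite -big_split; apply: eq_bigr => i _ /=; rewrite -big_split.
  by apply: eq_bigr => j _ /=; rewrite mxE mulrDl.
by under eq_fun do rewrite mxE; exact: tameD.
Qed.

Lemma smoothM f g : smooth f -> smooth g -> smooth (fun A => f A * g A).
Proof.
move=> [tf [L fL tL]] [tg [K gK tK]]; split; first exact: tameM.
exists (fun A => f A *: K A + g A *: L A) => [A D|i j].
  apply: is_derive_eq; first exact: is_deriveM (fL A D) (gK A D).
  rewrite /GRing.scale/= !mulr_sumr -big_split; apply: eq_bigr => i _ /=.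
  rewrite !mulr_sumr -big_split; apply: eq_bigr => j _ /=.
  by rewrite !mxE mulrDl !mulrA.
by under eq_fun do rewrite !mxE; apply: tameD; exact: tameM.
Qed.

Lemma smooth_sum (I : Type) (r : seq I) (p : pred I) (F : I -> M -> R) :
  (forall i, p i -> smooth (F i)) -> smooth (fun A => \sum_(i <- r | p i) F i A).
Proof.
move=> tF; elim: r => [|i r IH].
  by under eq_fun do rewrite big_nil; exact: smooth_cst.
under eq_fun do rewrite big_cons.
by case: (boolP (p i)) => // pi; apply: smoothD => //; exact: tF.
Qed.

Lemma smoothX f k : smooth f -> smooth (fun A => f A ^+ k).
Proof.
move=> tf; elim: k => [|k IH].
  by under eq_fun do rewrite expr0; exact: smooth_cst.
by under eq_fun do rewrite exprS; exact: smoothM.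
Qed.

Lemma poly_growth_line f (B D : M) : poly_growth f ->
  poly_bounded (fun t : R => f (B + t *: D)).
Proof.
move=> [C [N [C0 fC]]].
exists (C * (1 + abs_sum B + abs_sum D) ^+ N), N => t.
apply: (le_trans (fC _)); rewrite -mulrA ler_wpM2l// -exprMn.
have bB := abs_sum_ge0 B; have bD := abs_sum_ge0 D.
apply: lerXn2r; rewrite ?nnegrE.
- by rewrite addr_ge0// abs_sum_ge0.
- by rewrite mulr_ge0 ?addr_ge0.
have := abs_sumD B (t *: D); rewrite abs_sumZ.
have : 0 <= `|t| * (1 + abs_sum B) by rewrite mulr_ge0// addr_ge0.
nra.
Qed.

Lemma continuous_line f (B D : M) : continuous f ->
  continuous (fun t : R => f (B + t *: D)).
Proof.
move=> cf t; apply: (@cvg_comp _ _ _ (fun t : R => B + t *: D) f _ (nbhs (B + t *: D))).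
  by apply: cvgD; [exact: cvg_cst|apply: cvgZr_tmp; exact: cvg_id].
exact: cf.
Qed.

Lemma is_derive_line f (B D : M) t df : is_derive (B + t *: D) D f df ->
  is_derive t 1 (fun t : R => f (B + t *: D)) df.
Proof.
move=> [/cvg_ex[x fx] fdf].
have E h : h^-1 *: (((fun t : R => f (B + t *: D)) \o shift t) (h *: (1 : R)) - f (B + t *: D))
  = h^-1 *: ((f \o shift (B + t *: D)) (h *: D) - f (B + t *: D)).
  congr (_ *: (f _ - _)); rewrite /= [h *: 1]mulr1 scalerDl addrCA //.
have xdf : x = df by rewrite -fdf; apply/esym/cvg_lim.
split; first by apply/cvg_ex; exists x; under eq_cvg do rewrite E.
by rewrite -xdf; apply: cvg_lim => //; under eq_cvg do rewrite E.
Qed.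

End MatrixFunctions.

Lemma exprD_le (R : realDomainType) (a b : R) N : 0 <= a -> 0 <= b ->
  (a + b) ^+ N <= 2 ^+ N * (a ^+ N + b ^+ N).
Proof.
wlog ab : a b / a <= b => [H a0 b0|a0 b0].
  case/orP: (le_total a b) => [/H|/H h]; first exact.
  by rewrite addrC [X in _ * X]addrC; exact: h.
apply: (@le_trans _ _ ((2 * b) ^+ N)).
  by apply: lerXn2r; rewrite ?nnegrE ?addr_ge0 ?mulr_ge0//; lra.
rewrite exprMn ler_wpM2l ?exprn_ge0// lerDr exprn_ge0//.
Qed.

(** This reduces polynomial growth in all entries jointly to absolute moments of single entries. *)
Lemma exprn_sum_le (R : realDomainType) (I : Type) (r : seq I) N :
  exists2 K : R, 0 <= K & forall x : I -> R, (forall i, 0 <= x i) ->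
    (1 + \sum_(i <- r) x i) ^+ N <= K * (1 + \sum_(i <- r) x i ^+ N).
Proof.
elim: r => [|i r [K K0 IH]].
  by exists 1 => // x _; rewrite !big_nil addr0 expr1n mul1r.
exists (2 ^+ N * (1 + K)); first by rewrite mulr_ge0 ?exprn_ge0 ?addr_ge0.
move=> x x0; rewrite !big_cons.
have S0 : 0 <= \sum_(j <- r) x j by exact: sumr_ge0.
have SN0 : 0 <= \sum_(j <- r) x j ^+ N.
  by apply: sumr_ge0 => j _; rewrite exprn_ge0.
rewrite addrCA; apply: (le_trans (exprD_le N (x0 i) _)); first exact: addr_ge0.
rewrite -mulrA ler_wpM2l ?exprn_ge0//.
have xN : 0 <= x i ^+ N by rewrite exprn_ge0.
have := IH x x0; have : 0 <= K * x i ^+ N by rewrite mulr_ge0.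
nra.
Qed.

(** * Integration by parts for a random matrix *)

Section SteinEntry.
Context {d : measure_display} {T : measurableType d} {R : realType}
  (P : probability T R) {m n : nat} (X : 'I_m -> 'I_n -> {RV P >-> R}) (s : R).
Hypothesis s0 : s != 0.
Hypothesis indepX : mutually_independent (fun ij : 'I_m * 'I_n => X ij.1 ij.2).
Hypothesis lawX : forall i j (B : set R), measurable B ->
  distribution P (X i j) B = normal_prob 0 s B.
Local Notation M := 'M[R]_(m, n).

Lemma ge0_integral_law i j (f : R -> \bar R) : measurable_fun setT f ->
  (forall t, (0 <= f t)%E) ->
  (\int[distribution P (X i j)]_t f t = \int[normal_prob 0 s]_t f t)%E.
Proof.
move=> mf f0.
(* The identity is read as a map from [measurableTypeR R] to [R], so that both integrals live on the
   same measurable type. *)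
have mid : measurable_fun setT (fun t : measurableTypeR R => (t : R)).
  by move=> _ A mA; rewrite setTI.
transitivity (\int[pushforward (normal_prob 0 s) (fun t : measurableTypeR R => (t : R))]_t f t)%E.
  by apply: eq_measure_integral => A mA _; exact: lawX.
by rewrite ge0_integral_pushforward.
Qed.

Lemma integral_law i j (f : R -> \bar R) : measurable_fun setT f ->
  (\int[distribution P (X i j)]_t f t = \int[normal_prob 0 s]_t f t)%E.
Proof.
move=> mf; rewrite integralE [RHS]integralE !(@ge0_integral_law i j)//.
- exact: measurable_funeneg.
- exact: measurable_funepos.
Qed.

Let mX i j : measurable_fun setT (fun w => random_mx X w i j).
Proof. by under eq_fun do rewrite mxE; exact: measurable_funPT. Qed.

Lemma integrable_entryX i j N : P.-integrable setT (fun w => (`|X i j w| ^+ N)%:E).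
Proof.
have mf : measurable_fun setT (fun t : R => `|t| ^+ N).
  by apply: measurable_funX; exact: normr_measurable.
have ib : (normal_prob 0 s).-integrable setT (EFin \o (fun t => `|t| ^+ N)).
  apply: integrable_poly_bounded => //; exists 1, N => t.
  rewrite mul1r ger0_norm ?exprn_ge0//.
  by apply: lerXn2r; rewrite ?nnegrE ?addr_ge0// lerDr.
have mnf : measurable_fun setT (fun t : R => `|(`|t| ^+ N)%:E|%E).
  by apply: measurableT_comp => //; exact/measurable_EFinP.
apply/integrableP; split.
  apply/measurable_EFinP; apply: (measurableT_comp mf); exact: measurable_funPT.
move/integrableP : ib => [_]; apply: le_lt_trans.
rewrite -(@ge0_integral_distribution _ _ _ _ _ P (X i j) (fun t => `|(`|t| ^+ N)%:E|%E))//.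
by rewrite (ge0_integral_law i j).
Qed.

Lemma integrable_tame (f : M -> R) : tame f ->
  P.-integrable setT (fun w => (f (random_mx X w))%:E).
Proof.
move=> [_ mf [C [N [C0 fC]]]].
have [K K0 HK] := @exprn_sum_le R _ (index_enum ('I_m * 'I_n)%type) N.
pose g w : \bar R := ((C * K)%:E * (1 + \sum_(ij : 'I_m * 'I_n) (`|X ij.1 ij.2 w| ^+ N)%:E))%E.
have ig : P.-integrable setT g.
  apply: integrableZl => //; apply: integrableD => //.
    exact: finite_measure_integrable_cst.
  by apply: integrable_sum => // ij _; exact: integrable_entryX.
apply: le_integrable ig => //.
  by apply/measurable_EFinP; exact: mf.
move=> w _; rewrite /g sumEFin -EFinD -EFinM !abse_EFin lee_fin [leRHS]ger0_norm; last first.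
  rewrite !mulr_ge0// addr_ge0// sumr_ge0// => i _; exact: exprn_ge0.
apply: (le_trans (fC _)); rewrite -mulrA ler_wpM2l//.
apply: le_trans (HK (fun ij => `|X ij.1 ij.2 w|) _) => //.
rewrite /abs_sum pair_bigA/= le_eqVlt; apply/orP; left; apply/eqP.
by congr ((1 + _) ^+ N); apply: eq_bigr => i _; rewrite mxE.
Qed.

(** After resampling, the entry [(i, j)] is integrated first with all others frozen: the matrix runs
    along the line [B w + t *: delta_mx i j], where [B w] has a zero at [(i, j)], and the
    one-dimensional formula applies. *)
Lemma stein_entry (f : M -> R) (L : M -> M) i j : tame f -> gradient f L ->
  tame (fun A => L A i j) ->
  (\int[P]_w (X i j w * f (random_mx X w))%:E =
   \int[P]_w (s ^+ 2 * L (random_mx X w) i j)%:E)%E.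
Proof.
move=> tf fL tL.
pose I := ('I_m * 'I_n)%type.
pose mx (y : #|{: I}|.-tuple R) : M := \matrix_(i, j) tnth y (enum_rank ((i, j) : I)).
have mmx (g : M -> R) : tame g -> measurable_fun setT (g \o mx).
  move=> [_ mg _]; apply: mg => i' j'; rewrite /mx.
  by under eq_fun do rewrite mxE; exact: measurable_tnth.
have mxX w : mx [tuple (fun ij : I => X ij.1 ij.2 w) (enum_val k) | k < #|{: I}|]
    = random_mx X w.
  by apply/matrixP => i' j'; rewrite !mxE tnth_mktuple enum_rankK.
pose B w : M := random_mx X w - X i j w *: delta_mx i j.
have mxB t w : mx [tuple (fun ij : I => if ij == (i, j) then t else X ij.1 ij.2 w) (enum_val k) | k < #|{: I}|]
    = B w + t *: delta_mx i j.
  apply/matrixP => i' j'; rewrite !mxE tnth_mktuple enum_rankK xpair_eqE.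
  case: (eqVneq i' i) => [->|_]; last by rewrite !mulr0 subr0 addr0.
  by case: (eqVneq j' j) => [->|_] /=; rewrite ?mulr1 ?mulr0 ?subr0 ?addr0// subrr add0r.
have res (g : M -> R) : tame g ->
  (\int[P]_w (g (random_mx X w))%:E =
   \int[P]_w \int[normal_prob 0 s]_t (g (B w + t *: delta_mx i j))%:E)%E.
  move=> tg.
  have := @integral_resample _ _ _ P _ (fun ij : I => X ij.1 ij.2) (i, j) indepX (g \o mx) (mmx _ tg).
  under eq_integral do rewrite /= mxX.
  move=> ->; last first.
    by rewrite /comp; under eq_fun do rewrite mxX; exact: integrable_tame.
  apply: eq_integral => w _.
  under eq_integral do rewrite /= mxB.
  apply: integral_law; apply/measurable_EFinP; have [_ mg _] := tg.
  apply: mg => i' j'; under eq_fun do rewrite !mxE.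
  by apply: measurable_funD => //; exact: measurable_funM.
have -> : (\int[P]_w (X i j w * f (random_mx X w))%:E =
    \int[P]_w (random_mx X w i j * f (random_mx X w))%:E)%E.
  by apply: eq_integral => w _; rewrite mxE.
rewrite (res (fun A => A i j * f A)); last by apply: tameM => //; exact: tame_coord.
rewrite (res (fun A => s ^+ 2 * L A i j)); last by apply: tameM => //; exact: tame_cst.
apply: eq_integral => w _.
transitivity (\int[normal_prob 0 s]_t (t * f (B w + t *: delta_mx i j))%:E)%E.
  apply: eq_integral => t _; congr (_ * _)%:E.
  by rewrite !mxE !eqxx /= mulr1 subrr add0r mulr1.
apply: (normal_prob_ibp s0).
- move=> t; apply: is_derive_line; apply: is_derive_eq; first exact: fL.
  rewrite (bigD1 i)//= (bigD1 j)//= !mxE !eqxx mulr1 big1 => [|j' /negbTE nj].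
    rewrite addr0 big1 ?addr0 // => i' /negbTE ni.
    by rewrite big1 // => j' _; rewrite mxE ni mulr0.
  by rewrite mxE nj andbF mulr0.
- by apply: (@continuous_line _ _ _ (fun A => L A i j)); case: tL.
- by apply: poly_growth_line; case: tf.
- by apply: (@poly_growth_line _ _ _ (fun A => L A i j)); case: tL.
Qed.

End SteinEntry.

Section TameComp.
Context {R : realType} {m n p r : nat}.
Variable phi : 'M[R]_(m, n) -> 'M[R]_(p, r).

Lemma continuous_entrywise : (forall i j, continuous (fun A => phi A i j)) ->
  continuous phi.
Proof.
move=> cphi A B [N NA /= NB].
have : \forall M \near nbhs A, forall ij : 'I_p * 'I_r, N ij.1 ij.2 (phi M ij.1 ij.2).
  apply: filter_forall => ij; exact: (cphi ij.1 ij.2 A _ (NA ij.1 ij.2)).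
apply: filterS => M MN; apply: NB => i j; exact: (MN (i, j)).
Qed.

Lemma tame_comp (f : 'M[R]_(p, r) -> R) : (forall i j, tame (fun A => phi A i j)) ->
  tame f -> tame (fun A => f (phi A)).
Proof.
move=> tphi [cf mf [C [N [C0 fC]]]]; split.
- move=> A; apply: (@cvg_comp _ _ _ phi f _ (nbhs (phi A))); last exact: cf.
  by apply: continuous_entrywise => i j; have [] := tphi i j.
- by move=> d S Z mZ; apply: mf => i j; have [_ mphi _] := tphi i j; exact: mphi.
have [D [K [D0 phiD]]] : exists D K, 0 <= D /\
    forall A, 1 + abs_sum (phi A) <= D * (1 + abs_sum A) ^+ K.
  have [D [K [D0 HD]]] : poly_growth (fun A => \sum_(ij : 'I_p * 'I_r) `|phi A ij.1 ij.2|).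
    elim: (index_enum _) => [|ij s IH].
      apply: (@poly_growth_bounded _ _ _ _ 0) => A.
      by rewrite big_nil normr0.
    under eq_fun do rewrite big_cons; apply: poly_growthD => //.
    have [_ _ [C' [N' [C'0 H]]]] := tphi ij.1 ij.2.
    by exists C', N'; split => // A; rewrite normr_id.
  exists (1 + D), K; split; first exact: addr_ge0.
  move=> A; rewrite mulrDl mul1r lerD//.
    by rewrite exprn_ege1// lerDl abs_sum_ge0.
  apply: le_trans (HD A); rewrite ger0_norm ?sumr_ge0//.
  by rewrite /abs_sum pair_bigA.
exists (C * D ^+ N), (K * N)%N; split; first by rewrite mulr_ge0 ?exprn_ge0.
move=> A; apply: (le_trans (fC _)); rewrite -mulrA ler_wpM2l// exprM -exprMn.
apply: lerXn2r; rewrite ?nnegrE//.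
- by rewrite addr_ge0// abs_sum_ge0.
- by rewrite mulr_ge0 ?exprn_ge0 ?addr_ge0 ?abs_sum_ge0.
Qed.

End TameComp.

Section SteinMatrix.
Context {d : measure_display} {T : measurableType d} {R : realType}
  (P : probability T R) {n l : nat}.

(* [stein_matrix G tau] is all that is used of a Gaussian matrix [G] with entries
   of variance [tau]. *)
Definition stein_matrix (G : T -> 'M[R]_(n, l)) (tau : R) : Prop :=
  [/\ forall i a, measurable_fun setT (fun w => G w i a),
      forall f, tame f -> P.-integrable setT (fun w => (f (G w))%:E) &
      forall f L i a, tame f -> gradient f L -> (forall i a, tame (fun A => L A i a)) ->
        (\int[P]_w (G w i a * f (G w))) =
        tau * (\int[P]_w (L (G w) i a))].

Section Theory.
Variables (G : T -> 'M[R]_(n, l)) (tau : R).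
Hypothesis steinG : stein_matrix G tau.
Local Notation M := 'M[R]_(n, l).
Implicit Types (f g : M -> R).

Definition mean f : R := \int[P]_w f (G w).

Let intG f : tame f -> P.-integrable setT (EFin \o (fun w => f (G w))).
Proof. by case: steinG => _ + _ => /[apply]. Qed.

Lemma eq_mean f g : f =1 g -> mean f = mean g.
Proof. by move=> fg; congr Rintegral; apply/funext => w; rewrite fg. Qed.

Lemma meanE f : tame f -> (\int[P]_w (f (G w))%:E = (mean f)%:E)%E.
Proof. by move=> tf; rewrite fineK//; apply: integrable_fin_num => //; exact: intG. Qed.

Lemma meanD f g : tame f -> tame g -> mean (fun A => f A + g A) = mean f + mean g.
Proof. by move=> tf tg; rewrite /mean RintegralD//; exact: intG. Qed.

Lemma meanZ c f : tame f -> mean (fun A => c * f A) = c * mean f.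
Proof. by move=> tf; rewrite /mean RintegralZl//; exact: intG. Qed.

Lemma mean_cst c : mean (fun=> c) = c.
Proof.
rewrite /mean Rintegral_cst// (_ : _ [set: T] = 1%E) ?mulr1//; exact: probability_setT.
Qed.

Lemma mean_sum (I : Type) (s : seq I) (q : pred I) (F : I -> M -> R) :
  (forall i, q i -> tame (F i)) ->
  mean (fun A => \sum_(i <- s | q i) F i A) = \sum_(i <- s | q i) mean (F i).
Proof.
move=> tF; elim: s => [|i s IH].
  by under eq_mean do rewrite big_nil; rewrite mean_cst big_nil.
under eq_mean do rewrite big_cons; rewrite big_cons -IH.
case: (boolP (q i)) => // qi; rewrite meanD//; first exact: tF.
exact: tame_sum.
Qed.

Lemma le_mean f g : tame f -> tame g -> (forall A, f A <= g A) -> mean f <= mean g.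
Proof. by move=> tf tg fg; apply: le_Rintegral => //; exact: intG. Qed.

(** This is the form used for all moments: the derivative [psi] is computed by hand in one direction
    of one column, and uniqueness of derivatives identifies it with the contraction of the gradient
    that [smooth] provides. *)
Lemma stein_direction (c : 'cV[R]_n) (a : 'I_l) f psi : smooth f ->
  (forall A, is_derive A (c *m delta_mx 0 a) f (psi A)) ->
  mean (fun A => (\sum_i c i 0 * A i a) * f A) = tau * mean psi.
Proof.
move=> [tf [L fL tL]] fpsi.
have psiE A : psi A = \sum_i c i 0 * L A i a.
  rewrite -(derive_val (is_derive := fpsi A)) (derive_val (is_derive := fL A _)).
  apply: eq_bigr => i _; rewrite (bigD1 a)//= !mxE big_ord1 !mxE !eqxx mulr1 mulrC.
  by rewrite big1 ?addr0// => b /negbTE ba; rewrite mxE big_ord1 mxE ba mulr0 mulr0.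
under eq_mean do rewrite mulr_suml; rewrite mean_sum; last first.
  move=> i _; apply: tameM => //; apply: tameM; [exact: tame_cst|exact: tame_coord].
rewrite (eq_mean psiE) mean_sum; last first.
  by move=> i _; apply: tameM => //; exact: tame_cst.
rewrite mulr_sumr; apply: eq_bigr => i _.
under eq_mean do rewrite -mulrA.
rewrite !meanZ//; last by apply: tameM => //; exact: tame_coord.
by rewrite mulrCA; congr (_ * _); case: steinG => _ _; exact.
Qed.

End Theory.
End SteinMatrix.

Section SteinRotation.
Context {d : measure_display} {T : measurableType d} {R : realType}
  (P : probability T R) {n l : nat} (X : 'I_l -> 'I_n -> {RV P >-> R}) (s : R).
Hypothesis s0 : s != 0.
Hypothesis indepX : mutually_independent (fun ij : 'I_l * 'I_n => X ij.1 ij.2).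
Hypothesis lawX : forall i j (B : set R), measurable B ->
  distribution P (X i j) B = normal_prob 0 s B.

(** By the chain rule for the linear map [phi], the gradient of [f (phi A)] is [(V *m L (phi A))^T];
    applying [V^T] to return to the rotated coordinates produces [V^T *m V], hence [L] again with
    the same variance. *)
Lemma stein_rotation (V : 'M[R]_n) : V^T *m V = 1%:M ->
  stein_matrix P (fun w => V^T *m (random_mx X w)^T) (s ^+ 2).
Proof.
move=> VTV.
pose phi (A : 'M[R]_(l, n)) := V^T *m A^T.
have phiE A i a : phi A i a = \sum_b V b i * A a b.
  by rewrite mxE; apply: eq_bigr => b _; rewrite !mxE.
have tphi i a : tame (fun A => phi A i a).
  under eq_fun do rewrite phiE; apply: tame_sum => b _.
  by apply: tameM; [exact: tame_cst|exact: tame_coord].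
have mX i j : measurable_fun setT (fun w => random_mx X w i j).
  by under eq_fun do rewrite mxE; exact: measurable_funPT.
split.
- by move=> i a; have [_ m _] := tphi i a; exact: m.
- by move=> f tf; apply: (integrable_tame s0 lawX (tame_comp tphi tf)).
move=> f L i a tf fL tL.
pose L' (A : 'M[R]_(l, n)) := (V *m L (phi A))^T.
have L'E A a' b : L' A a' b = \sum_i V b i * L (phi A) i a' by rewrite !mxE.
have tL' a' b : tame (fun A => L' A a' b).
  under eq_fun do rewrite L'E; apply: tame_sum => i' _.
  apply: tameM; [exact: tame_cst|exact: tame_comp (tL _ _)].
have tfphi : tame (fun A => f (phi A)) by exact: tame_comp.
have fL' : gradient (fun A => f (phi A)) L'.
  move=> A D.
  have [/cvg_ex[x fx] fdf] := fL (phi A) (phi D).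
  have phiDZ h : phi (h *: D + A) = h *: phi D + phi A.
    by rewrite /phi raddfD/= linearZ/= mulmxDr scalemxAr.
  have E h : h^-1 *: (((fun A => f (phi A)) \o shift A) (h *: D) - f (phi A))
    = h^-1 *: ((f \o shift (phi A)) (h *: phi D) - f (phi A)).
    by rewrite /= phiDZ.
  have xdf : x = \sum_i \sum_j L (phi A) i j * phi D i j.
    by rewrite -fdf; apply/esym/cvg_lim.
  have -> : \sum_i \sum_j L' A i j * D i j = x.
    rewrite xdf exchange_big/=.
    rewrite [RHS]exchange_big/= exchange_big/=; apply: eq_bigr => b _.
    under eq_bigr do rewrite L'E mulr_suml.
    rewrite exchange_big/=; apply: eq_bigr => i' _.
    rewrite phiE mulr_sumr; apply: eq_bigr => j' _.
    by rewrite mulrA [L _ _ _ * _]mulrC.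
  split; first by apply/cvg_ex; exists x; under eq_cvg do rewrite E.
  by apply: cvg_lim => //; under eq_cvg do rewrite E.
have iX (g : 'M[R]_(l, n) -> R) : tame g ->
    P.-integrable setT (EFin \o (fun w => g (random_mx X w))).
  by move=> tg; exact: (integrable_tame s0 lawX tg).
have Rsum (F : 'I_n -> 'M[R]_(l, n) -> R) : (forall b, tame (F b)) ->
    \int[P]_w (\sum_b F b (random_mx X w)) = \sum_b \int[P]_w (F b (random_mx X w)).
  move=> tF; rewrite /Rintegral.
  under eq_integral do rewrite -sumEFin.
  rewrite integral_sum//; last by move=> b; exact: iX.
  by rewrite sum_fine// => b _; apply: integrable_fin_num => //; exact: iX.
have st a' b : \int[P]_w (random_mx X w a' b * f (phi (random_mx X w))) =
    s ^+ 2 * \int[P]_w L' (random_mx X w) a' b.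
  rewrite -RintegralZl//; last exact: (iX (fun A => L' A a' b)).
  rewrite /Rintegral -(stein_entry s0 indepX lawX tfphi fL' (tL' a' b)).
  by congr fine; apply: eq_integral => w _; rewrite mxE.
pose F b (A : 'M[R]_(l, n)) := V b i * (A a b * f (phi A)).
have tAf b : tame (fun A : 'M[R]_(l, n) => A a b * f (phi A)).
  by apply: tameM => //; exact: tame_coord.
transitivity (\int[P]_w (\sum_b F b (random_mx X w))).
  congr Rintegral; apply/funext => w; rewrite -/(phi _) phiE mulr_suml.
  by apply: eq_bigr => b _; rewrite /F mulrA.
rewrite Rsum; last by move=> b; apply: tameM => //; exact: tame_cst.
under eq_bigr => b _.
  rewrite RintegralZl//; last exact: (iX _ (tAf b)).
  rewrite st mulrCA.
  over.
rewrite -mulr_sumr; congr (_ * _).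
pose K b (A : 'M[R]_(l, n)) := V b i * L' A a b.
transitivity (\sum_b \int[P]_w K b (random_mx X w)).
  apply: eq_bigr => b _; rewrite RintegralZl//; exact: (iX _ (tL' a b)).
rewrite -Rsum; last by move=> b; apply: tameM => //; exact: tame_cst.
congr Rintegral; apply/funext => w; rewrite -/(phi _).
transitivity ((V^T *m V *m L (phi (random_mx X w))) i a).
  rewrite -mulmxA mxE; apply: eq_bigr => b _; rewrite /K L'E !mxE; congr (_ * _).
by rewrite VTV mul1mx.
Qed.

End SteinRotation.

(** * The regularised inverse of the head Gram matrix *)

Section Dot.
Context {R : realType} {n : nat}.
Implicit Types x y : 'cV[R]_n.

Definition dot x y : R := (x^T *m y) 0 0.

Lemma dotE x y : dot x y = \sum_i x i 0 * y i 0.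
Proof. by rewrite /dot mxE; apply: eq_bigr => i _; rewrite mxE. Qed.

Lemma dotC x y : dot x y = dot y x.
Proof. by rewrite !dotE; apply: eq_bigr => i _; rewrite mulrC. Qed.

Lemma dotDr x y z : dot x (y + z) = dot x y + dot x z.
Proof. by rewrite /dot mulmxDr mxE. Qed.

Lemma dotBr x y z : dot x (y - z) = dot x y - dot x z.
Proof. by rewrite /dot mulmxBr !mxE. Qed.

Lemma dotZr c x y : dot x (c *: y) = c * dot x y.
Proof. by rewrite /dot -scalemxAr mxE. Qed.

Lemma dot_ge0 x : 0 <= dot x x.
Proof. by rewrite dotE; apply: sumr_ge0 => i _; rewrite -expr2 sqr_ge0. Qed.

Lemma dot_sqr x : dot x x = \sum_i x i 0 ^+ 2.
Proof. by rewrite dotE; apply: eq_bigr => i _; rewrite expr2. Qed.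

Lemma sqr_le_dot x i : x i 0 ^+ 2 <= dot x x.
Proof.
rewrite dot_sqr (bigD1 i)//= lerDl sumr_ge0// => j _; exact: sqr_ge0.
Qed.

Lemma dot_eq0 x : (dot x x == 0) = (x == 0).
Proof.
apply/eqP/eqP => [x0|->]; last by rewrite /dot mulmx0 mxE.
apply/matrixP => i j; rewrite ord1 mxE; apply/eqP.
by rewrite -sqrf_eq0 eq_le sqr_ge0 andbT -x0 sqr_le_dot.
Qed.

Lemma dot_gt0 x : (0 < dot x x) = (x != 0).
Proof. by rewrite lt_def dot_ge0 dot_eq0 andbT. Qed.

Lemma dot_delta x i : dot x (delta_mx i 0) = x i 0.
Proof.
rewrite dotE (bigD1 i)//= mxE !eqxx mulr1 big1 ?addr0// => j /negbTE ji.
by rewrite mxE ji mulr0.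
Qed.

End Dot.

Lemma dot_mulmx (R : realType) (m n : nat) (A : 'M[R]_(m, n)) x y :
  dot x (A *m y) = dot (A^T *m x) y.
Proof. by rewrite /dot trmx_mul trmxK mulmxA. Qed.

Section Resolvent.
Context {R : realType} {n l : nat} (J : pred 'I_n) (eps : R).
Hypothesis eps0 : 0 < eps.
Local Notation M := 'M[R]_(n, l).
Implicit Types (A D : M).

(* Projector onto the coordinates in [J]; [gram], [ridge] and [resolvent] only see
   the rows of [A] in [J]. *)
Definition mask : 'M[R]_n := diag_mx (\row_i (J i)%:R).

Lemma mask_sym : mask^T = mask. Proof. exact: tr_diag_mx. Qed.

Lemma mask_idem : mask *m mask = mask.
Proof.
rewrite mulmx_diag; congr diag_mx; apply/rowP => i; rewrite !mxE.
by case: (J i); rewrite ?mulr1 ?mulr0.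
Qed.

Lemma mask_mulE p (B : 'M[R]_(n, p)) i j : (mask *m B) i j = (J i)%:R * B i j.
Proof. by rewrite mul_diag_mx !mxE. Qed.

Definition gram A : 'M[R]_n := mask *m A *m A^T *m mask.
Definition ridge A : 'M[R]_n := gram A + eps%:M.
Definition resolvent A : 'M[R]_n := invmx (ridge A).

Lemma gram_sym A : (gram A)^T = gram A.
Proof. by rewrite /gram !trmx_mul trmxK mask_sym !mulmxA. Qed.

Lemma ridge_sym A : (ridge A)^T = ridge A.
Proof. by rewrite /ridge raddfD/= gram_sym tr_scalar_mx. Qed.

Lemma dot_gram A x : dot x (gram A *m x) =
  dot (A^T *m (mask *m x)) (A^T *m (mask *m x)).
Proof.
by rewrite /dot /gram !trmx_mul mask_sym !trmxK !mulmxA.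
Qed.

Lemma dot_ridge A x : dot x (ridge A *m x) = dot x (gram A *m x) + eps * dot x x.
Proof. by rewrite mulmxDl dotDr mul_scalar_mx dotZr. Qed.

Lemma dot_ridge_ge A x : eps * dot x x <= dot x (ridge A *m x).
Proof. by rewrite dot_ridge lerDr dot_gram dot_ge0. Qed.

Lemma ridge_unit A : ridge A \in unitmx.
Proof.
rewrite -row_free_unit -kermx_eq0; apply/eqP/row_matrixP => i.
rewrite row0; set u := row i _.
have uR : u *m ridge A = 0.
  by apply/sub_kermxP; exact: row_sub.
have uR' : ridge A *m u^T = 0 by rewrite -[ridge A]ridge_sym -trmx_mul uR trmx0.
have := dot_ridge_ge A u^T; rewrite uR' {2}/dot mulmx0 mxE.
rewrite pmulr_rle0// => u0; apply: trmx_inj; rewrite trmx0; apply/eqP.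
by rewrite -dot_eq0 eq_le u0 dot_ge0.
Qed.

Lemma resolvent_sym A : (resolvent A)^T = resolvent A.
Proof. by rewrite /resolvent trmx_inv ridge_sym. Qed.

Lemma resolventK A : ridge A *m resolvent A = 1%:M.
Proof. exact/mulmxV/ridge_unit. Qed.

Lemma gram_resolvent A : gram A *m resolvent A = 1%:M - eps *: resolvent A.
Proof. by rewrite -(resolventK A) mulmxDl mul_scalar_mx addrK. Qed.

Lemma resolvent_gram A : resolvent A *m gram A = 1%:M - eps *: resolvent A.
Proof.
apply: trmx_inj; rewrite trmx_mul gram_sym resolvent_sym gram_resolvent.
by rewrite [RHS]linearB/= [in RHS]linearZ/= resolvent_sym tr_scalar_mx.
Qed.

Lemma dot_resolvent_ge A x : eps * dot (resolvent A *m x) (resolvent A *m x)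
  <= dot x (resolvent A *m x).
Proof.
by apply: (le_trans (dot_ridge_ge A _)); rewrite mulmxA resolventK mul1mx dotC.
Qed.

Lemma dot_resolvent_ge0 A x : 0 <= dot x (resolvent A *m x).
Proof.
apply: le_trans (dot_resolvent_ge A x); rewrite mulr_ge0 ?dot_ge0//; exact: ltW.
Qed.

Lemma resolvent_entry A i j : resolvent A i j = dot (delta_mx i 0) (resolvent A *m delta_mx j 0).
Proof. by rewrite dotC dot_delta -colE mxE. Qed.

(** If [w] is the [j]-th column, then [eps * w_i^2 <= eps * |w|^2 <= w_j]. The case [i = j] gives
    [w_j <= eps^-1], and then every other entry follows. *)
Lemma resolvent_bounded A i j : `|resolvent A i j| <= eps^-1.
Proof.
set w := resolvent A *m (delta_mx j 0 : 'cV_n).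
have wE i' : w i' 0 = resolvent A i' j by rewrite /w -colE mxE.
have H i' : eps * w i' 0 ^+ 2 <= w j 0.
  apply: (@le_trans _ _ (eps * dot w w)); first by rewrite ler_pM2l// sqr_le_dot.
  by apply: (le_trans (dot_resolvent_ge A _)); rewrite -/w dotC dot_delta.
have wj0 : 0 <= w j 0.
  by apply: le_trans (H j); rewrite mulr_ge0 ?sqr_ge0 ?ltW.
have wj : w j 0 <= eps^-1.
  have [->|wj0'] := eqVneq (w j 0) 0; first by rewrite invr_ge0 ltW.
  rewrite -(ler_pM2l (x := eps * w j 0)); last by rewrite mulr_gt0// lt_def wj0' wj0.
  by rewrite -mulrA -expr2 (le_trans (H j))// mulrAC divff ?mul1r ?gt_eqF.
rewrite -wE -(@ler_pXn2r _ 2)// ?nnegrE ?invr_ge0 ?(ltW eps0)//.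
rewrite real_normK ?num_real//.
rewrite -(ler_pM2l eps0) (le_trans (H i))// expr2 mulrA divff ?mul1r ?gt_eqF//.
Qed.

Lemma smooth_prod (I : Type) (r : seq I) (p : pred I) (F : I -> M -> R) :
  (forall i, smooth (F i)) -> smooth (fun A => \prod_(i <- r | p i) F i A).
Proof.
move=> tF; elim: r => [|i r IH].
  by under eq_fun do rewrite big_nil; exact: smooth_cst.
under eq_fun do rewrite big_cons.
by case: (boolP (p i)) => // pi; apply: smoothM.
Qed.

Lemma smooth_det k (B : M -> 'M[R]_k) : (forall i j, smooth (fun A => B A i j)) ->
  smooth (fun A => \det (B A)).
Proof.
move=> sB; rewrite /determinant; apply: smooth_sum => s _.
by apply: smoothM; [exact: smooth_cst|exact: smooth_prod].
Qed.

Lemma smooth_ridge i j : smooth (fun A => ridge A i j).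
Proof.
have E A : ridge A i j =
    \sum_a ((J i)%:R * A i a) * (A j a * (J j)%:R) + eps *+ (i == j).
  rewrite /ridge [LHS]mxE [eps%:M _ _]mxE; congr (_ + _).
  rewrite /gram -mulmxA [LHS]mxE; apply: eq_bigr => a _.
  by rewrite mask_mulE mul_mx_diag !mxE.
under eq_fun do rewrite E; apply: smoothD; last exact: smooth_cst.
by apply: smooth_sum => a _; apply: smoothM;
  apply: smoothM; (exact: smooth_cst || exact: smooth_coord).
Qed.

Lemma smooth_adj i j : smooth (fun A => (\adj (ridge A)) i j).
Proof.
have E A : (\adj (ridge A)) i j =
    (-1) ^+ (j + i) * \det (row' j (col' i (ridge A))) by rewrite mxE.
under eq_fun do rewrite E; apply: smoothM; first exact: smooth_cst.
apply: smooth_det => i' j'; rewrite (_ : (fun A => _) =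
    (fun A => ridge A (lift j i') (lift i j'))); last first.
  by apply/funext => A; rewrite mxE [LHS]mxE.
exact: smooth_ridge.
Qed.

Lemma resolventE A i j : resolvent A i j = (\det (ridge A))^-1 * (\adj (ridge A)) i j.
Proof. by rewrite /resolvent /invmx ridge_unit mxE. Qed.

Lemma det_ridge_neq0 A : \det (ridge A) != 0.
Proof. by have := ridge_unit A; rewrite unitmxE unitfE. Qed.

Lemma tame_resolvent i j : tame (fun A => resolvent A i j).
Proof.
have [cd md _] := smooth_tame (smooth_det smooth_ridge).
have [ca ma _] := smooth_tame (smooth_adj i j).
split; last by apply: (poly_growth_bounded (C := eps^-1)) => A; exact: resolvent_bounded.
  under eq_fun do rewrite resolventE.
  move=> A; apply: (@continuousM _ _ (fun A => (\det (ridge A))^-1)); last exact: ca.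
  by apply: continuousV; [exact: det_ridge_neq0|exact: cd].
move=> d S Z mZ.
(* The measurable function [powR] with exponent [-1] is the inverse on nonnegative reals only, hence
   the detour through the square of the determinant. *)
have E s : resolvent (Z s) i j = \det (ridge (Z s)) * (\det (ridge (Z s)) ^+ 2) `^ (-1)
    * (\adj (ridge (Z s))) i j.
  rewrite resolventE powR_inv1 ?sqr_ge0//; congr (_ * _).
  by rewrite expr2 invfM mulrA divff ?mul1r// det_ridge_neq0.
under eq_fun do rewrite E; apply: measurable_funM; last exact: ma.
apply: measurable_funM; first exact: md.
apply: (measurableT_comp (measurable_powR (-1))).
by apply: measurable_funX; exact: md.
Qed.

End Resolvent.

Section DerivePointwise.
Context {R : realType} {V : normedModType R}.
Implicit Types (f g : V -> R) (x v : V) (df dg : R).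

Lemma is_derive_mul f g x v df dg : is_derive x v f df -> is_derive x v g dg ->
  is_derive x v (fun y => f y * g y) (df * g x + f x * dg).
Proof.
move=> fdf gdg; have -> : df * g x + f x * dg = f x *: dg + g x *: df :> R.
  by rewrite /GRing.scale/= addrC (mulrC df).
exact: is_deriveM fdf gdg.
Qed.

Lemma is_derive_add f g x v df dg : is_derive x v f df -> is_derive x v g dg ->
  is_derive x v (fun y => f y + g y) (df + dg).
Proof. by move=> fdf gdg; exact: is_deriveD fdf gdg. Qed.

Lemma is_derive_bigsum (I : Type) (r : seq I) (F : I -> V -> R) (dF : I -> R) x v :
  (forall i, is_derive x v (F i) (dF i)) ->
  is_derive x v (fun y => \sum_(i <- r) F i y) (\sum_(i <- r) dF i).
Proof.
move=> H; elim: r => [|i r IH].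
  by under eq_fun do rewrite big_nil; rewrite big_nil; exact: is_derive_cst.
by under eq_fun do rewrite big_cons; rewrite big_cons; exact: is_derive_add.
Qed.

Lemma is_derive_exp f p x v df : is_derive x v f df ->
  is_derive x v (fun y => f y ^+ p) (p%:R * f x ^+ p.-1 * df).
Proof.
move=> fdf; elim: p => [|p IH].
  by under eq_fun do rewrite expr0; rewrite !mul0r; exact: is_derive_cst.
under eq_fun do rewrite exprS.
have -> : p.+1%:R * f x ^+ p.+1.-1 * df =
    df * f x ^+ p + f x * (p%:R * f x ^+ p.-1 * df).
  rewrite /= -natr1; case: p {IH} => [|p] /=; first by rewrite expr0; ring.
  by rewrite exprS; ring.
exact: is_derive_mul.
Qed.

End DerivePointwise.

Section ResolventDerivative.
Context {R : realType} {n l : nat} (J : pred 'I_n) (eps : R).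
Hypothesis eps0 : 0 < eps.
Local Notation M := 'M[R]_(n, l).
Local Notation mask := (@mask R n J).
Local Notation gram := (@gram R n l J).
Local Notation ridge := (@ridge R n l J eps).
Local Notation resolvent := (@resolvent R n l J eps).
Implicit Types (A D : M).

Definition dgram A D : 'M[R]_n :=
  mask *m D *m A^T *m mask + mask *m A *m D^T *m mask.

Lemma is_derive_ridge A D i j :
  is_derive A D (fun A => ridge A i j) (dgram A D i j).
Proof.
have E (B C : M) : (mask *m B *m C^T *m mask) i j =
    \sum_a ((J i)%:R * B i a) * ((J j)%:R * C j a).
  rewrite -mulmxA [LHS]mxE; apply: eq_bigr => a _.
  by rewrite mask_mulE mul_mx_diag !mxE [_ * C j a]mulrC.
have E' A' : ridge A' i j = \sum_a ((J i)%:R * A' i a) * ((J j)%:R * A' j a)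
    + eps *+ (i == j).
  by rewrite /ridge [LHS]mxE [eps%:M _ _]mxE E.
under eq_fun do rewrite E'.
have Ed : dgram A D i j = \sum_a (((J i)%:R * D i a) * ((J j)%:R * A j a) +
    ((J i)%:R * A i a) * ((J j)%:R * D j a)) + 0.
  by rewrite /dgram [LHS]mxE !E -big_split addr0.
rewrite Ed; apply: is_derive_add.
have H c i' a : is_derive A D (fun A => c * A i' a) (c * D i' a).
  have -> : c * D i' a = 0 * A i' a + c * D i' a by rewrite mul0r add0r.
  by apply: is_derive_mul; exact: is_derive_coord.
by apply: is_derive_bigsum => a; apply: is_derive_mul; exact: H.
Qed.

Lemma derivable_resolvent A D i j : derivable (fun A => resolvent A i j) A D.
Proof.
have H (f : M -> R) : smooth f -> derivable f A D.
  by move=> [_ [L fL _]]; case: (fL A D).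
under eq_fun do rewrite (resolventE J eps0).
apply: derivableM; last exact/H/smooth_adj.
apply: derivableV; first exact: det_ridge_neq0.
apply: H; apply: smooth_det; exact: smooth_ridge.
Qed.

(** Cramer's rule gives differentiability; the value then follows by differentiating the constant
    [ridge A *m resolvent A = 1] and solving for the unknown derivative. *)
Lemma is_derive_resolvent A D i j : is_derive A D (fun A => resolvent A i j)
  ((- (resolvent A *m dgram A D *m resolvent A)) i j).
Proof.
pose R' : 'M[R]_n := \matrix_(i, j) 'D_D (fun A => resolvent A i j) A.
have HR' i' j' : is_derive A D (fun A => resolvent A i' j') (R' i' j').
  by rewrite mxE; apply: derivableP; exact: derivable_resolvent.
suff -> : - (resolvent A *m dgram A D *m resolvent A) = R' by exact: HR'.
have E : ridge A *m R' + dgram A D *m resolvent A = 0.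
  apply/matrixP => i' j'.
  have : is_derive A D (fun A => \sum_k ridge A i' k * resolvent A k j')
      (\sum_k (dgram A D i' k * resolvent A k j' + ridge A i' k * R' k j')).
    by apply: is_derive_bigsum => k; apply: is_derive_mul => //; exact: is_derive_ridge.
  have -> : (fun A => \sum_k ridge A i' k * resolvent A k j') = cst ((1%:M : 'M[R]_n) i' j').
    by apply/funext => B; rewrite -(resolventK J eps0 B) [RHS]mxE.
  move=> [_ H]; have := derive_cst ((1%:M : 'M[R]_n) i' j') A D; rewrite H => S0.
  rewrite [LHS]mxE [RHS]mxE -[RHS]S0 big_split/= addrC.
  by congr (_ + _); rewrite mxE.
have : resolvent A *m (ridge A *m R') = - (resolvent A *m dgram A D *m resolvent A).
  have -> : ridge A *m R' = - (dgram A D *m resolvent A).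
    by rewrite -(addr0_eq E) opprK.
  by rewrite mulmxN mulmxA.
by rewrite mulmxA /resolvent mulVmx ?ridge_unit// mul1mx => ->.
Qed.

Lemma smooth_resolvent i j : smooth (fun A => resolvent A i j).
Proof.
split; first exact: tame_resolvent.
pose P A := resolvent A *m mask.
pose Q A := A^T *m mask *m resolvent A.
(* The gradient is read off after writing [resolvent *m dgram *m resolvent] as
   [P D Q + Q^T D^T P^T], which is linear in the entries of [D]. *)
exists (fun A => \matrix_(i', a) - (P A i i' * Q A a j + Q A a i * P A j i')).
  move=> A D; apply: is_derive_eq; first exact: is_derive_resolvent.
  have QT : (Q A)^T = resolvent A *m mask *m A.
    by rewrite /Q !trmx_mul trmxK mask_sym resolvent_sym mulmxA.
  have PT : (P A)^T = mask *m resolvent A by rewrite /P trmx_mul mask_sym resolvent_sym.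
  have -> : resolvent A *m dgram A D *m resolvent A =
      P A *m (D *m Q A) + (Q A)^T *m (D^T *m (P A)^T).
    by rewrite QT PT /P /Q /dgram mulmxDr mulmxDl !mulmxA.
  have E : (P A *m (D *m Q A) + (Q A)^T *m (D^T *m (P A)^T)) i j =
      \sum_i' \sum_a (P A i i' * Q A a j + Q A a i * P A j i') * D i' a.
    rewrite [LHS]mxE; under [RHS]eq_bigr => i' _ do
      (under eq_bigr do rewrite mulrDl; rewrite big_split/=).
    rewrite big_split/=; congr (_ + _).
      rewrite [LHS]mxE; apply: eq_bigr => i' _; rewrite [(D *m _) _ _]mxE mulr_sumr.
      by apply: eq_bigr => a _; rewrite -mulrA (mulrC (D _ _)).
    rewrite [LHS]mxE exchange_big; apply: eq_bigr => a _ /=.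
    rewrite [(D^T *m _) _ _]mxE mulr_sumr; apply: eq_bigr => i' _.
    by rewrite [(Q A)^T _ _]mxE [D^T _ _]mxE [(P A)^T _ _]mxE -mulrA (mulrC (D _ _)).
  rewrite [LHS]mxE E -sumrN; apply: eq_bigr => i' _; rewrite -sumrN.
  by apply: eq_bigr => a _; rewrite [X in _ = X * _]mxE mulNr.
have tP i' j' : tame (fun A => P A i' j').
  have E A : P A i' j' = resolvent A i' j' * (J j')%:R.
    by rewrite /P mul_mx_diag !mxE.
  under eq_fun do rewrite E.
  by apply: tameM; [exact: tame_resolvent|exact: tame_cst].
have tQ a' j' : tame (fun A => Q A a' j').
  have E A : Q A a' j' = \sum_i' A i' a' * (J i')%:R * resolvent A i' j'.
    rewrite /Q [LHS]mxE; apply: eq_bigr => i' _; congr (_ * _).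
    by rewrite mul_mx_diag !mxE.
  under eq_fun do rewrite E.
  apply: tame_sum => i' _; apply: tameM; last exact: tame_resolvent.
  by apply: tameM; [exact: tame_coord|exact: tame_cst].
move=> i' a.
have E A : (\matrix_(i', a) - (P A i i' * Q A a j + Q A a i * P A j i')) i' a =
    -1 * (P A i i' * Q A a j + Q A a i * P A j i') by rewrite mxE mulN1r.
under eq_fun do rewrite E.
by apply: tameM; [exact: tame_cst|apply: tameD; exact: tameM].
Qed.

End ResolventDerivative.

Section ResolventForms.
Context {R : realType} {n l : nat} (J : pred 'I_n) (eps : R) (v : 'cV[R]_n).
Hypothesis eps0 : 0 < eps.
Hypothesis Jv : mask J *m v = v.
Local Notation M := 'M[R]_(n, l).
Local Notation mask := (@mask R n J).
Local Notation gram := (@gram R n l J).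
Local Notation ridge := (@ridge R n l J eps).
Local Notation res := (@resolvent R n l J eps).
Local Notation dres A D := (- (res A *m dgram J A D *m res A)).
Implicit Types (A D : M).

Lemma dot_res_sum (p q : 'cV[R]_n) (B : 'M[R]_n) :
  dot p (B *m q) = \sum_i \sum_j p i 0 * B i j * q j 0.
Proof.
rewrite dotE; apply: eq_bigr => i _; rewrite mxE mulr_sumr.
by apply: eq_bigr => j _; rewrite mulrA.
Qed.

Lemma smooth_dot_res (p q : 'cV[R]_n) : smooth (fun A => dot p (res A *m q)).
Proof.
under eq_fun do rewrite dot_res_sum.
apply: smooth_sum => i _; apply: smooth_sum => j _; apply: smoothM; last exact: smooth_cst.
by apply: smoothM; [exact: smooth_cst|exact: smooth_resolvent].
Qed.

Lemma is_derive_dot_res (p q : 'cV[R]_n) A D :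
  is_derive A D (fun A => dot p (res A *m q)) (dot p (dres A D *m q)).
Proof.
under eq_fun do rewrite dot_res_sum.
rewrite dot_res_sum.
apply: is_derive_bigsum => i; apply: is_derive_bigsum => j.
have -> : p i 0 * (dres A D) i j * q j 0 =
  (0 * res A i j + p i 0 * (dres A D) i j) * q j 0 + p i 0 * res A i j * 0 by ring.
apply: is_derive_mul; apply: is_derive_mul; exact: is_derive_resolvent.
Qed.

Definition xform A : R := dot v (res A *m v).
(** With [H = mask *m A] this is [H^T (H H^T + eps)^-1 v], the regularised minimum-norm solution [z]
    of [H z = v]. *)
Definition zvec A : 'cV[R]_l := A^T *m (mask *m (res A *m v)).
Definition zform A : R := dot (zvec A) (zvec A).

Lemma zvecE A a : zvec A a 0 = \sum_i A i a * dot ((J i)%:R *: delta_mx i 0) (res A *m v).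
Proof.
rewrite mxE; apply: eq_bigr => i _; rewrite mxE mask_mulE dotC dotZr dot_delta.
by [].
Qed.

Lemma smooth_xform : smooth xform. Proof. exact: smooth_dot_res. Qed.

Lemma smooth_zvec a : smooth (fun A => zvec A a 0).
Proof.
under eq_fun do rewrite zvecE; apply: smooth_sum => i _.
by apply: smoothM; [exact: smooth_coord|exact: smooth_dot_res].
Qed.

Lemma zformE A : zform A = \sum_a zvec A a 0 ^+ 2. Proof. exact: dot_sqr. Qed.

Lemma smooth_zform : smooth zform.
Proof.
have -> : zform = (fun A => \sum_a zvec A a 0 ^+ 2) by apply/funext => A; exact: zformE.
apply: smooth_sum => a _.
exact/smoothX/smooth_zvec.
Qed.

Lemma is_derive_zvec A D a : is_derive A D (fun A => zvec A a 0)
  ((D^T *m (mask *m (res A *m v)) + A^T *m (mask *m (dres A D *m v))) a 0).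
Proof.
under eq_fun do rewrite zvecE.
have -> : (D^T *m (mask *m (res A *m v)) + A^T *m (mask *m (dres A D *m v))) a 0 =
    \sum_i (D i a * dot ((J i)%:R *: delta_mx i 0) (res A *m v)
      + A i a * dot ((J i)%:R *: delta_mx i 0) (dres A D *m v)).
  rewrite [LHS]mxE big_split/=; congr (_ + _); rewrite [LHS]mxE; apply: eq_bigr => i _;
    by rewrite mxE mask_mulE dotC dotZr dot_delta.
apply: is_derive_bigsum => i; apply: is_derive_mul; first exact: is_derive_coord.
exact: is_derive_dot_res.
Qed.

Lemma xform_ge0 A : 0 <= xform A. Proof. exact: dot_resolvent_ge0. Qed.

Lemma zform_ge0 A : 0 <= zform A. Proof. exact: dot_ge0. Qed.

Lemma zform_le A : zform A <= xform A.
Proof.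
have -> : zform A = dot (res A *m v) (gram A *m (res A *m v)) by rewrite dot_gram.
rewrite mulmxA gram_resolvent// mulmxBl mul1mx dotBr -scalemxAl dotZr.
by rewrite /xform dotC gerBl mulr_ge0 ?dot_ge0// ltW.
Qed.

(** The left side is what gets integrated by parts: its first factors are linear forms in the
    columns, while the sum is deterministic up to a term of favourable sign. *)
Lemma sum_zvec A : \sum_a (\sum_i v i 0 * A i a) * zvec A a 0 = dot v v - eps * xform A.
Proof.
transitivity (dot (A^T *m v) (zvec A)).
  rewrite dotE; apply: eq_bigr => a _; congr (_ * _).
  by rewrite mxE; apply: eq_bigr => i _; rewrite mxE mulrC.
have -> : dot (A^T *m v) (zvec A) = dot v (gram A *m res A *m v).
  rewrite -[X in A^T *m X]Jv /dot !trmx_mul trmxK mask_sym /zvec /gram.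
  by rewrite -Jv !trmx_mul mask_sym Jv !mulmxA -!(mulmxA _ mask mask) mask_idem.
by rewrite gram_resolvent// mulmxBl mul1mx dotBr -scalemxAl dotZr.
Qed.

(** Regularised leverage score of column [a] of the head. The scores sum to a trace bounded by the
    number of head rows. *)
Definition hform A a : R := dot (mask *m A *m delta_mx a 0) (res A *m (mask *m A *m delta_mx a 0)).

Lemma sum_hform A : \sum_a hform A a <= (\sum_(i | J i) 1).
Proof.
have -> : \sum_a hform A a = \tr (res A *m gram A).
  transitivity (\tr ((mask *m A)^T *m (res A *m (mask *m A)))).
    apply: eq_bigr => a _; rewrite /hform mulmxA -!colE dotE [RHS]mxE.
    by apply: eq_bigr => i _; rewrite [col _ _ _ _]mxE [col _ (_ *m _) _ _]mxE [_^T _ _]mxE.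
  rewrite mxtrace_mulC /gram -!mulmxA; congr (\tr (_ *m _)).
  by rewrite trmx_mul mask_sym.
have -> : res A *m gram A = mask - eps *: (res A *m mask).
  have -> : mask - eps *: (res A *m mask) = (1%:M - eps *: res A) *m mask.
    by rewrite mulmxBl mul1mx -scalemxAl.
  rewrite -resolvent_gram// -mulmxA.
  by rewrite /gram -!mulmxA mask_idem.
rewrite linearB/= linearZ/=.
have -> : \tr mask = \sum_(i | J i) 1.
  rewrite mxtrace_diag [RHS]big_mkcond/=; apply: eq_bigr => i _; rewrite mxE.
  by case: (J i).
rewrite gerBl mulr_ge0 ?(ltW eps0)//; apply: sumr_ge0 => i _.
have -> : (res A *m mask) i i = res A i i * (J i)%:R by rewrite mul_mx_diag !mxE.
by rewrite mulr_ge0// resolvent_entry dot_resolvent_ge0.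
Qed.

Lemma zvec_dot A a :
  zvec A a 0 = dot (mask *m A *m (delta_mx a 0 : 'cV_l)) (res A *m v).
Proof. by rewrite -dot_delta dotC /zvec /dot !trmx_mul mask_sym !mulmxA. Qed.

(** Moving column [a] in the direction [v] changes the Gram matrix by the rank-two matrix
    [v g^T + g v^T]. Hence the derivatives of [xform] and [zvec] in this direction are polynomials
    in [xform], [zvec] and [hform], and the recursion for the moments closes. *)
Lemma dot_dres (p : 'cV[R]_n) A a : let D := v *m delta_mx 0 a in
  let g := mask *m A *m (delta_mx a 0 : 'cV_l) in
  dot p (dres A D *m v) = - (dot p (res A *m v) * zvec A a 0 + dot p (res A *m g) * xform A).
Proof.
move=> D g.
have gE := zvec_dot A a; rewrite -/g in gE.
have dgE : dgram J A D = v *m g^T + g *m v^T.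
  have vm : v^T *m mask = v^T by rewrite -{1}mask_sym -trmx_mul Jv.
  rewrite /dgram /D /g !trmx_mul !mask_sym !trmx_delta !mulmxA Jv.
  by rewrite -(mulmxA _ v^T mask) vm.
have E : (v *m g^T + g *m v^T) *m (res A *m v) = zvec A a 0 *: v + xform A *: g.
  have H (u : 'cV[R]_n) (B : 'M[R]_(1, 1)) : u *m B = B 0 0 *: u.
    by rewrite {1}[B]mx11_scalar mul_mx_scalar.
  by rewrite mulmxDl -(mulmxA v) -(mulmxA g) !H gE.
rewrite dgE mulNmx. set W := _ + _ in E *. have -> : res A *m W *m res A *m v = res A *m (W *m (res A *m v)) by rewrite !mulmxA. rewrite E.
rewrite mulmxDr -!scalemxAr -scaleN1r dotZr dotDr !dotZr.
by ring.
Qed.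

Lemma is_derive_xform A a :
  is_derive A (v *m delta_mx 0 a) xform (- (2 * xform A * zvec A a 0)).
Proof.
have -> : - (2 * xform A * zvec A a 0) = dot v (dres A (v *m delta_mx 0 a) *m v).
  rewrite dot_dres -/(xform A).
  have -> : dot v (res A *m (mask *m A *m delta_mx a 0)) = zvec A a 0.
    by rewrite dot_mulmx resolvent_sym dotC -zvec_dot.
  by ring.
exact: is_derive_dot_res.
Qed.

Lemma is_derive_zvec_v A a : is_derive A (v *m delta_mx 0 a) (fun A => zvec A a 0)
  (xform A * (1 - hform A a) - zvec A a 0 ^+ 2).
Proof.
have -> : xform A * (1 - hform A a) - zvec A a 0 ^+ 2 =
  (((v *m delta_mx 0 a)^T *m (mask *m (res A *m v)) + A^T *m (mask *m (dres A (v *m delta_mx 0 a) *m v))) a 0).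
  rewrite [RHS]mxE; set g := mask *m A *m (delta_mx a 0 : 'cV_l).
  have -> : ((v *m delta_mx 0 a)^T *m (mask *m (res A *m v))) a 0 = xform A.
    have vm : v^T *m mask = v^T by rewrite -{1}mask_sym -trmx_mul Jv.
    by rewrite trmx_mul trmx_delta -mulmxA (mulmxA v^T) vm mxE big_ord1 mxE !eqxx mul1r.
  have -> : (A^T *m (mask *m (dres A (v *m delta_mx 0 a) *m v))) a 0 =
      dot g (dres A (v *m delta_mx 0 a) *m v).
    by rewrite -dot_delta dotC /g /dot !trmx_mul mask_sym !mulmxA.
  rewrite dot_dres -/g /hform -/g.
  rewrite -zvec_dot.
  by ring.
exact: is_derive_zvec.
Qed.

End ResolventForms.

(** * Moments *)

Section Moments.
Context {d : measure_display} {T : measurableType d} {R : realType}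
  (P : probability T R) {n l : nat} (G : T -> 'M[R]_(n, l)) (tau : R).
Hypothesis tau0 : 0 < tau.
Hypothesis steinG : stein_matrix P G tau.
Local Notation M := 'M[R]_(n, l).
Local Notation E := (mean P G).
Implicit Types (A D : M).

Section LinearForms.
Variables (a0 : 'I_l).

Lemma moment_linear_form (c : 'cV[R]_n) p :
  E (fun A => (\sum_i c i 0 * A i a0) ^+ (2 * p)) =
  (tau * dot c c) ^+ p * \prod_(j < p) (1 + 2 * j%:R).
Proof.
pose u A := \sum_i c i 0 * A i a0.
have su : smooth u.
  by apply: smooth_sum => i _; apply: smoothM; [exact: smooth_cst|exact: smooth_coord].
have du A : is_derive A (c *m delta_mx 0 a0) u (dot c c).
  rewrite dotE; apply: is_derive_bigsum => i.
  have -> : c i 0 * c i 0 = 0 * A i a0 + c i 0 * (c *m delta_mx 0 a0) i a0.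
    by rewrite mul0r add0r mxE big_ord1 mxE !eqxx mulr1.
  by apply: is_derive_mul; exact: is_derive_coord.
elim: p => [|p IH]; first by rewrite big_ord0 muln0 !expr0 mulr1; exact: mean_cst.
rewrite big_ord_recr/= exprSr mulrACA -IH -/u.
transitivity (E (fun A => u A * u A ^+ (2 * p).+1)).
  by apply: eq_mean => A; rewrite -exprS mulnS.
have H := stein_direction steinG (smoothX (2 * p).+1 su)
  (fun A => is_derive_exp (2 * p).+1 (du A)).
apply: (etrans H); under eq_mean do rewrite mulrAC.
rewrite (meanZ steinG); last exact/tameX/smooth_tame.
by rewrite -natr1 natrM; ring.
Qed.

(** Moments of a scaled chi-square variable: write [N^(p+1)] as the sum of [A_i (A_i N^p)] and
    integrate each term by parts. The first factors give one [N^p] for each row in [J], and the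
    derivative of [N^p] gives [2p] more. *)
Lemma moment_column_norm (J : pred 'I_n) p :
  E (fun A => (\sum_(i | J i) A i a0 ^+ 2) ^+ p) =
  \prod_(j < p) (tau * (\sum_(i | J i) 1 + 2 * j%:R)).
Proof.
pose N A : R := \sum_(i | J i) A i a0 ^+ 2.
have sN : smooth N by apply: smooth_sum => i _; apply: smoothX; exact: smooth_coord.
elim: p => [|p IH]; first by rewrite big_ord0; under eq_mean do rewrite expr0; exact: mean_cst.
rewrite big_ord_recr/= -IH -/N.
have dN A i : J i -> is_derive A ((delta_mx i 0 : 'cV_n) *m delta_mx 0 a0) N (2 * A i a0).
  move=> Ji; have -> : N = (fun A => \sum_i' (J i')%:R * A i' a0 ^+ 2).
    apply/funext => B; rewrite /N big_mkcond; apply: eq_bigr => i' _.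
    by case: (J i'); rewrite ?mul1r ?mul0r.
  have -> : 2 * A i a0 = \sum_i' (0 * A i' a0 ^+ 2 + (J i')%:R *
      (2%:R * A i' a0 ^+ 2.-1 * ((delta_mx i 0 : 'cV[R]_n) *m delta_mx 0 a0) i' a0)).
    rewrite (bigD1 i)//= big1 => [|i' /negbTE i'i].
      by rewrite Ji mul_delta_mx mxE !eqxx /= expr1; ring.
    by rewrite mul_delta_mx mxE i'i /=; ring.
  apply: is_derive_bigsum => i'; apply: is_derive_mul; apply: is_derive_exp.
  exact: is_derive_coord.
transitivity (E (fun A => \sum_(i | J i) A i a0 * (A i a0 * N A ^+ p))).
  apply: eq_mean => A; rewrite exprS {1}/N mulr_suml; apply: eq_bigr => i _.
  by rewrite expr2 mulrA.
have tNp : tame (fun A => N A ^+ p) by exact/tameX/smooth_tame.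
have sf i : smooth (fun A => A i a0 * N A ^+ p).
  by apply: smoothM; [exact: smooth_coord|exact: smoothX].
pose psi i A := 1 * N A ^+ p + A i a0 * (p%:R * N A ^+ p.-1 * (2 * A i a0)).
have tpsi i : tame (psi i).
  apply: tameD; first by apply: tameM => //; exact: tame_cst.
  apply: tameM; first exact: tame_coord.
  apply: tameM; first by apply: tameM; [exact: tame_cst|exact/tameX/smooth_tame].
  by apply: tameM; [exact: tame_cst|exact: tame_coord].
rewrite (mean_sum steinG); last first.
  by move=> i _; apply: tameM; [exact: tame_coord|exact: smooth_tame].
have H i : J i -> E (fun A => A i a0 * (A i a0 * N A ^+ p)) = tau * E (psi i).
  move=> Ji.
  have df A : is_derive A ((delta_mx i 0 : 'cV_n) *m delta_mx 0 a0)
      (fun A => A i a0 * N A ^+ p) (psi i A).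
    apply: is_derive_mul; last by apply: is_derive_exp; exact: dN.
    have := is_derive_coord A ((delta_mx i 0 : 'cV[R]_n) *m delta_mx 0 a0) i a0.
    by rewrite mul_delta_mx mxE !eqxx.
  rewrite -(stein_direction steinG (sf i) df).
  apply: eq_mean => A; congr (_ * _); rewrite (bigD1 i)//= mxE !eqxx mul1r.
    by rewrite big1 ?addr0// => i' /negbTE i'i; rewrite mxE i'i mul0r.
rewrite (eq_bigr _ H) -mulr_sumr -(mean_sum steinG)//.
rewrite mulrCA; congr (_ * _).
rewrite mulrC -(meanZ steinG)//; apply: eq_mean => A.
rewrite /psi big_split/= mulrDl; congr (_ + _); first by rewrite -mulr_suml.
case: p {IH tNp sf psi tpsi H} => [|p].
  by rewrite big1 => [|i _]; rewrite !(mulr0, mul0r).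
under eq_bigr => i _.
  rewrite (_ : _ * _ = 2 * p.+1%:R * N A ^+ p * A i a0 ^+ 2); last by rewrite /=; ring.
  over.
by rewrite -mulr_sumr -/(N A) -mulrA -exprSr.
Qed.

End LinearForms.
End Moments.

(** The truncated predecessor in the derivative of a power is harmless: at [p = 0] the factor [p%:R]
    vanishes. *)
Lemma natr_exp_pred (R : comNzRingType) (c : R) p :
  p%:R * c ^+ p.-1 * c = p%:R * c ^+ p.
Proof. by case: p => [|p]; rewrite ?mul0r// -mulrA -exprSr. Qed.

Section QuadraticMoments.
Context {d : measure_display} {T : measurableType d} {R : realType}
  (P : probability T R) {n l : nat} (G : T -> 'M[R]_(n, l)) (tau : R).
Hypothesis tau0 : 0 < tau.
Hypothesis steinG : stein_matrix P G tau.
Variables (J : pred 'I_n) (eps : R) (v : 'cV[R]_n).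
Hypothesis eps0 : 0 < eps.
Hypothesis Jv : mask J *m v = v.
Local Notation M := 'M[R]_(n, l).
Local Notation E := (mean P G).
Local Notation x := (@xform R n l J eps v).
Local Notation z := (@zvec R n l J eps v).
Local Notation Y := (@zform R n l J eps v).
Local Notation h := (@hform R n l J eps).
Local Notation r := (\sum_(i | J i) (1 : R)).
Implicit Types (A D : M).

Let tx : tame x. Proof. exact/smooth_tame/smooth_xform. Qed.
Let tz a : tame (fun A => z A a 0). Proof. exact/smooth_tame/smooth_zvec. Qed.

Lemma tame_hform a : tame (fun A => h A a).
Proof.
have hE A : h A a = \sum_i \sum_j ((J i)%:R * A i a) * resolvent J eps A i j * ((J j)%:R * A j a).
  rewrite /hform dot_res_sum; apply: eq_bigr => i _; apply: eq_bigr => j _.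
  by rewrite -!mulmxA !mask_mulE -!colE !mxE.
under eq_fun do rewrite hE; apply: tame_sum => i _; apply: tame_sum => j _.
by apply: tameM; first apply: tameM; try exact: tame_resolvent;
  apply: tameM; (exact: tame_cst || exact: tame_coord).
Qed.

(* Integrate by parts [(v . A_a) (z_a x^p)], in the direction [v] of column [a], and sum
   over [a]; the negative moments of [gram] are thus bounded without its law. *)
Lemma moment_xform_step p :
  tau * (l%:R - r - 1 - 2 * p%:R) * E (fun A => x A ^+ p.+1) <=
  dot v v * E (fun A => x A ^+ p).
Proof.
pose psi a A := (x A * (1 - h A a) - z A a 0 ^+ 2) * x A ^+ p +
  z A a 0 * (p%:R * x A ^+ p.-1 * (- (2 * x A * z A a 0))).
have txp k : tame (fun A => x A ^+ k) by exact: tameX.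
have tc (c : R) : tame (fun _ : M => c) by exact: tame_cst.
have tpsi a : tame (psi a).
  apply: tameD.
    apply: tameM => //; apply: tameD.
      by apply: tameM => //; apply: tameD => //; under eq_fun do rewrite -mulN1r; apply: tameM => //; exact: tame_hform.
    by under eq_fun do rewrite -mulN1r; apply: tameM => //; exact: tameX.
  apply: tameM => //; apply: tameM; first exact: tameM.
  by under eq_fun do rewrite -mulN1r; apply: tameM => //; apply: tameM => //; exact: tameM.
have sf a : smooth (fun A => z A a 0 * x A ^+ p).
  by apply: smoothM; [exact: smooth_zvec|exact/smoothX/smooth_xform].
have H a : E (fun A => (\sum_i v i 0 * A i a) * (z A a 0 * x A ^+ p)) = tau * E (psi a).
  apply: (stein_direction steinG (sf a)) => A.
  by apply: is_derive_mul; [exact: is_derive_zvec_v|apply: is_derive_exp; exact: is_derive_xform].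
have HS : E (fun A => (dot v v - eps * x A) * x A ^+ p) =
    tau * E (fun A => \sum_a psi a A).
  rewrite (mean_sum steinG)// mulr_sumr -(eq_bigr _ (fun a _ => H a)).
  rewrite -(mean_sum steinG); last first.
    move=> a _; apply: tameM; last exact: smooth_tame.
    by apply: tame_sum => i _; apply: tameM => //; exact: tame_coord.
  apply: eq_mean => A; rewrite -(sum_zvec eps0 Jv A) mulr_suml.
  by apply: eq_bigr => a _; rewrite mulrA.
(* Origin of the degrees of freedom: the sum over [a] counts [l], loses [r] through [sum_hform], and
   loses [1 + 2p] through [zform_le]. *)
have psi_ge A : (l%:R - r - 1 - 2 * p%:R) * x A ^+ p.+1 <= \sum_a psi a A.
  have psiE a : psi a A = x A ^+ p.+1 - x A ^+ p.+1 * h A a -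
      (1 + 2 * p%:R) * x A ^+ p * z A a 0 ^+ 2.
    rewrite /psi [x A ^+ p.+1]exprS.
    rewrite [z A a 0 * (p%:R * _ * _)](_ : _ = - (2 * (p%:R * x A ^+ p.-1 * x A) * z A a 0 ^+ 2)); last by ring.
    by rewrite natr_exp_pred; ring.
  rewrite (eq_bigr _ (fun a _ => psiE a)) !sumrB [\sum_(a < l) x A ^+ p.+1]sumr_const card_ord -!mulr_sumr.
  rewrite -zformE -[x A ^+ p.+1 *+ l]mulr_natl.
  have x0 := xform_ge0 J v eps0 A.
  have h1 : x A ^+ p.+1 * \sum_a h A a <= x A ^+ p.+1 * r.
    by rewrite ler_wpM2l ?exprn_ge0//; exact: sum_hform.
  have h2 : (1 + 2 * p%:R) * x A ^+ p * Y A <= (1 + 2 * p%:R) * x A ^+ p * x A.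
    rewrite ler_wpM2l ?mulr_ge0 ?addr_ge0 ?mulr_ge0 ?exprn_ge0//; exact: zform_le.
  move: h1 h2; rewrite -[(1 + _) * _ * x A]mulrA -exprSr; lra.
apply: (@le_trans _ _ (tau * E (fun A => \sum_a psi a A))).
  rewrite -mulrA ler_pM2l// -(meanZ steinG)//; apply: (le_mean steinG) => //.
    by apply: tameM.
  by apply: tame_sum.
rewrite -HS -(meanZ steinG)//; apply: (le_mean steinG).
- apply: tameM => //; apply: tameD => //; under eq_fun do rewrite -mulNr.
  exact: tameM.
- exact: tameM.
move=> A; rewrite ler_wpM2r ?exprn_ge0 ?xform_ge0// gerBl mulr_ge0 ?xform_ge0//.
exact: ltW.
Qed.

(** For a Gaussian matrix the right side is the exact moment of the limit [eps -> 0], an inverse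
    chi-square variable with [l - r + 1] degrees of freedom, so the dropped terms cost nothing in
    the limit. *)
Lemma moment_xform p : (forall j, (j < p)%N -> 0 < l%:R - r - 1 - 2 * j%:R) ->
  E (fun A => x A ^+ p) <=
  dot v v ^+ p * \prod_(j < p) (tau * (l%:R - r - 1 - 2 * j%:R))^-1.
Proof.
elim: p => [|p IH] c0.
  by under eq_mean do rewrite expr0; rewrite mean_cst expr0 big_ord0 mulr1.
rewrite big_ord_recr/= mulrA ler_pdivlMr ?mulr_gt0 ?c0// mulrC.
apply: (le_trans (moment_xform_step p)); rewrite exprS -mulrA ler_wpM2l ?dot_ge0//.
by apply: IH => j jp; apply: c0; exact: ltnW.
Qed.

Section Tail.
Variables (s : 'I_n -> R) (S : R).
Hypothesis sJ : forall i, J i -> s i = 0.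
Hypothesis S0 : 0 <= S.
Hypothesis sS : forall i, s i ^+ 2 <= S.

Definition qform A i : R := \sum_a A i a * z A a 0.
(** The squared norm of [diag(s) A z]. Since [s] vanishes on [J], only the tail rows of [A] enter
    explicitly, and the head enters through [z]. *)
Definition Qform A : R := \sum_i s i ^+ 2 * qform A i ^+ 2.

Let sq i : smooth (fun A => qform A i).
Proof.
apply: smooth_sum => a _; apply: smoothM; [exact: smooth_coord|exact: smooth_zvec].
Qed.

Lemma smooth_Qform : smooth Qform.
Proof.
by apply: smooth_sum => i _; apply: smoothM; [exact: smooth_cst|exact: smoothX].
Qed.

Lemma Qform_ge0 A : 0 <= Qform A.
Proof. by apply: sumr_ge0 => i _; rewrite mulr_ge0 ?sqr_ge0. Qed.

Let D i a : M := (delta_mx i 0 : 'cV_n) *m delta_mx 0 a.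

Let DE i a i' b : D i a i' b = ((i' == i) && (b == a))%:R.
Proof. by rewrite /D mul_delta_mx mxE. Qed.

Let maskD i a : ~~ J i -> mask J *m D i a = 0.
Proof.
move=> /negbTE Ji; apply/matrixP => i' b; rewrite mask_mulE DE mxE.
by case: eqVneq => [->|]; rewrite ?Ji ?mul0r// mulr0.
Qed.

Let dz A i a b : ~~ J i -> is_derive A (D i a) (fun A => z A b 0) 0.
Proof.
move=> Ji; have := is_derive_zvec J v eps0 A (D i a) b.
have -> : dgram J A (D i a) = 0.
  rewrite /dgram maskD// !mul0mx add0r.
  have -> : mask J *m A *m (D i a)^T *m mask J = mask J *m A *m (mask J *m D i a)^T.
    by rewrite [(mask J *m _)^T]trmx_mul mask_sym !mulmxA.
  by rewrite maskD// trmx0 mulmx0.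
rewrite !(mulmx0, mul0mx, oppr0) addr0 mulmxA.
have -> : (D i a)^T *m mask J = (mask J *m D i a)^T.
  by rewrite [(mask J *m _)^T]trmx_mul mask_sym.
by rewrite maskD// trmx0 mul0mx mxE.
Qed.

Let dY A i a : ~~ J i -> is_derive A (D i a) Y 0.
Proof.
move=> Ji; have -> : Y = (fun A => \sum_a z A a 0 ^+ 2).
  by apply/funext => B; exact: zformE.
have H : is_derive A (D i a) (fun A => \sum_a z A a 0 ^+ 2)
    (\sum_b 2%:R * z A b 0 ^+ 2.-1 * 0).
  by apply: is_derive_bigsum => b; apply: is_derive_exp; exact: dz.
by move: H; rewrite [X in is_derive _ _ _ X]big1// => b _; rewrite mulr0.
Qed.

Let dq A i a i' : ~~ J i ->
  is_derive A (D i a) (fun A => qform A i') ((i' == i)%:R * z A a 0).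
Proof.
move=> Ji; have -> : (i' == i)%:R * z A a 0 =
    \sum_b (D i a i' b * z A b 0 + A i' b * 0).
  rewrite (bigD1 a)//= big1 => [|b /negbTE ba]; rewrite DE.
    by rewrite eqxx andbT mulr0 !addr0.
  by rewrite ba andbF mul0r mulr0 addr0.
apply: is_derive_bigsum => b; apply: is_derive_mul; first exact: is_derive_coord.
exact: dz.
Qed.

Let dQ A i a : ~~ J i ->
  is_derive A (D i a) Qform (2 * s i ^+ 2 * qform A i * z A a 0).
Proof.
move=> Ji; have -> : 2 * s i ^+ 2 * qform A i * z A a 0 =
    \sum_i' (0 * qform A i' ^+ 2 + s i' ^+ 2 *
      (2%:R * qform A i' ^+ 2.-1 * ((i' == i)%:R * z A a 0))).
  rewrite (bigD1 i)//= big1 => [|i' /negbTE i'i].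
    by rewrite eqxx /= expr1; ring.
  by rewrite i'i /=; ring.
apply: is_derive_bigsum => i'; apply: is_derive_mul; apply: is_derive_exp.
exact: dq.
Qed.

(* Integrate by parts over the rows outside [J], on which [z] does not depend. *)
Lemma moment_Qform_step e b :
  E (fun A => Y A ^+ e * Qform A ^+ b.+1) <=
  tau * (\sum_i s i ^+ 2 + 2 * b%:R * S) * E (fun A => Y A ^+ e.+1 * Qform A ^+ b).
Proof.
have tc (c : R) : tame (fun _ : M => c) by exact: tame_cst.
have tQ := smooth_tame smooth_Qform.
have tY : tame Y by exact/smooth_tame/smooth_zform.
have tq i : tame (fun A => qform A i) by exact/smooth_tame/sq.
pose F i a A := z A a 0 * qform A i * (Y A ^+ e * Qform A ^+ b).
pose psi i a A := z A a 0 ^+ 2 * (Y A ^+ e * Qform A ^+ b) +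
  z A a 0 * qform A i * (Y A ^+ e * (b%:R * Qform A ^+ b.-1 *
    (2 * s i ^+ 2 * qform A i * z A a 0))).
have sF i a : smooth (F i a).
  apply: smoothM; first by apply: smoothM; [exact: smooth_zvec|exact: sq].
  by apply: smoothM; apply: smoothX; [exact: smooth_zform|exact: smooth_Qform].
have tpsi i a : tame (psi i a).
  apply: tameD.
    by apply: tameM; [exact: tameX|apply: tameM; exact: tameX].
  apply: tameM; first exact: tameM.
  apply: tameM; first exact: tameX.
  apply: tameM; first by apply: tameM => //; exact: tameX.
  by apply: tameM => //; apply: tameM.
have H i a : s i ^+ 2 * E (fun A => A i a * F i a A) = s i ^+ 2 * (tau * E (psi i a)).
  have [Ji|Ji] := boolP (J i); first by rewrite sJ// expr0n/= !mul0r.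
  congr (_ * _).
  have dF A : is_derive A (D i a) (F i a) (psi i a A).
    have -> : psi i a A = (0 * qform A i + z A a 0 * ((i == i)%:R * z A a 0)) *
        (Y A ^+ e * Qform A ^+ b) + z A a 0 * qform A i *
        ((e%:R * Y A ^+ e.-1 * 0) * Qform A ^+ b + Y A ^+ e * (b%:R * Qform A ^+ b.-1 *
        (2 * s i ^+ 2 * qform A i * z A a 0))).
      by rewrite /psi eqxx /=; ring.
    apply: is_derive_mul; apply: is_derive_mul.
    - exact: dz.
    - exact: dq.
    - by apply: is_derive_exp; exact: dY.
    - by apply: is_derive_exp; exact: dQ.
  rewrite -(stein_direction steinG (sF i a) dF); apply: eq_mean => A; congr (_ * _).
  rewrite (bigD1 i)//= mxE !eqxx mul1r.
  by rewrite big1 ?addr0// => i' /negbTE i'i; rewrite mxE i'i mul0r.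
have tAF i a : tame (fun A => A i a * F i a A).
  by apply: tameM; [exact: tame_coord|exact: smooth_tame].
have -> : E (fun A => Y A ^+ e * Qform A ^+ b.+1) =
    tau * E (fun A => \sum_i \sum_a s i ^+ 2 * psi i a A).
  transitivity (E (fun A => \sum_i \sum_a s i ^+ 2 * (A i a * F i a A))).
    apply: eq_mean => A; rewrite exprS {1}/Qform mulrCA mulr_suml.
    apply: eq_bigr => i _; rewrite [qform A i ^+ 2]expr2 {1}/qform mulr_suml mulr_sumr mulr_suml.
    by apply: eq_bigr => a _; rewrite /F; ring.
  rewrite !(mean_sum steinG); last 2 first.
  - by move=> i _; apply: tame_sum => a _; exact: tameM.
  - by move=> i _; apply: tame_sum => a _; exact: tameM.
  rewrite mulr_sumr; apply: eq_bigr => i _.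
  rewrite !(mean_sum steinG); last 2 first.
  - by move=> a _; exact: tameM.
  - by move=> a _; exact: tameM.
  rewrite mulr_sumr; apply: eq_bigr => a _.
  by rewrite !(meanZ steinG)// H mulrCA.
have tYQ e' b' : tame (fun A => Y A ^+ e' * Qform A ^+ b') by apply: tameM; exact: tameX.
rewrite -mulrA ler_pM2l// -(meanZ steinG)//; apply: (le_mean steinG).
- by apply: tame_sum => i _; apply: tame_sum => a _; exact: tameM.
- exact: tameM.
move=> A.
have psiE i : \sum_a s i ^+ 2 * psi i a A = s i ^+ 2 * (Y A ^+ e.+1 * Qform A ^+ b) +
    2 * b%:R * (Y A ^+ e.+1 * Qform A ^+ b.-1) * (s i ^+ 2 * (s i ^+ 2 * qform A i ^+ 2)).
  transitivity (\sum_a z A a 0 ^+ 2 * (s i ^+ 2 * (Y A ^+ e * Qform A ^+ b) +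
      2 * b%:R * (Y A ^+ e * Qform A ^+ b.-1) * (s i ^+ 2 * (s i ^+ 2 * qform A i ^+ 2)))).
    by apply: eq_bigr => a _; rewrite /psi; ring.
  by rewrite -mulr_suml -zformE !exprS; ring.
rewrite (eq_bigr _ (fun i _ => psiE i)) big_split/= -mulr_suml [leRHS]mulrDl lerD2l.
rewrite -mulr_sumr.
have Y0 := zform_ge0 J eps v A; have Q0 := Qform_ge0 A.
(* Differentiating the power of [Qform] produces weights [s_i^4]; bounding one factor [s_i^2] by [S]
   restores [Qform] and closes the recursion. *)
apply: (@le_trans _ _ (2 * b%:R * (Y A ^+ e.+1 * Qform A ^+ b.-1) * (S * Qform A))).
  rewrite ler_wpM2l ?mulr_ge0 ?exprn_ge0// /Qform mulr_sumr.
  by apply: ler_sum => i _; rewrite ler_wpM2r// mulr_ge0 ?sqr_ge0.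
case: b {F psi sF tpsi H tAF psiE} => [|b]; first by rewrite !(mulr0, mul0r).
by rewrite /= le_eqVlt; apply/orP; left; apply/eqP; rewrite [Qform A ^+ b.+1]exprS; ring.
Qed.

(** Each [moment_Qform_step] trades a factor [Qform] for a factor [Y]. After [p] of them, [Y <= x]
    and [moment_xform] finish; the [tau] gained from the tail cancels the [tau] lost to the head. *)
Lemma moment_Qform p : (forall j, (j < p)%N -> 0 < l%:R - r - 1 - 2 * j%:R) ->
  E (fun A => Qform A ^+ p) <=
  dot v v ^+ p * \prod_(j < p) ((\sum_i s i ^+ 2 + 2 * j%:R * S) / (l%:R - r - 1 - 2 * j%:R)).
Proof.
move=> c0.
have tQ := smooth_tame smooth_Qform.
have tY : tame Y by exact/smooth_tame/smooth_zform.
have sig0 (j : nat) : 0 <= tau * (\sum_i s i ^+ 2 + 2 * j%:R * S).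
  rewrite mulr_ge0 ?(ltW tau0)// addr_ge0 ?mulr_ge0// sumr_ge0// => i _.
  exact: sqr_ge0.
have H b e : E (fun A => Y A ^+ e * Qform A ^+ b) <=
    (\prod_(j < b) (tau * (\sum_i s i ^+ 2 + 2 * j%:R * S))) * E (fun A => Y A ^+ (e + b)).
  elim: b e => [|b IH] e.
    rewrite big_ord0 mul1r addn0 le_eqVlt; apply/orP; left; apply/eqP.
    by apply: eq_mean => A; rewrite expr0 mulr1.
  apply: (le_trans (moment_Qform_step e b)); rewrite big_ord_recr/=.
  by rewrite -[leRHS]mulrA [leRHS]mulrCA ler_wpM2l// addnS -addSn; exact: IH.
have := H p 0%N; under eq_mean do rewrite expr0 mul1r.
move=> /le_trans; apply; rewrite add0n.
have -> : \prod_(j < p) ((\sum_i s i ^+ 2 + 2 * j%:R * S) / (l%:R - r - 1 - 2 * j%:R)) =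
  (\prod_(j < p) (tau * (\sum_i s i ^+ 2 + 2 * j%:R * S))) *
  \prod_(j < p) (tau * (l%:R - r - 1 - 2 * j%:R))^-1.
  rewrite -big_split; apply: eq_bigr => j _ /=.
  by rewrite invfM mulrACA divff ?mul1r// gt_eqF.
rewrite mulrCA ler_wpM2l//; first by apply: prodr_ge0 => j _.
apply: le_trans (moment_xform c0); apply: (le_mean steinG).
- exact: tameX.
- exact: tameX.
by move=> A; apply: lerXn2r; rewrite ?nnegrE ?zform_ge0 ?xform_ge0 ?zform_le.
Qed.
End Tail.
End QuadraticMoments.

Lemma dot_cauchy_schwarz (R : realType) (n : nat) (x y : 'cV[R]_n) :
  dot x y ^+ 2 <= dot x x * dot y y.
Proof.
have [->|y0] := eqVneq y 0.
  have d0 (z : 'cV[R]_n) : dot z 0 = 0 by rewrite /dot mulmx0 mxE.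
  by rewrite !d0 expr0n mulr0.
have yy : 0 < dot y y by rewrite dot_gt0.
have := dot_ge0 (dot y y *: x - dot x y *: y).
rewrite dotBr !dotZr ![dot (_ - _) _]dotC !dotBr !dotZr (dotC y x).
rewrite (_ : _ - _ = dot y y * (dot x x * dot y y - dot x y ^+ 2)); last by ring.
by rewrite pmulr_rge0// subr_ge0.
Qed.

Lemma sum_cauchy_schwarz (R : realType) (n : nat) (x y : 'I_n -> R) :
  (\sum_i x i * y i) ^+ 2 <= (\sum_i x i ^+ 2) * (\sum_i y i ^+ 2).
Proof.
have := dot_cauchy_schwarz (\col_i x i) (\col_i y i).
rewrite !dot_sqr dotE.
under eq_bigr do rewrite !mxE.
under [X in _ <= X * _]eq_bigr do rewrite mxE.
by under [X in _ <= _ * X]eq_bigr do rewrite mxE.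
Qed.

Lemma dot_young (R : realType) (n : nat) (x y : 'cV[R]_n) (eta : R) : 0 < eta ->
  dot (x + y) (x + y) <= (1 + eta) * dot x x + (1 + eta^-1) * dot y y.
Proof.
move=> eta0; have := dot_ge0 (eta *: x - y).
rewrite dotBr dotZr ![dot (_ - _) _]dotC !dotBr !dotZr (dotC y x) => h.
rewrite dotDr ![dot (x + y) _]dotC !dotDr (dotC y x).
have : 0 <= eta^-1 * (eta * (eta * dot x x - dot x y) - (eta * dot x y - dot y y)).
  by rewrite mulr_ge0// ?invr_ge0 ?ltW.
rewrite (_ : eta^-1 * _ = eta * dot x x - 2 * dot x y + eta^-1 * dot y y); first lra.
by field; rewrite gt_eqF.
Qed.

(** * The head of a kernel vector, for one sample *)

Section PointwiseBound.
Context {R : realType} {n l : nat} (J : pred 'I_n) (eps : R).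
Hypothesis eps0 : 0 < eps.
Variables (A : 'M[R]_(n, l)) (s nu : 'I_n -> R) (a : 'cV[R]_n).
Hypothesis sJ : forall i, J i -> s i = 0.
Hypothesis Ja : mask J *m a = a.
Hypothesis aG : forall b, \sum_i (a i 0 + s i * nu i) * A i b = 0.
Local Notation res := (resolvent J eps A).
Local Notation c := (a - eps *: (mask J *m (res *m a))).

(* [c] is [gram *m res *m a], the part of [a] seen by the regularised inverse. *)
Lemma dot_gram_resolvent_le v' :
  dot c v' ^+ 2 <= (\sum_(i | ~~ J i) nu i ^+ 2) * Qform J eps (mask J *m v') s A.
Proof.
set v := mask J *m v'.
have Jv : mask J *m v = v by rewrite /v mulmxA mask_idem.
pose z := zvec J eps v A.
have -> : dot c v' = dot a (gram J A *m (res *m v)).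
  have -> : gram J A *m (res *m v) = v - eps *: (res *m v).
    by rewrite mulmxA gram_resolvent// mulmxBl mul1mx -scalemxAl.
  rewrite dotC !dotBr !dotZr; congr (_ - _ * _).
    by rewrite /v dot_mulmx mask_sym Ja dotC.
  by rewrite [RHS]dot_mulmx resolvent_sym /v [RHS]dot_mulmx mask_sym dotC.
(* The equations [aG], weighted by the entries of [z] and added up, exchange the pairing on the head
   for one on the tail. *)
have -> : dot a (gram J A *m (res *m v)) = - \sum_i (if J i then 0 else nu i) * (s i * qform J eps v A i).
  have -> : gram J A *m (res *m v) = mask J *m (A *m z) by rewrite /gram /z /zvec !mulmxA.
  rewrite dot_mulmx mask_sym Ja dotE.
  apply/eqP; rewrite -subr_eq0 opprK; apply/eqP.
  transitivity (\sum_b (\sum_i (a i 0 + s i * nu i) * A i b) * z b 0); last first.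
    by rewrite big1// => b _; rewrite aG mul0r.
  under [RHS]eq_bigr do rewrite mulr_suml.
  rewrite exchange_big/= -big_split/=; apply: eq_bigr => i _.
  under [RHS]eq_bigr do rewrite !mulrDl.
  rewrite big_split/= mxE mulr_sumr; congr (_ + _).
    by apply: eq_bigr => b _; rewrite mulrA.
  rewrite /qform !mulr_sumr; apply: eq_bigr => b _; rewrite -/z.
  by case: ifPn => [/sJ ->|_]; rewrite ?mul0r//; ring.
rewrite sqrrN; apply: (le_trans (sum_cauchy_schwarz _ _)).
rewrite le_eqVlt; apply/orP; left; apply/eqP; congr (_ * _).
  rewrite [RHS]big_mkcond; apply: eq_bigr => i _.
  by case: (J i); rewrite ?expr0n.
by apply: eq_bigr => i _; rewrite exprMn.
Qed.

(** The defect [u = a - c] satisfies [|u|^2 <= H |a|^2]: the Frobenius norm bounds the operator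
    norm, and the squared norm of the [j]-th column of [eps *: res] is at most its diagonal entry.
    Young's inequality with weight [eta] then separates [c] from [u], so [a] is controlled by [c]
    once [H] is small. *)
Lemma dot_le_regularized (eta : R) : 0 < eta ->
  dot a a * (1 - (1 + eta^-1) * (eps * \sum_(j | J j) res j j)) <= (1 + eta) * dot c c.
Proof.
move=> eta0; set H := eps * _.
pose u := eps *: (mask J *m (res *m a)).
have uu : dot u u <= H * dot a a.
  have uE i : u i 0 = \sum_j ((J i)%:R * (eps * res i j) * (J j)%:R) * a j 0.
    rewrite /u mxE mask_mulE mxE !mulr_sumr; apply: eq_bigr => j _.
    by rewrite -{1}Ja mask_mulE; ring.
  have rj j : \sum_i (eps * res i j) ^+ 2 <= eps * res j j.
    have := dot_resolvent_ge J eps0 A (delta_mx j 0).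
    rewrite [X in _ <= X]dotC dot_delta -colE mxE dot_sqr => h.
    rewrite -(ler_pM2l eps0) in h; apply: le_trans h.
    rewrite !mulr_sumr; apply: ler_sum => i _; rewrite mxE; lra.
  rewrite dot_sqr /H mulr_sumr mulr_suml.
  apply: (@le_trans _ _ (\sum_i (\sum_j ((J i)%:R * (eps * res i j) * (J j)%:R) ^+ 2) * dot a a)).
    apply: ler_sum => i _; rewrite uE dot_sqr; exact: sum_cauchy_schwarz.
  rewrite -!mulr_suml; apply: ler_wpM2r; first exact: dot_ge0.
  rewrite exchange_big/= [X in _ <= X]big_mkcond/=; apply: ler_sum => j _.
  case: (J j); last by rewrite big1// => i _; rewrite mulr0 expr0n.
  apply: le_trans (rj j); apply: ler_sum => i _; rewrite mulr1.
  by case: (J i); rewrite ?mul1r// mul0r expr0n sqr_ge0.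
have young : dot a a <= (1 + eta) * dot c c + (1 + eta^-1) * dot u u.
  by have := dot_young (a - u) u eta0; rewrite subrK.
have e0 : 0 < 1 + eta^-1 by rewrite addr_gt0// invr_gt0.
have : (1 + eta^-1) * dot u u <= (1 + eta^-1) * (H * dot a a) by rewrite ler_pM2l.
move: young; lra.
Qed.

End PointwiseBound.

(** * The variable that controls the ratio, and the limit in [eps] *)

Section TailVariable.
Context {d : measure_display} {T : measurableType d} {R : realType}
  (P : probability T R) {n l : nat} (G : T -> 'M[R]_(n, l)) (tau : R).
Hypothesis tau0 : 0 < tau.
Hypothesis steinG : stein_matrix P G tau.
Variables (a0 : 'I_l) (J : pred 'I_n) (s : 'I_n -> R) (S : R) (p : nat).
Local Notation r := (\sum_(i | J i) (1 : R)).
Hypothesis S0 : 0 <= S.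
Hypothesis sS : forall i, s i ^+ 2 <= S.
Hypothesis sJ : forall i, J i -> s i = 0.
Hypothesis p0 : (0 < p)%N.
Hypothesis dof : forall j, (j < p)%N -> 0 < l%:R - r - 1 - 2 * j%:R.
Local Notation E := (mean P G).

(** A square, so that [m * H m] has mean of order [1 / m]: this term disappears from the mean of
    [Psi], yet its boundedness forces [H m] to [0]. *)
Let eps (m : nat) : R := (m.+1%:R ^+ 2)^-1.

Let eps0 m : 0 < eps m.
Proof. by rewrite invr_gt0 exprn_gt0. Qed.

Let v w : 'cV[R]_n := mask J *m (\col_i G w i a0).

Let Jv w : mask J *m v w = v w.
Proof. by rewrite /v mulmxA mask_idem. Qed.

(** The point [w] is the sample and [w'] an independent copy on the product space, which supplies
    the test column [v w']. Averaging over the column is integration in [w']. *)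
Let Q m w w' : R := Qform J (eps m) (v w') s (G w).

Let mG i a : measurable_fun setT (fun w => G w i a).
Proof. by case: steinG. Qed.

Let mR m i j : measurable_fun setT (fun w => resolvent J (eps m) (G w) i j).
Proof. by have [_ + _] := @tame_resolvent R n l J _ (eps0 m) i j; apply. Qed.

Let mQ m : measurable_fun setT (fun z : T * T => (Q m z.1 z.2 ^+ p)%:E).
Proof.
apply/measurable_EFinP; apply: measurable_funX.
have mG1 i a : measurable_fun setT (fun z : T * T => G z.1 i a).
  by apply: (measurableT_comp (mG i a)).
have mG2 i a : measurable_fun setT (fun z : T * T => G z.2 i a).
  by apply: (measurableT_comp (mG i a)).
have mR1 i j : measurable_fun setT (fun z : T * T => resolvent J (eps m) (G z.1) i j).
  by apply: (measurableT_comp (mR m i j)).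
have E1 (z : T * T) i : ((resolvent J (eps m) (G z.1)) *m v z.2) i 0 =
    \sum_j resolvent J (eps m) (G z.1) i j * ((J j)%:R * G z.2 j a0).
  by rewrite mxE; apply: eq_bigr => j _; rewrite mask_mulE mxE.
have E2 (z : T * T) a : zvec J (eps m) (v z.2) (G z.1) a 0 =
    \sum_i G z.1 i a * ((J i)%:R * \sum_j resolvent J (eps m) (G z.1) i j * ((J j)%:R * G z.2 j a0)).
  by rewrite mxE; apply: eq_bigr => i _; rewrite mxE mask_mulE E1.
rewrite /Q /Qform; apply: measurable_sum => i; apply: measurable_funM => //.
apply: measurable_funX; rewrite /qform; apply: measurable_sum => a.
apply: measurable_funM => //.
under eq_fun do rewrite E2.
apply: measurable_sum => i'; apply: measurable_funM => //; apply: measurable_funM => //.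
by apply: measurable_sum => j; apply: measurable_funM => //; apply: measurable_funM.
Qed.

Let Phi m w := (\int[P]_w' (Q m w w' ^+ p)%:E)%E.

Let Q0 m w w' : 0 <= Q m w w'. Proof. exact: Qform_ge0. Qed.

Let mPhi m : measurable_fun setT (Phi m).
Proof.
apply: (@measurable_fun_fubini_tonelli_F _ _ _ _ _ P (fun z : T * T => (Q m z.1 z.2 ^+ p)%:E)) => //.
by move=> z; rewrite lee_fin exprn_ge0.
Qed.

Let Kq : R := \prod_(j < p) ((\sum_i s i ^+ 2 + 2 * j%:R * S) / (l%:R - r - 1 - 2 * j%:R)).

Let Kq0 : 0 <= Kq.
Proof.
apply: prodr_ge0 => j _; rewrite divr_ge0//; last by rewrite ltW// dof.
by rewrite addr_ge0 ?mulr_ge0// sumr_ge0// => i _; exact: sqr_ge0.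
Qed.

(** Tonelli exchanges the integrals: with the test column fixed, [moment_Qform] bounds the mean over
    the sample, and the remaining power of [|v|^2] is a chi-square moment. *)
Let int_Phi m : (\int[P]_w Phi m w <= (Kq * \prod_(j < p) (tau * (r + 2 * j%:R)))%:E)%E.
Proof.
rewrite /Phi (@fubini_tonelli _ _ _ _ _ P P (fun z : T * T => (Q m z.1 z.2 ^+ p)%:E))//; last first.
  by move=> z; rewrite lee_fin exprn_ge0.
have tN : tame (fun A : 'M[R]_(n, l) => (\sum_(i | J i) A i a0 ^+ 2) ^+ p).
  by apply: tameX; apply: tame_sum => i _; apply: tameX; exact: tame_coord.
have mN : measurable_fun setT (fun w => (\sum_(i | J i) G w i a0 ^+ 2) ^+ p).
  by have [_ + _] := tN; apply.
have N0 w : 0 <= (\sum_(i | J i) G w i a0 ^+ 2) ^+ p.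
  by rewrite exprn_ge0// sumr_ge0// => i _; exact: sqr_ge0.
rewrite /= -(moment_column_norm steinG a0 J p) EFinM -(meanE steinG tN).
rewrite -ge0_integralZl//; last 2 first.
- exact/measurable_EFinP.
- by move=> w _; rewrite lee_fin.
apply: ge0_le_integral => //.
- by move=> w _; apply: integral_ge0 => w' _; rewrite lee_fin exprn_ge0.
- apply: (@measurable_fun_fubini_tonelli_G _ _ _ _ _ P (fun z : T * T => (Q m z.1 z.2 ^+ p)%:E)) => //.
  by move=> z; rewrite lee_fin exprn_ge0.
- by apply/measurable_EFinP; apply: measurable_funM.
move=> w' _.
have := meanE steinG (tameX p (smooth_tame (smooth_Qform J (v w') (eps0 m) s))).
rewrite /Q => ->; rewrite -EFinM lee_fin.
apply: (le_trans (moment_Qform tau0 steinG (eps0 m) (Jv w') sJ S0 sS dof)).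
rewrite mulrC ler_wpM2l// le_eqVlt; apply/orP; left; apply/eqP.
congr (_ ^+ p); rewrite dot_sqr [RHS]big_mkcond; apply: eq_bigr => i _.
by rewrite mask_mulE mxE; case: (J i); rewrite ?mul1r// mul0r expr0n.
Qed.

Let H m w : R := eps m * \sum_(j | J j) resolvent J (eps m) (G w) j j.

Let H0 m w : 0 <= H m w.
Proof.
rewrite mulr_ge0 ?(ltW (eps0 m))// sumr_ge0// => j _.
by rewrite resolvent_entry dot_resolvent_ge0.
Qed.

Let C : R := r * (tau * (l%:R - r - 1))^-1.

Let int_H m : (\int[P]_w (m%:R * H m w)%:E <= (C / m.+1%:R)%:E)%E.
Proof.
have tR j : tame (fun A : 'M[R]_(n, l) => resolvent J (eps m) A j j) by exact: tame_resolvent.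
have tS : tame (fun A : 'M[R]_(n, l) => \sum_(j | J j) resolvent J (eps m) A j j).
  by apply: tame_sum => j _; exact: tR.
have tH : tame (fun A : 'M[R]_(n, l) => m%:R * (eps m * \sum_(j | J j) resolvent J (eps m) A j j)).
  by apply: tameM; [exact: tame_cst|apply: tameM => //; exact: tame_cst].
rewrite (meanE steinG tH) lee_fin.
rewrite !(meanZ steinG)//; last by apply: tameM => //; exact: tame_cst.
rewrite (mean_sum steinG)//.
have C0 : 0 <= (tau * (l%:R - r - 1))^-1.
  by have := dof p0; rewrite mulr0 subr0 => h; rewrite invr_ge0 ltW// mulr_gt0.
(* A diagonal entry of the resolvent is [xform] at a basis vector, so this is the case [p = 1] of
   [moment_xform]. *)
have h j : J j -> E (fun A : 'M[R]_(n, l) => resolvent J (eps m) A j j) <= 1 * (tau * (l%:R - r - 1))^-1.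
  move=> Jj; have Jd : mask J *m (delta_mx j 0 : 'cV[R]_n) = delta_mx j 0.
    apply/matrixP => i k; rewrite mask_mulE mxE.
    by case: eqVneq => [->|_]; rewrite ?Jj ?mul1r// mulr0.
  have dof1 : forall i, (i < 1)%N -> 0 < l%:R - r - 1 - 2 * i%:R.
    by move=> i; rewrite ltnS leqn0 => /eqP ->; exact: dof.
  have := moment_xform tau0 steinG (eps0 m) Jd dof1.
  rewrite big_ord1 mulr0 subr0 expr1 dot_delta mxE !eqxx /=.
  congr (_ <= _); apply: eq_mean => A.
  by rewrite expr1 /xform dotC dot_delta -colE mxE.
apply: (@le_trans _ _ (m%:R * (eps m * C))).
  rewrite ler_wpM2l// ler_wpM2l ?(ltW (eps0 m))// /C mulr_suml.
  by apply: ler_sum => j Jj; exact: h.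
rewrite mulrA mulrC; apply: ler_wpM2l.
  by rewrite /C mulr_ge0// sumr_ge0.
rewrite /eps expr2 invfM mulrA -[leRHS]mul1r ler_wpM2r ?invr_ge0//.
by rewrite ler_pdivrMr// mul1r ler_nat.
Qed.

(** The moment of order [2p] of a centred Gaussian of variance [tau]: the factor that averaging over
    the test column leaves in front of [|c|^(2p)]. *)
Let K0 : R := tau ^+ p * \prod_(j < p) (1 + 2 * j%:R).

Let K00 : 0 < K0.
Proof.
by rewrite mulr_gt0 ?exprn_gt0// prodr_gt0.
Qed.

Let Psi_ m w : \bar R := ((K0^-1)%:E * Phi m w + (m%:R * H m w)%:E)%E.

Let Phi0 m w : (0 <= Phi m w)%E.
Proof. by apply: integral_ge0 => w' _; rewrite lee_fin exprn_ge0. Qed.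

Let Psi_0 m w : (0 <= Psi_ m w)%E.
Proof.
apply: adde_ge0; first by apply: mule_ge0 => //; rewrite lee_fin invr_ge0 ltW.
by rewrite lee_fin mulr_ge0.
Qed.

Let mH m : measurable_fun setT (H m).
Proof.
have tH : tame (fun A : 'M[R]_(n, l) => eps m * \sum_(j | J j) resolvent J (eps m) A j j).
  apply: tameM; first exact: tame_cst.
  by apply: tame_sum => j _; exact: tame_resolvent.
by have [_ + _] := tH; apply.
Qed.

Let mPsi_ m : measurable_fun setT (Psi_ m).
Proof.
apply: emeasurable_funD.
  by apply: emeasurable_funM => //; exact: mPhi.
by apply/measurable_EFinP; apply: measurable_funM.
Qed.

Let mom : R := \prod_(j < p) ((r + 2 * j%:R) * (\sum_i s i ^+ 2 + 2 * j%:R * S) /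
    ((1 + 2 * j%:R) * (l%:R - r - 1 - 2 * j%:R))).

Let int_Psi_ m : (\int[P]_w Psi_ m w <= (mom + C / m.+1%:R)%:E)%E.
Proof.
rewrite ge0_integralD//; last 4 first.
- by move=> w _; apply: mule_ge0 => //; rewrite lee_fin invr_ge0 ltW.
- by apply: emeasurable_funM => //; exact: mPhi.
- by move=> w _; rewrite lee_fin mulr_ge0.
- by apply/measurable_EFinP; apply: measurable_funM.
rewrite EFinD; apply: leeD; last exact: int_H.
rewrite ge0_integralZl//; last first.
  by rewrite lee_fin invr_ge0 ltW.
apply: (@le_trans _ _ ((K0^-1)%:E * (Kq * \prod_(j < p) (tau * (r + 2 * j%:R)))%:E)%E).
  by apply: lee_wpmul2l => //; rewrite lee_fin invr_ge0 ltW.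
rewrite -EFinM lee_fin le_eqVlt; apply/orP; left; apply/eqP.
have -> : K0 = \prod_(j < p) (tau * (1 + 2 * j%:R)).
  by rewrite /K0 big_split/= prodr_const card_ord.
rewrite -prodfV /Kq -!big_split/=; apply: eq_bigr => j _.
have h1 := dof (ltn_ord j).
have h2 : (0 : R) < 1 + 2 * j%:R by rewrite ltr_wpDr ?mulr_ge0.
by field; rewrite !gt_eqF.
Qed.

Let Psi w : \bar R := limn_einf (Psi_ ^~ w).

Let PsiE w : Psi w = ereal_sup (range (einfs (Psi_ ^~ w))).
Proof. by rewrite /Psi limn_einf_lim; apply/cvg_lim => //; exact: cvg_einfs_sup. Qed.

Let Psi_ge_einfs w m : (einfs (Psi_ ^~ w) m <= Psi w)%E.
Proof. by rewrite PsiE; apply: ereal_sup_ubound; exists m. Qed.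

Let Psi0 w : (0 <= Psi w)%E.
Proof.
apply: le_trans (Psi_ge_einfs w 0); apply: le_ereal_inf_tmp => _ [m _ <-]; exact: Psi_0.
Qed.

Let mPsi : measurable_fun setT Psi.
Proof.
have -> : Psi = (fun w => - limn_esup ((fun m w => - Psi_ m w) ^~ w))%E.
  apply/funext => w; rewrite /Psi -limn_einfN; congr limn_einf.
  by apply/funext => m /=; rewrite oppeK.
have mN m : measurable_fun setT (fun w => - Psi_ m w)%E.
  by apply: measurableT_comp => //; exact: oppe_measurable.
apply: measurableT_comp; first exact: oppe_measurable.
exact: measurable_fun_limn_esup mN.
Qed.

Let int_Psi : (\int[P]_w Psi w <= mom%:E)%E.
Proof.
have F : (\int[P]_w Psi w <= limn_einf (fun m => \int[P]_w Psi_ m w))%E.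
  exact: (fatou P measurableT mPsi_ (fun m w _ => Psi_0 m w)).
apply: (le_trans F).
apply: (@le_trans _ _ (limn_einf (fun m => (mom + C / m.+1%:R)%:E))).
  rewrite !limn_einf_lim; apply: lee_lim; [exact: is_cvg_einfs|exact: is_cvg_einfs|].
  apply: nearW => N; apply: le_ereal_inf_tmp => _ [m /= Nm <-].
  by apply: (le_trans _ (int_Psi_ m)); apply: ereal_inf_lbound; exists m.
have h : (mom + C / m.+1%:R)%:E @[m --> \oo] --> mom%:E.
  apply: cvg_EFin; first exact: nearW.
  rewrite -[X in _ --> X]addr0; apply: cvgD; first exact: cvg_cst.
  rewrite -[X in _ --> X](mulr0 C); apply: cvgM; first exact: cvg_cst.
  exact: cvg_harmonic.
by have [-> _] := cvg_limn_einf_sup h.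
Qed.

(** Along indices where [Psi_ m w] is close to its lower limit, [Phi m w] is nearly at most
    [K0 * Psi w] and [H m w] is of order [1 / m]. The bound then holds up to factors [1 - eta] and
    [1 + eta], and [eta] tends to [0]. *)
Let Psi_bound w (a : 'cV[R]_n) (nu : 'I_n -> R) : (Psi w < +oo)%E ->
  mask J *m a = a -> (forall b, \sum_i (a i 0 + s i * nu i) * G w i b = 0) ->
  dot a a ^+ p <= (\sum_(i | ~~ J i) nu i ^+ 2) ^+ p * fine (Psi w).
Proof.
move=> Pfin Ja aG; set N2 := \sum_(i | _) _; set L := fine (Psi w).
have LE : Psi w = L%:E by rewrite fineK// ge0_fin_numE.
have L0 : 0 <= L by rewrite -lee_fin -LE.
have N20 : 0 <= N2 by apply: sumr_ge0 => i _; exact: sqr_ge0.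
pose c m : 'cV[R]_n := a - eps m *: (mask J *m (resolvent J (eps m) (G w) *m a)).
have cPhi m : ((K0 * dot (c m) (c m) ^+ p)%:E <= (N2 ^+ p)%:E * Phi m w)%E.
  have tN : tame (fun A : 'M[R]_(n, l) => (\sum_i c m i 0 * A i a0) ^+ (2 * p)).
    apply: tameX; apply: tame_sum => i _.
    by apply: tameM; [exact: tame_cst|exact: tame_coord].
  have mQ1 : measurable_fun setT (fun w' => (Q m w w' ^+ p)%:E).
    exact: (measurableT_comp (mQ m) (pair1_measurable w)).
  have mE := moment_linear_form steinG a0 (c m) p.
  have -> : K0 * dot (c m) (c m) ^+ p =
      E (fun A : 'M[R]_(n, l) => (\sum_i c m i 0 * A i a0) ^+ (2 * p)).
    by rewrite mE exprMn /K0; ring.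
  rewrite -(meanE steinG tN) /Phi -ge0_integralZl//; last 2 first.
  - by move=> w' _; rewrite lee_fin exprn_ge0.
  - by rewrite lee_fin exprn_ge0.
  apply: ge0_le_integral => //.
  - by move=> w' _; rewrite lee_fin mulnC exprM exprn_even_ge0.
  - by have [_ mN _] := tN; apply/measurable_EFinP; exact: mN.
  - by apply: emeasurable_funM.
  move=> w' _; rewrite -EFinM lee_fin exprM -exprMn.
  apply: lerXn2r; rewrite ?nnegrE ?sqr_ge0 ?mulr_ge0//.
  have := dot_gram_resolvent_le (eps0 m) sJ Ja aG (\col_i G w' i a0).
  rewrite dotE; congr (_ ^+ 2 <= _); apply: eq_bigr => i _.
  by rewrite [X in _ * X]mxE.
(* A lower limit is approached infinitely often, so [m] may also be taken as large as desired. *)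
have small (eta : R) : 0 < eta -> forall N, exists m, (N <= m)%N /\ (Psi_ m w < (L + eta)%:E)%E.
  move=> eta0 N; apply: contrapT => /forallNP hN.
  have : ((L + eta)%:E <= Psi w)%E.
    apply: le_trans (Psi_ge_einfs w N); apply: le_ereal_inf_tmp => _ [m /= Nm <-].
    by rewrite leNgt; apply/negP => h; apply: (hN m).
  by rewrite LE lee_fin gerDl leNgt eta0.
have step (eta : R) : 0 < eta -> eta <= 1 ->
    dot a a ^+ p * (1 - eta) ^+ p <= (1 + eta) ^+ p * (N2 ^+ p * (L + eta)).
  move=> eta0 eta1; have Le0 : 0 < L + eta by rewrite ltr_wpDl.
  have e1 : 0 < 1 + eta^-1 by rewrite addr_gt0 ?invr_gt0.
  (* Chosen so that [m > B] and [m * H m w <= L + eta] together give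
     [(1 + eta^-1) * H m w <= eta]. *)
  pose B := (1 + eta^-1) * (L + eta) / eta.
  have B0 : 0 < B by rewrite divr_gt0// mulr_gt0.
  have [m [Nm mlt]] := small eta eta0 (Num.bound B).
  have Bm : B < m%:R by rewrite (lt_le_trans (archi_boundP (ltW B0)))// ler_nat.
  have m0 : (0 : R) < m%:R by exact: lt_trans Bm.
  have PhiE : (Phi m w <= (K0 * (L + eta))%:E)%E.
    have -> : Phi m w = (K0%:E * ((K0^-1)%:E * Phi m w))%E.
      by rewrite muleA -EFinM divff ?gt_eqF// mul1e.
    rewrite (EFinM K0 (L + eta)); apply: lee_wpmul2l; first by rewrite lee_fin ltW.
    apply: le_trans (ltW mlt); rewrite /Psi_ leeDl// lee_fin mulr_ge0//.
  have HE : (1 + eta^-1) * H m w <= eta.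
    have mH' : m%:R * H m w <= L + eta.
      rewrite -lee_fin; apply: le_trans (ltW mlt); rewrite /Psi_ leeDr//.
      by apply: mule_ge0 => //; rewrite lee_fin invr_ge0 ltW.
    rewrite -(ler_pM2l m0) mulrCA; apply: (@le_trans _ _ ((1 + eta^-1) * (L + eta))).
      by rewrite ler_pM2l.
    by rewrite -ler_pdivrMr// ltW.
  have aa0 := dot_ge0 a; have cc0 := dot_ge0 (c m).
  have h : dot a a * (1 - eta) <= (1 + eta) * dot (c m) (c m).
    apply: le_trans (dot_le_regularized (eps0 m) (G w) Ja eta0).
    by rewrite ler_wpM2l// lerD2l lerN2.
  rewrite -exprMn; apply: (@le_trans _ _ (((1 + eta) * dot (c m) (c m)) ^+ p)).
    by apply: lerXn2r; rewrite ?nnegrE ?mulr_ge0 ?subr_ge0// addr_ge0// ltW.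
  rewrite exprMn ler_wpM2l ?exprn_ge0 ?addr_ge0 ?(ltW eta0)//.
  rewrite -(ler_pM2l K00) mulrCA -lee_fin; apply: (le_trans (cPhi m)).
  by rewrite EFinM; apply: lee_wpmul2l => //; rewrite lee_fin exprn_ge0.
have h0 : (@harmonic R) @ \oo --> (0 : R) := cvg_harmonic.
have cX (u : nat -> R) (x : R) : u @ \oo --> x -> (fun j => u j ^+ p) @ \oo --> x ^+ p.
  move=> ux; exact: (cvg_comp _ _ ux (@exprn_continuous R p x)).
have lhs : (fun j => dot a a ^+ p * (1 - harmonic j) ^+ p) @ \oo --> dot a a ^+ p * (1 - 0) ^+ p.
  apply: cvgM; first exact: cvg_cst.
  by apply: (cX); apply: cvgB => //; exact: cvg_cst.
have rhs : (fun j => (1 + harmonic j) ^+ p * (N2 ^+ p * (L + harmonic j))) @ \oo -->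
    (1 + 0) ^+ p * (N2 ^+ p * (L + 0)).
  apply: cvgM; first by apply: (cX); apply: cvgD => //; exact: cvg_cst.
  apply: cvgM; first exact: cvg_cst.
  by apply: cvgD => //; exact: cvg_cst.
move: lhs rhs; rewrite subr0 !addr0 !expr1n mulr1 mul1r => lhs rhs.
apply: (ler_cvg_to lhs rhs); apply: nearW => j; apply: step; rewrite /harmonic/=; first by rewrite invr_gt0.
by rewrite invf_le1// ler1n.
Qed.

(* [Psi] is the lower limit, as [eps -> 0], of the conditional moment of [Qform]
   plus a multiple of [eps * \tr resolvent]; the latter, whose mean vanishes, forces
   the head of [G] to have full rank wherever [Psi] is finite. *)
Lemma tail_variable : exists Psi : T -> \bar R,
  [/\ measurable_fun setT Psi, forall w, (0 <= Psi w)%E,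
      (\int[P]_w Psi w <= (\prod_(j < p) ((r + 2 * j%:R) * (\sum_i s i ^+ 2 + 2 * j%:R * S) /
        ((1 + 2 * j%:R) * (l%:R - r - 1 - 2 * j%:R))))%:E)%E &
      forall w (a : 'cV[R]_n) (nu : 'I_n -> R), (Psi w < +oo)%E -> mask J *m a = a ->
        (forall b, \sum_i (a i 0 + s i * nu i) * G w i b = 0) ->
        dot a a ^+ p <= (\sum_(i | ~~ J i) nu i ^+ 2) ^+ p * fine (Psi w)].
Proof. by exists Psi; split. Qed.

End TailVariable.

(** * Real symmetric matrices *)

Lemma char_poly_conj (F : comNzRingType) (n : nat) (H A : 'M[F]_n) (K : 'M[F]_n) :
  K *m H = 1%:M -> char_poly (H *m A *m K) = char_poly A.
Proof.
move=> KH; have HK : H *m K = 1%:M by exact: mulmx1C.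
have E : char_poly_mx (H *m A *m K) =
    map_mx polyC H *m char_poly_mx A *m map_mx polyC K.
  rewrite /char_poly_mx mulmxBr mulmxBl -!map_mxM; congr (_ - _).
  by rewrite scalar_mxC -mulmxA -map_mxM HK map_mx1 mulmx1.
rewrite /char_poly E !det_mulmx mulrAC -det_mulmx -map_mxM HK.
by rewrite map_mx1 det1 mul1r.
Qed.

Lemma char_poly_block_diag (F : comNzRingType) (n : nat) (x : F) (B : 'M[F]_n) :
  char_poly (block_mx x%:M 0 0 B : 'M[F]_(1 + n)) = ('X - x%:P) * char_poly B.
Proof.
rewrite /char_poly; set M := char_poly_mx _.
have -> : M = block_mx ('X - x%:P)%:M 0 0 (char_poly_mx B).
  rewrite /M /char_poly_mx map_block_mx !map_mx0 (@scalar_mx_block _ 1 n).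
  rewrite opp_block_mx add_block_mx !oppr0 !addr0; congr block_mx.
  by apply/matrixP => i j; rewrite !ord1 !mxE.
by rewrite det_ublock det_scalar1.
Qed.

Lemma prod_XsubC_perm (F : idomainType) (s t : seq F) :
  \prod_(x <- s) ('X - x%:P) = \prod_(x <- t) ('X - x%:P) -> perm_eq s t.
Proof.
elim: s t => [|x s IH] t E.
  have : size t = 0%N.
    by apply: succn_inj; rewrite -(size_prod_XsubC t id) -E big_nil size_poly1.
  by move/eqP; rewrite size_eq0 => /eqP ->.
have xt : x \in t.
  by rewrite -root_prod_XsubC -E big_cons rootM root_XsubC eqxx.
rewrite perm_sym (perm_trans (perm_to_rem xt))// perm_cons perm_sym; apply: IH.
have X0 : 'X - x%:P != 0 by rewrite polyXsubC_eq0.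
apply: (mulfI X0); move: E; rewrite big_cons => ->.
by rewrite (perm_big _ (perm_to_rem xt)) big_cons.
Qed.

Section Spectral.
Context {R : realType}.

(** The reflection in the hyperplane orthogonal to [u - e]; when [u = e] this vector vanishes and
    the identity serves instead. *)
Lemma householder (n : nat) (u : 'cV[R]_(1 + n)) : dot u u = 1 ->
  exists H : 'M[R]_(1 + n), [/\ H^T = H, H *m H = 1%:M & H *m u = delta_mx 0 0].
Proof.
move=> uu; set e : 'cV[R]_(1 + n) := delta_mx 0 0.
have ee : dot e e = 1 by rewrite dot_delta mxE !eqxx.
have [->|ue] := eqVneq u e.
  by exists 1%:M; rewrite trmx1 !mul1mx.
pose v := u - e; have v0 : dot v v != 0 by rewrite dot_eq0 subr_eq0.
pose c := 2 / dot v v.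
pose W := v *m v^T.
have WW : W *m W = dot v v *: W.
  rewrite /W -mulmxA (mulmxA v^T) [v^T *m v]mx11_scalar -/(dot v v).
  by rewrite mul_scalar_mx -scalemxAr.
exists (1%:M - c *: W); split.
- by rewrite linearB linearZ/= trmx1 /W trmx_mul trmxK.
- rewrite mulmxBl mul1mx mulmxBr mulmx1 -!scalemxAl -!scalemxAr WW !scalerA.
  have -> : c * c * dot v v = c + c by rewrite /c; field.
  by rewrite scalerDl opprB addrK subrK.
rewrite mulmxBl mul1mx -scalemxAl /W -mulmxA [v^T *m u]mx11_scalar -/(dot v u).
rewrite scalemxAr -mul_scalar_mx -scalar_mxM -[v *m _]trmxK trmx_mul tr_scalar_mx.
rewrite mul_scalar_mx linearZ/= trmxK.
have -> : c * dot v u = 1.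
  have h : dot v v = 2 * dot v u.
    rewrite {1 3}/v; rewrite !dotBr ![dot (u - e) _]dotC !dotBr uu ee (dotC e u); ring.
  by rewrite /c {1}h; field; move: v0; rewrite h mulf_eq0 negb_or => /andP[].
by rewrite scale1r /v subKr.
Qed.

(** Deflation along the list: a reflection sends a real unit eigenvector for the head of [s] to the
    first basis vector, symmetry splits off a block of size one, and the other block has the tail of
    [s] as roots. The diagonal therefore keeps the order of [s]. *)
Lemma symmetric_spectral (n : nat) (A : 'M[R]_n) (s : seq R) : A^T = A ->
  char_poly A = \prod_(x <- s) ('X - x%:P) ->
  exists2 V : 'M[R]_n, V^T *m V = 1%:M & A = V *m diag_mx (\row_i s`_i) *m V^T.
Proof.
elim: n A s => [|n IH] A s symA chA.
  by exists 1%:M; rewrite ?trmx1 ?mulmx1// [LHS]flatmx0 [RHS]flatmx0.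
case: s chA => [|x s] chA.
  by have := size_char_poly A; rewrite chA big_nil size_poly1.
have : eigenvalue A x.
  by rewrite eigenvalue_root_char chA big_cons rootM root_XsubC eqxx.
case/eigenvalueP => u0 u0A u00.
pose u1 : 'cV[R]_(1 + n) := u0^T.
have u1A : A *m u1 = x *: u1 by rewrite /u1 -{1}symA -trmx_mul u0A linearZ.
have u10 : 0 < dot u1 u1 by rewrite dot_gt0 /u1 trmx_eq0.
pose u := (Num.sqrt (dot u1 u1))^-1 *: u1.
have uA : A *m u = x *: u by rewrite /u -scalemxAr u1A !scalerA mulrC.
have uu : dot u u = 1.
  rewrite /u dotZr dotC dotZr mulrA -invfM -expr2 sqr_sqrtr ?ltW// mulVf//.
  by rewrite gt_eqF.
have [H [HT HH Hu]] := householder uu.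
have [A' A'def] : exists A', A' = H *m A *m H by eexists.
have A'T : A'^T = A' by rewrite A'def !trmx_mul HT symA mulmxA.
have He : H *m (delta_mx 0 0 : 'cV_(1 + n)) = u by rewrite -Hu mulmxA HH mul1mx.
have A'e : A' *m (delta_mx 0 0 : 'cV_(1 + n)) = x *: delta_mx 0 0.
  by rewrite A'def -!mulmxA He uA -scalemxAr Hu.
have A'E : A' = block_mx x%:M 0 0 (@drsubmx _ 1 n 1 n A').
  have c0 i : A' i 0 = x * (i == 0)%:R.
    have := congr1 (fun M : 'cV_(1 + n) => M i 0) A'e.
    by rewrite -colE !mxE andbT.
  rewrite -{1}[A'](@submxK _ 1 n 1 n); congr block_mx.
  - apply/matrixP => i j; rewrite !ord1 !mxE lshift0 c0 eqxx; ring.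
  - apply/matrixP => i j; rewrite !ord1 !mxE -A'T mxE lshift0 c0.
    by rewrite -val_eqE /= mulr0.
  - apply/matrixP => i j; rewrite !ord1 !mxE lshift0 c0.
    by rewrite -val_eqE /= mulr0.
set B := drsubmx _ in A'E.
have BT : B^T = B by rewrite /B trmx_drsub A'T.
have chB : char_poly B = \prod_(y <- s) ('X - y%:P).
  have X0 : 'X - x%:P != 0 by rewrite polyXsubC_eq0.
  apply: (mulfI X0); rewrite -char_poly_block_diag -A'E A'def.
  by rewrite (char_poly_conj _ HH) chA big_cons.
have [V VV BE] := IH B s BT chB.
pose W : 'M[R]_(1 + n) := block_mx 1%:M 0 0 V.
have WT : W^T = block_mx 1%:M 0 0 V^T by rewrite /W tr_block_mx !trmx0 trmx1.
have WW : W^T *m W = 1%:M.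
  rewrite WT /W mulmx_block !mulmx0 !mul0mx !addr0 !add0r VV.
  by rewrite mulmx1 -scalar_mx_block.
have WE : W *m diag_mx (row_mx (x%:M : 'rV_1) (\row_i s`_i)) *m W^T = A'.
  rewrite WT diag_mx_row /W !mulmx_block !mulmx0 !mul0mx !addr0 !add0r.
  rewrite ?(mul1mx, mulmx0, mul0mx, mulmx1) -BE A'E; congr block_mx.
  by apply/matrixP => i j; rewrite !ord1 !mxE eqxx.
exists (H *m W); first by rewrite trmx_mul HT -mulmxA (mulmxA H) HH mul1mx.
have -> : A = H *m A' *m H by rewrite A'def !mulmxA HH mul1mx -mulmxA HH mulmx1.
rewrite trmx_mul HT -WE !mulmxA; congr (_ *m _ *m _ *m _ *m _); congr diag_mx.
apply/matrixP => i j; rewrite !mxE; case: splitP => k jk.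
  by rewrite jk !ord1 mxE.
by rewrite jk mxE.
Qed.

End Spectral.

Section SpectralCalculus.
Context {R : realType} {n : nat} (V : 'M[R]_n).
Hypothesis VV : V^T *m V = 1%:M.
Implicit Types (f g : nat -> R) (x y : 'cV[R]_n).

(** Functional calculus in the fixed orthonormal basis [V]; [f] is a function of the index of an
    eigenvalue, not of the eigenvalue. *)
Definition spec f : 'M[R]_n := V *m diag_mx (\row_i f i) *m V^T.

Let VV' : V *m V^T = 1%:M. Proof. exact: mulmx1C. Qed.

Lemma spec_mul f g : spec f *m spec g = spec (fun i => f i * g i).
Proof.
rewrite /spec -!mulmxA (mulmxA V^T) VV mul1mx (mulmxA (diag_mx _)) mulmx_diag.
congr (_ *m (diag_mx _ *m _)); apply/matrixP => i j; rewrite !mxE//.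
Qed.

Lemma spec_add f g : spec f + spec g = spec (fun i => f i + g i).
Proof.
rewrite /spec -mulmxDl -mulmxDr -raddfD/=; congr (_ *m diag_mx _ *m _).
by apply/matrixP => i j; rewrite !mxE.
Qed.

Lemma scalar_spec (c : R) : c%:M = spec (fun=> c).
Proof.
have -> : spec (fun=> c) = V *m c%:M *m V^T.
  by rewrite /spec; congr (_ *m _ *m _); apply/matrixP => i j; rewrite !mxE.
by rewrite -mulmxA mul_scalar_mx -scalemxAr VV' scalemx1.
Qed.

Lemma spec_exp f q : spec f ^+ q = spec (fun i => f i ^+ q).
Proof.
elim: q => [|q IH]; first by rewrite expr0 -[LHS]/(1%:M) scalar_spec.
by rewrite exprS IH -[LHS]/(_ *m _) spec_mul; congr spec; apply/funext => i; rewrite exprS.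
Qed.

Lemma tr_spec f : (spec f)^T = spec f.
Proof. by rewrite /spec !trmx_mul trmxK tr_diag_mx mulmxA. Qed.

Lemma dot_isometry x : dot (V^T *m x) (V^T *m x) = dot x x.
Proof. by rewrite dot_mulmx trmxK mulmxA VV' mul1mx. Qed.

Lemma dot_spec f x : dot x (spec f *m x) = \sum_(i < n) f i * (V^T *m x) i 0 ^+ 2.
Proof.
rewrite /spec -!mulmxA dot_mulmx dotE; apply: eq_bigr => i _.
rewrite mul_diag_mx !mxE; ring.
Qed.

Lemma spec_col f i : spec f *m col i V = f i *: col i V.
Proof.
rewrite /spec -!mulmxA (_ : V^T *m col i V = delta_mx i 0); last first.
  by rewrite colE mulmxA VV mul1mx.
have -> : diag_mx (\row_i f i) *m (delta_mx i 0 : 'cV_n) = f i *: delta_mx i 0.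
  rewrite mul_diag_mx; apply/matrixP => i' j'; rewrite !mxE.
  by case: eqVneq => [->|]; rewrite ?mulr0.
by rewrite -scalemxAr -colE.
Qed.

(** The characteristic polynomial determines the multiset of its roots, and a nonincreasing list is
    determined by its multiset. *)
Lemma eigenvalues_spec f : (forall i j, (i <= j < n)%N -> f j <= f i) ->
  eigenvalues (spec f) = mkseq f n.
Proof.
move=> fnoninc; have [srt chp] := eigenvaluesP (tr_spec f).
have chf : char_poly (spec f) = \prod_(x <- mkseq f n) ('X - x%:P).
  rewrite /spec (char_poly_conj _ VV) char_poly_trig ?diag_mx_is_trig//.
  rewrite /mkseq big_map -[n in iota 0 n]subn0 -/(index_iota 0 n) big_mkord.
  by apply: eq_bigr => i _; rewrite !mxE eqxx.
apply: (@sorted_eq _ (fun x y : R => y <= x)) => //.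
- by move=> y x z yx zy; exact: le_trans zy yx.
- by move=> x y /andP[yx xy]; apply/eqP; rewrite eq_le xy.
- apply/(sortedP 0) => i; rewrite size_mkseq => ip.
  by rewrite !nth_mkseq// ?(ltnW ip)//; apply: fnoninc; rewrite leqnSn.
- by apply: prod_XsubC_perm; rewrite -chp chf.
Qed.

Lemma stable_rank_spec f k : (0 < k <= n)%N -> (forall i, 0 <= f i) ->
  (forall i j, (i <= j < n)%N -> f j <= f i) ->
  stable_rank k (spec f) = (\sum_(i < n | (k.-1 <= i)%N) f i) / f k.-1.
Proof.
move=> /andP[k0 kn] f0 fnoninc.
have sv : singular_values (spec f) = mkseq f n.
  rewrite /singular_values tr_spec spec_mul eigenvalues_spec; last first.
    by move=> i j ij; apply: ler_pM => //; exact: fnoninc.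
  rewrite /mkseq -map_comp; apply: eq_map => i /=.
  by rewrite -expr2 sqrtr_sqr ger0_norm.
have sE j : (0 < j <= n)%N -> sigma (spec f) j = f j.-1.
  by case: j => // j jn; rewrite /sigma sv nth_mkseq.
rewrite /stable_rank sE ?k0//; congr (_ / _).
rewrite -{1}(prednK k0) big_add1/= big_geq_mkord/=.
apply: eq_bigr => i _; rewrite sE//=.
Qed.

End SpectralCalculus.

Lemma symmetric_specE (R : realType) (n : nat) (A : 'M[R]_n) : A^T = A ->
  exists2 V : 'M[R]_n, V^T *m V = 1%:M & A = spec V (fun i => (eigenvalues A)`_i).
Proof. by move=> AT; have [_ /(symmetric_spectral AT)] := eigenvaluesP AT. Qed.

Lemma size_eigenvalues (R : realType) (n : nat) (A : 'M[R]_n) : A^T = A ->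
  size (eigenvalues A) = n.
Proof.
move=> AT; have [_ chA] := eigenvaluesP AT.
by apply: succn_inj; rewrite -(size_prod_XsubC _ id) -chA size_char_poly.
Qed.

Lemma eigenvalues_noninc (R : realType) (n : nat) (A : 'M[R]_n) i j : A^T = A ->
  (i <= j < n)%N -> (eigenvalues A)`_j <= (eigenvalues A)`_i.
Proof.
move=> AT /andP[ij jn]; have [srt _] := eigenvaluesP AT.
apply: (sorted_leq_nth (leT := fun x y => y <= x)) => //.
- by move=> y x z yx zy; exact: le_trans zy yx.
- by rewrite inE size_eigenvalues// (leq_ltn_trans ij).
- by rewrite inE size_eigenvalues.
Qed.

Lemma pos_def_eigenvalues (R : realType) (n : nat) (A : 'M[R]_n) i : pos_def A ->
  (i < n)%N -> 0 < (eigenvalues A)`_i.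
Proof.
move=> [AT Apos] ilt; have [V VV AE] := symmetric_specE AT.
pose x := col (Ordinal ilt) V.
have xx : dot x x = 1.
  by rewrite /x colE dot_mulmx mulmxA VV mul1mx dot_delta mxE !eqxx.
have x0 : x != 0 by rewrite -dot_eq0 xx oner_eq0.
have := Apos x x0; rewrite -mulmxA -/(dot _ _) {1}AE /x spec_col// dotZr -/x xx.
by rewrite mulr1.
Qed.

Section EuclideanNorm.
Context {R : realType}.

Lemma enormE (n : nat) (x : 'cV[R]_n) : enorm x = Num.sqrt (dot x x).
Proof. by rewrite /enorm dot_sqr. Qed.

Lemma enorm_ge0 (n : nat) (x : 'cV[R]_n) : 0 <= enorm x.
Proof. exact: sqrtr_ge0. Qed.

Lemma sqr_enorm (n : nat) (x : 'cV[R]_n) : enorm x ^+ 2 = dot x x.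
Proof. by rewrite enormE sqr_sqrtr// dot_ge0. Qed.

Lemma dot_le_enorm (n : nat) (x y : 'cV[R]_n) : dot x y <= enorm x * enorm y.
Proof.
apply: (le_trans (ler_norm _)); rewrite -sqrtr_sqr !enormE -sqrtrM ?dot_ge0//.
by apply: ler_wsqrtr; exact: dot_cauchy_schwarz.
Qed.

Lemma enorm0 (n : nat) : enorm (0 : 'cV[R]_n) = 0.
Proof. by rewrite enormE /dot mulmx0 mxE sqrtr0. Qed.

Lemma enormZ (n : nat) c (x : 'cV[R]_n) : enorm (c *: x) = `|c| * enorm x.
Proof.
by rewrite !enormE dotZr dotC dotZr mulrA -expr2 sqrtrM ?sqr_ge0// sqrtr_sqr.
Qed.

Lemma spectral_norm_le (m n : nat) (C : 'M[R]_(m, n)) c :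
  (forall x, enorm x <= 1 -> enorm (C *m x) <= c) -> spectral_norm C <= c.
Proof.
move=> H; apply: ge_sup.
  by exists (enorm (C *m 0)); exists 0; rewrite //= enorm0.
by move=> _ [x /= x1 <-]; exact: H.
Qed.

End EuclideanNorm.

(* Tangent line of [t |-> t ^ (m + 2)] as a function of [t ^ 2], at [c ^ 2]. *)
Lemma tangent_exprn (R : realDomainType) (m : nat) (a c : R) : 0 <= a -> 0 <= c ->
  (m%:R + 2) * c ^+ m * a ^+ 2 <= 2 * a ^+ m.+2 + m%:R * c ^+ m.+2.
Proof.
move=> a0 c0; elim: m => [|m IH]; first by rewrite expr0 mul0r; lra.
have h : 0 <= c ^+ m * ((a - c) ^+ 2 * ((m%:R + 2) * a + (m%:R + 1) * c)).
  by rewrite mulr_ge0 ?exprn_ge0// mulr_ge0 ?sqr_ge0// addr_ge0// mulr_ge0// addr_ge0.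
have := ler_wpM2l a0 IH; move: h.
rewrite !exprS -[m.+1%:R]/((1 + m)%:R : R) natrD.
set x := a ^+ m; set y := c ^+ m; set z := m%:R; rewrite expr0; nra.
Qed.

(** * The projection error of a fixed sample *)

Section ProjectionError.
Context {R : realType} {n l : nat} (V Pi : 'M[R]_n) (X : 'M[R]_(l, n)).
Variables (lam : nat -> R) (mu : R) (q : nat).
Hypothesis VV : V^T *m V = 1%:M.
Hypothesis lam0 : forall i, 0 <= lam i.
Hypothesis mu0 : 0 <= mu.
(** The power [q] of the theorem is [q.+1] from here on, which builds in [q >= 1]. *)
Local Notation s i := ((lam i + mu) * lam i ^+ q.+1).
Local Notation Amu := (spec V lam + mu%:M).
Hypothesis PiP : is_orth_projector Pi (Amu *m (spec V lam ^+ q.+1 *m X^T)).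

Lemma projection_kernel (y : 'cV[R]_n) (b : 'I_l) : Pi *m y = 0 ->
  \sum_(i < n) (s i * (V^T *m y) i 0) * (V^T *m X^T) i b = 0.
Proof.
move=> Piy; have [PiT _ /eqmxP PiM] := PiP.
have /submxP[D DE] : ((Amu *m (spec V lam ^+ q.+1 *m X^T))^T <= Pi^T)%MS by rewrite PiM.
have : (Amu *m (spec V lam ^+ q.+1 *m X^T))^T *m y = 0.
  by rewrite DE PiT -mulmxA Piy mulmx0.
rewrite (scalar_spec VV) spec_add spec_exp// mulmxA spec_mul//.
rewrite trmx_mul trmxK tr_spec /spec -!mulmxA mulmxA.
move=> /(congr1 (fun M : 'cV_l => M b 0)); rewrite mxE [RHS]mxE => E; apply: etrans E.
apply: eq_bigr => i _; rewrite mul_diag_mx.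
rewrite -[V^T *m X^T]trmxK trmx_mul !trmxK.
by rewrite [(X *m V)^T i b]mxE [(\matrix_(_, _) _) i 0]mxE !mxE mulrC.
Qed.

Variables (j : nat) (w : R).
Hypothesis lam_noninc : forall i, (j <= i < n)%N -> lam i <= lam j.
Hypothesis w0 : 0 <= w.
Hypothesis head_le : forall y : 'cV[R]_n, Pi *m y = 0 ->
  \sum_(i < n | (i < j)%N) (s i * (V^T *m y) i 0) ^+ 2 <=
  w ^+ 2 * \sum_(i < n | ~~ (i < j)%N) (V^T *m y) i 0 ^+ 2.

Let s0 i : 0 <= s i. Proof. by rewrite mulr_ge0 ?exprn_ge0 ?addr_ge0. Qed.

(** The tail contributes at most [s j * N2]. On the head, Cauchy-Schwarz and [head_le] give
    [w * sqrt (N1 * N2)], and AM-GM turns this into [w / 2] times [N1 + N2]. *)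
Let quadratic_le (y : 'cV[R]_n) : Pi *m y = 0 ->
  \sum_(i < n) s i * (V^T *m y) i 0 ^+ 2 <= (s j + w / 2) * dot y y.
Proof.
move=> /head_le hy; set nu := V^T *m y in hy *.
have NE : dot y y = \sum_(i < n | (i < j)%N) nu i 0 ^+ 2 + \sum_(i < n | ~~ (i < j)%N) nu i 0 ^+ 2.
  by rewrite -(dot_isometry VV) dot_sqr (bigID (fun i : 'I_n => (i < j)%N)).
set N1 := \sum_(i < n | _) _ in NE; set N2 := \sum_(i < n | _) _ in NE hy.
have N10 : 0 <= N1 by apply: sumr_ge0 => i _; exact: sqr_ge0.
have N20 : 0 <= N2 by apply: sumr_ge0 => i _; exact: sqr_ge0.
rewrite (bigID (fun i : 'I_n => (i < j)%N))/= NE addrC mulrDl; apply: lerD.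
  apply: (@le_trans _ _ (s j * N2)).
    rewrite /N2 mulr_sumr; apply: ler_sum => i; rewrite -leqNgt => ji.
    rewrite ler_wpM2r ?sqr_ge0//; have lij : lam i <= lam j by rewrite lam_noninc// ji ltn_ord.
    apply: ler_pM; rewrite ?exprn_ge0 ?addr_ge0 ?lerD2r//.
    by apply: lerXn2r; rewrite ?nnegrE.
  by rewrite ler_wpM2l// lerDr.
set H := \sum_(i < n | _) (s i * _) ^+ 2 in hy.
set L := \sum_(i < n | _) _ * _ ^+ 2.
have L2 : L ^+ 2 <= H * N1.
  have := sum_cauchy_schwarz (fun i : 'I_n => if (i < j)%N then s i * nu i 0 else 0)
    (fun i => if (i < j)%N then nu i 0 else 0).
  rewrite /L /H /N1 ![\sum_(i < n | (i < j)%N) _]big_mkcond/=; congr (_ ^+ 2 <= _ * _);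
    apply: eq_bigr => i _; case: ifP => _; rewrite ?expr0n ?mul0r//.
  by rewrite expr2 mulrA.
have h : L ^+ 2 <= (w / 2 * (N1 + N2)) ^+ 2.
  apply: (le_trans L2); apply: (@le_trans _ _ (w ^+ 2 * N2 * N1)).
    by rewrite ler_wpM2r.
  have : 0 <= w ^+ 2 * (N1 - N2) ^+ 2 by rewrite mulr_ge0 ?sqr_ge0.
  by rewrite !expr2; lra.
rewrite -(@ler_pXn2r _ 2)// ?nnegrE//.
- by apply: sumr_ge0 => i _; rewrite mulr_ge0 ?sqr_ge0.
- by rewrite mulr_ge0// ?divr_ge0// addr_ge0.
Qed.

Lemma enorm_spec_le (y : 'cV[R]_n) : Pi *m y = 0 ->
  enorm (spec V lam *m y) <= (s j + w / 2) `^ (1 / (q.+1%:R + 1)) * enorm y.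
Proof.
move=> Piy; have [->|y0] := eqVneq y 0; first by rewrite mulmx0 !enorm0 mulr0.
have N0 : 0 < dot y y by rewrite dot_gt0.
set c := enorm (spec V lam *m y) / enorm y.
have e0 : 0 < enorm y by rewrite enormE sqrtr_gt0.
have c0 : 0 <= c by rewrite divr_ge0 ?enorm_ge0.
have c2 : c ^+ 2 * dot y y = \sum_(i < n) lam i ^+ 2 * (V^T *m y) i 0 ^+ 2.
  rewrite expr_div_n !sqr_enorm divfK ?gt_eqF// dot_mulmx tr_spec mulmxA spec_mul// dotC.
  by rewrite dot_spec; apply: eq_bigr => i _; rewrite expr2.
(* [c ^+ 2] is the mean of [lam i ^+ 2] for weights proportional to the squared coordinates of [y].
   Summing the tangent inequality at [c] itself is Jensen's inequality, and [mu >= 0] gives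
   [lam i ^+ q.+2 <= s i]. *)
have jensen : c ^+ q.+2 * dot y y <= (s j + w / 2) * dot y y.
  apply: le_trans (quadratic_le Piy).
  apply: (@le_trans _ _ (\sum_(i < n) lam i ^+ q.+2 * (V^T *m y) i 0 ^+ 2)); last first.
    apply: ler_sum => i _; rewrite ler_wpM2r ?sqr_ge0// [leLHS]exprS.
    by rewrite ler_wpM2r ?exprn_ge0// lerDl.
  have : (q%:R + 2) * c ^+ q * (c ^+ 2 * dot y y) <=
      2 * (\sum_(i < n) lam i ^+ q.+2 * (V^T *m y) i 0 ^+ 2) +
      q%:R * c ^+ q.+2 * dot y y.
    rewrite c2 -(dot_isometry VV) dot_sqr !mulr_sumr -big_split/=.
    apply: ler_sum => i _.
    have := ler_wpM2r (sqr_ge0 ((V^T *m y) i 0)) (tangent_exprn q (lam0 i) c0).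
    by rewrite -[leLHS]mulrA [leRHS]mulrDl -[2 * _ * _]mulrA.
  have -> : (q%:R + 2) * c ^+ q * (c ^+ 2 * dot y y) = (q%:R + 2) * (c ^+ q.+2 * dot y y).
    by rewrite !exprS; ring.
  rewrite -[q%:R * _ * _]mulrA; set u := c ^+ q.+2 * _; lra.
rewrite ler_pM2r// in jensen.
rewrite -ler_pdivrMr// -/c.
have -> : c = (c ^+ q.+2) `^ (1 / (q.+1%:R + 1)).
  rewrite -powR_mulrn// -powRrM natr1 mul1r divff ?powRr1//.
apply: ge0_ler_powR; rewrite ?nnegrE ?exprn_ge0//.
- by rewrite addr_ge0// divr_ge0.
Qed.

(** The vector [y = (1 - Pi) Amu x] lies in the kernel of [Pi], so [|y|^2] is the pairing of [Amu y]
    with [x]. The multiple of the identity costs [mu |y|], and [enorm_spec_le] bounds [|A y|]. *)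
Lemma projection_error_le :
  spectral_norm ((1%:M - Pi) *m Amu) <= mu + (s j + w / 2) `^ (1 / (q.+1%:R + 1)).
Proof.
have [PiT PiPi _] := PiP; set theta := _ `^ _.
have theta0 : 0 <= theta by exact: powR_ge0.
apply: spectral_norm_le => x x1; set y := _ *m x.
have Piy : Pi *m y = 0.
  by rewrite /y !mulmxA mulmxBr mulmx1 PiPi subrr !mul0mx.
have yy : dot y y = dot (Amu *m y) x.
  rewrite {2}/y -!mulmxA dot_mulmx linearB/= trmx1 PiT mulmxBl mul1mx Piy subr0.
  by rewrite dot_mulmx linearD/= tr_spec tr_scalar_mx.
have [->|y0] := eqVneq y 0; first by rewrite enorm0 addr_ge0.
have e0 : 0 < enorm y by rewrite enormE sqrtr_gt0 dot_gt0.
rewrite -(ler_pM2r e0) -expr2 sqr_enorm yy mulmxDl mul_scalar_mx dotC dotDr dotZr addrC mulrDl.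
apply: lerD.
  rewrite ler_wpM2l// dotC; apply: (le_trans (dot_le_enorm _ _)).
  by rewrite -[leRHS]mulr1 ler_wpM2l ?enorm_ge0.
apply: (le_trans (dot_le_enorm _ _)); rewrite mulrC.
apply: (@le_trans _ _ (enorm (spec V lam *m y) * 1)).
  by rewrite ler_wpM2l ?enorm_ge0.
by rewrite mulr1; exact: enorm_spec_le.
Qed.

End ProjectionError.

(** * Numerical constants *)

(** The exponent [6] is the first [n] with [(1 - 1 / n)^n >= 1 / 3]. *)
Lemma expR1_le3 (R : realType) : expR 1 <= 3 :> R.
Proof.
have h : 1 - 1 / 6 <= expR (- (1 / 6)) :> R by have := expR_ge1Dx (- (1 / 6) : R).
have h6 : (1 - 1 / 6) ^+ 6 <= expR (- 1) :> R.
  have -> : (- 1 : R) = 6%:R * (- (1 / 6)) by field.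
  rewrite expRM_natl; apply: lerXn2r; rewrite ?nnegrE ?expR_ge0//; lra.
rewrite -[expR 1]invrK -expRN -[leRHS]invrK lef_pV2 ?posrE ?expR_gt0 ?invr_gt0//.
apply: le_trans h6; rewrite !exprS expr0; lra.
Qed.

Lemma exprn_succ_le (R : realType) n : n.+1%:R ^+ n <= 3 * n%:R ^+ n :> R.
Proof.
case: n => [|n]; first by rewrite !expr0; lra.
have n0 : 0 < n.+1%:R :> R by [].
have -> : n.+2%:R = (1 + n.+1%:R^-1) * n.+1%:R :> R.
  by rewrite mulrDl mulVf ?gt_eqF// mul1r -natr1.
rewrite exprMn ler_pM2r ?exprn_gt0//; apply: (le_trans _ (expR1_le3 R)).
rewrite -[in leRHS](@divff _ (n.+1%:R : R)) ?gt_eqF// expRM_natl; apply: lerXn2r; rewrite ?nnegrE ?expR_ge0//.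
exact: expR_ge1Dx.
Qed.

(** Stirling's lower bound with [3] in place of [e], so that the later comparisons are between
    rationals. *)
Lemma fact_ge (R : realType) n : (n%:R / 3) ^+ n <= n`!%:R :> R.
Proof.
elim: n => [|n IH]; first by rewrite expr0.
rewrite exprS factS natrM -mulrA ler_pM2l//; apply: le_trans IH.
rewrite !expr_div_n mulrA ler_pM2r ?invr_gt0 ?exprn_gt0//.
by rewrite mulrC ler_pdivrMr// mulrC exprn_succ_le.
Qed.

Lemma prod_odd_ge (R : realType) p : (p%:R / 2) ^+ p <= \prod_(j < p) (1 + 2 * j%:R) :> R.
Proof.
elim: p => [|p IH]; first by rewrite expr0 big_ord0.
rewrite big_ord_recr/=; have h := exprn_succ_le R p.
have p0 : 0 <= p%:R :> R by [].
apply: le_trans (ler_wpM2r _ IH); last by rewrite addr_ge0 ?mulr_ge0.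
rewrite exprSr !expr_div_n ![_ / 2 ^+ p * _]mulrAC.
rewrite ler_pM2r ?invr_gt0 ?exprn_gt0//.
(* The inductive step amounts to [3 (p + 1) / 2 <= 1 + 2 p], which starts at [p = 1]. *)
case: p h p0 {IH} => [|p] h p0; first by rewrite !expr0; lra.
have p1 : 1 <= p.+1%:R :> R by rewrite ler1n.
apply: le_trans (ler_wpM2r _ h) _; first by rewrite divr_ge0.
have y0 : 0 <= p.+1%:R ^+ p.+1 :> R by rewrite exprn_ge0.
by rewrite -[p.+2%:R]natr1; nra.
Qed.

(* Pair the factors [j] and [h - j] and apply AM-GM. *)
Lemma prod_arith_le (R : realType) (x : R) h : 0 <= x ->
  \prod_(j < h.+1) (x + 2 * j%:R) <= (x + h%:R) ^+ h.+1.
Proof.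
move=> x0; set p := \prod_(j < _) _.
have pos (j : 'I_h.+1) : 0 <= x + 2 * j%:R by rewrite addr_ge0 ?mulr_ge0.
rewrite -(@ler_pXn2r _ 2) ?nnegrE ?exprn_ge0 ?addr_ge0 ?prodr_ge0//.
have -> : p ^+ 2 = \prod_(j < h.+1) ((x + 2 * j%:R) * (x + 2 * (rev_ord j)%:R)).
  by rewrite big_split/= expr2; congr (_ * _); rewrite /p (reindex_inj rev_ord_inj).
have -> : ((x + h%:R) ^+ h.+1) ^+ 2 = \prod_(j < h.+1) (x + h%:R) ^+ 2.
  by rewrite prodr_const card_ord exprAC.
apply: ler_prod => j _; rewrite (mulr_ge0 (pos j) (pos (rev_ord j)))/=.
have jh : (j <= h)%N by rewrite -ltnS.
rewrite -subr_ge0 -{1}(subnKC jh) natrD subSS.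
rewrite [leRHS](_ : _ = (j%:R - (h - j)%:R) ^+ 2) ?sqr_ge0//; ring.
Qed.

(** The first factors are the odd numbers up to [2h + 1]; the second, read backwards, are the even
    numbers up to [2h + 2]. *)
Lemma prod_odd_even (R : comPzRingType) h :
  \prod_(j < h.+1) ((1 + 2 * j%:R) * (2 * h%:R + 2 - 2 * j%:R)) = (2 * h.+1)`!%:R :> R.
Proof.
rewrite big_split/= [X in _ * X](reindex_inj rev_ord_inj)/=.
rewrite [X in _ * X](eq_bigr (fun j : 'I_h.+1 => 2 * j%:R + 2)); last first.
  by move=> j _; rewrite subSS natrB -1?ltnS//; ring.
rewrite -big_split/=; elim: h.+1 => [|m IH]; first by rewrite big_ord0.
rewrite big_ord_recr/= IH mulnS add2n !factS !natrM -!natr1 natrM; ring.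
Qed.

Section MomentConstants.
Context {R : realType}.
Variables (k : nat) (x : R).
Hypothesis k3 : (3 <= k)%N.
Hypothesis x0 : 0 <= x.
Local Notation term j := ((k.-1%:R + 2 * j%:R) * (x + 2 * j%:R) /
  ((1 + 2 * j%:R) * (k%:R + 2 - 2 * j%:R))).

(* Here [x] is the stable rank; the orders [p = k/8 + 1] and [p = k/2 + 1] are those
   for which the constants of the theorem come out. *)
Lemma moment_constant_expectation :
  \prod_(j < (k %/ 8).+1) term j <=
  (2 + 2 * (Num.sqrt 2 * expR 1) * Num.sqrt (x / k%:R)) ^+ (2 * (k %/ 8).+1).
Proof.
set h := (k %/ 8)%N.
have k0 : 0 < k%:R :> R by rewrite ltr0n; lia.
have hk : 8 * h%:R <= k%:R :> R by rewrite -natrM ler_nat /h; lia.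
have hk1 : k%:R <= 8 * h.+1%:R :> R by rewrite -natrM ler_nat /h; lia.
have kp : k.-1%:R = k%:R - 1 :> R by rewrite -[in RHS](ltn_predK k3) -natr1 addrK.
have jh (j : 'I_h.+1) : j%:R <= h%:R :> R by rewrite ler_nat -ltnS.
(* For [j <= k / 8] the ratio of [k - 1 + 2j] to [k + 2 - 2j] is at most
   [(5 / 4) / (3 / 4) = 5 / 3]. *)
have h1 : \prod_(j < h.+1) term j <=
    \prod_(j < h.+1) (5 / 3 * (x + 2 * j%:R) / (1 + 2 * j%:R)).
  apply: ler_prod => j _; have jj := jh j.
  have j0 : 0 <= j%:R :> R by [].
  have d0 : 0 < k%:R + 2 - 2 * j%:R :> R by lra.
  have e0 : 0 < 1 + 2 * j%:R :> R by lra.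
  have f0 : 0 <= x + 2 * j%:R by rewrite addr_ge0 ?mulr_ge0.
  have g0 : 0 <= k.-1%:R + 2 * j%:R :> R by rewrite addr_ge0 ?mulr_ge0.
  rewrite divr_ge0 ?mulr_ge0 ?(ltW e0) ?(ltW d0)//=.
  have -> : term j = (k.-1%:R + 2 * j%:R) / (k%:R + 2 - 2 * j%:R) * (x + 2 * j%:R) / (1 + 2 * j%:R).
    by field; rewrite !gt_eqF.
  rewrite ler_wpM2r ?invr_ge0 ?(ltW e0)// ler_wpM2r//.
  by rewrite ler_pdivrMr// kp; lra.
apply: (le_trans h1).
set c := Num.sqrt 2 * expR 1; set y := Num.sqrt (x / k%:R).
have xk0 : 0 <= x / k%:R by rewrite divr_ge0// ltW.
have y2 : y ^+ 2 = x / k%:R by rewrite sqr_sqrtr.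
have y0 : 0 <= y by exact: sqrtr_ge0.
have c0 : 0 <= c by rewrite mulr_ge0 ?sqrtr_ge0 ?expR_ge0.
have c2 : 8 <= c ^+ 2.
  rewrite exprMn sqr_sqrtr//.
  have e2 : 2 <= expR 1 :> R by have := expR_ge1Dx (1 : R).
  by nra.
have -> : \prod_(j < h.+1) (5 / 3 * (x + 2 * j%:R) / (1 + 2 * j%:R)) =
    (5 / 3) ^+ h.+1 * (\prod_(j < h.+1) (x + 2 * j%:R)) / \prod_(j < h.+1) (1 + 2 * j%:R).
  by rewrite -prodfV 2!big_split/= prodr_const card_ord.
have P0 : 0 < h.+1%:R / 2 :> R by rewrite divr_gt0.
apply: (@le_trans _ _ ((5 / 3) ^+ h.+1 * (x + h%:R) ^+ h.+1 / (h.+1%:R / 2) ^+ h.+1)).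
  apply: ler_pM.
  - by rewrite mulr_ge0 ?exprn_ge0 ?divr_ge0// prodr_ge0// => j _; rewrite addr_ge0 ?mulr_ge0.
  - by rewrite invr_ge0 prodr_ge0// => j _; rewrite addr_ge0 ?mulr_ge0.
  - by rewrite ler_wpM2l ?exprn_ge0 ?divr_ge0// prod_arith_le.
  - rewrite lef_pV2 ?posrE ?exprn_gt0//; first exact: prod_odd_ge.
    by apply: prodr_gt0 => j _; rewrite ltr_wpDr ?mulr_ge0.
rewrite -exprMn -expr_div_n exprM; apply: lerXn2r; rewrite ?nnegrE.
- by rewrite divr_ge0 ?(ltW P0)// mulr_ge0 ?divr_ge0 ?addr_ge0.
- exact: sqr_ge0.
rewrite ler_pdivrMr//.
have xE : x = y ^+ 2 * k%:R by rewrite y2 divfK ?gt_eqF.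
rewrite xE; set N := h.+1%:R in hk1 P0 *; set K := k%:R in hk hk1 k0 *.
have N1 : h%:R <= N by rewrite /N -natr1 lerDl.
have yy : 0 <= y ^+ 2 by exact: sqr_ge0.
have cy : 0 <= c * y by exact: mulr_ge0.
have h2 : y ^+ 2 * K <= y ^+ 2 * (8 * N) by rewrite ler_wpM2l.
have h3 : 8 * y ^+ 2 <= c ^+ 2 * y ^+ 2 by rewrite ler_wpM2r.
(* Both [x <= 8 N y^2] (from [k <= 8 N]) and [c^2 = 2 e^2 >= 8] meet here: [5/3 * (8 y^2 + 1) N] is
   below [(4 + 32 y^2) N / 2], and [(2 + 2 c y)^2 >= 4 + 32 y^2]. *)
apply: (@le_trans _ _ ((4 + 4 * (8 * y ^+ 2)) * (N / 2))).
  have NN : 0 <= N * y ^+ 2 by rewrite mulr_ge0// ler0n.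
  by have := ler0n R h.+1; rewrite -/N; lra.
rewrite ler_wpM2r ?(ltW P0)//.
rewrite (_ : (2 + 2 * c * y) ^+ 2 = 4 + 8 * (c * y) + 4 * (c ^+ 2 * y ^+ 2)); last by ring.
by lra.
Qed.

Lemma moment_constant_probability :
  \prod_(j < (k %/ 2).+1) term j <=
  6 ^- k * (34 + 2 * (8 * Num.sqrt 2) * Num.sqrt (x / k%:R)) ^+ (2 * (k %/ 2).+1).
Proof.
set h := (k %/ 2)%N; set y := Num.sqrt (x / k%:R).
have k0 : 0 < k%:R :> R by rewrite ltr0n; lia.
have h1k : (2 * h <= k)%N by rewrite /h; lia.
have kh1 : (k <= 2 * h + 1)%N by rewrite /h; lia.
have hk : 2 * h%:R <= k%:R :> R by rewrite -natrM ler_nat.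
have kk : k%:R <= 2 * h%:R + 1 :> R by rewrite -natrM natr1 -addn1 ler_nat.
have kp : k.-1%:R = k%:R - 1 :> R by rewrite -[in RHS](ltn_predK k3) -natr1 addrK.
have jh (j : 'I_h.+1) : j%:R <= h%:R :> R by rewrite ler_nat -ltnS.
have y0 : 0 <= y by exact: sqrtr_ge0.
have y2 : y ^+ 2 = x / k%:R by rewrite sqr_sqrtr// divr_ge0// ltW.
set theta := 34 + _; have th0 : 0 <= theta ^+ 2 by exact: sqr_ge0.
(* Since [512 = (16 * sqrt 2)^2], the terms in [y^2] agree exactly; the constant [34^2 / 512] has
   only to exceed [h / k <= 1 / 2]. *)
have th2 : x + h%:R <= k%:R / 512 * theta ^+ 2.
  have xE : x = y ^+ 2 * k%:R by rewrite y2 divfK ?gt_eqF.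
  have s2 : Num.sqrt 2 ^+ 2 = 2 :> R by rewrite sqr_sqrtr.
  have -> : theta ^+ 2 = 1156 + 1088 * (Num.sqrt 2 * y) + 256 * (Num.sqrt 2 ^+ 2 * y ^+ 2).
    by rewrite /theta; ring.
  have sy : 0 <= k%:R * (Num.sqrt 2 * y) by rewrite !mulr_ge0 ?sqrtr_ge0// ltW.
  rewrite s2 [X in X + _]xE; lra.
have P0 (j : 'I_h.+1) : 0 < 2 * h%:R + 2 - 2 * j%:R :> R by have := jh j; lra.
(* Rounding [k] down to [2h] in the denominators turns them into the factorial of
   [prod_odd_even]. *)
have h1 : \prod_(j < h.+1) term j <=
    \prod_(j < h.+1) (k.-1%:R + 2 * j%:R) * \prod_(j < h.+1) (x + 2 * j%:R) / (2 * h.+1)`!%:R.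
  rewrite -prod_odd_even -prodfV -!big_split/=; apply: ler_prod => j _.
  have jj := jh j; have pj := P0 j; have j0 : 0 <= j%:R :> R by [].
  have g0 : 0 <= (k.-1%:R + 2 * j%:R) * (x + 2 * j%:R).
    by rewrite mulr_ge0// addr_ge0 ?mulr_ge0.
  have e0 : 0 < 1 + 2 * j%:R :> R by lra.
  have d0 : 0 < k%:R + 2 - 2 * j%:R :> R by lra.
  rewrite (divr_ge0 g0 (mulr_ge0 (ltW e0) (ltW d0)))/= ler_wpM2l//.
  by rewrite lef_pV2 ?posrE ?mulr_gt0// ler_pM2l//; lra.
apply: (le_trans h1).
set p := h.+1; have p0 : 0 < p%:R :> R by [].
have pE : p%:R = h%:R + 1 :> R by rewrite /p -natr1.
have F0 : 0 < (2 * p)`!%:R :> R by rewrite ltr0n fact_gt0.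
rewrite ler_pdivrMr//.
have A1 : \prod_(j < p) (k.-1%:R + 2 * j%:R) <= (3 * p%:R) ^+ p :> R.
  apply: (le_trans (prod_arith_le _ _)) => //.
  by apply: lerXn2r; rewrite ?nnegrE ?addr_ge0 ?mulr_ge0// kp pE; lra.
have A2 : \prod_(j < p) (x + 2 * j%:R) <= (p%:R / 256 * theta ^+ 2) ^+ p.
  apply: (le_trans (prod_arith_le _ x0)); apply: lerXn2r; rewrite ?nnegrE ?addr_ge0//.
    by rewrite mulr_ge0 ?divr_ge0.
  apply: (le_trans th2); rewrite ler_wpM2r// pE; lra.
have A0 : 0 <= \prod_(j < p) (x + 2 * j%:R) by rewrite prodr_ge0// => j _; rewrite addr_ge0 ?mulr_ge0.
have B0 : 0 <= \prod_(j < p) (k.-1%:R + 2 * j%:R) :> R by rewrite prodr_ge0// => j _; rewrite addr_ge0 ?mulr_ge0.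
apply: (le_trans (ler_pM B0 A0 A1 A2)).
have F := fact_ge R (2 * p).
have T0 : 0 <= theta ^+ (2 * p) by rewrite exprM exprn_ge0.
apply: (@le_trans _ _ (6 ^- k * theta ^+ (2 * p) * ((2 * p)%:R / 3) ^+ (2 * p))); last first.
  by rewrite ler_wpM2l// mulr_ge0// invr_ge0 exprn_ge0.
(* Passing from [k] to [2p >= k] makes every factor a [p]-th power, so that only the bases remain to
   be compared. *)
have k6 : 6 ^- (2 * p) <= 6 ^- k :> R.
  have kp2 : (k <= 2 * p)%N by rewrite (leq_trans kh1)// mulnS addnC leq_add2r.
  rewrite lef_pV2 ?posrE ?exprn_gt0//.
  by apply: ler_weXn2l => //; rewrite ler1n.
apply: (@le_trans _ _ (6 ^- (2 * p) * theta ^+ (2 * p) * ((2 * p)%:R / 3) ^+ (2 * p))); last first.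
  by rewrite ler_wpM2r ?exprn_ge0 ?divr_ge0// ler_wpM2r.
(* The bases compare as [3 / 256 <= 1 / 81], where [81] is the inverse square of
   [(1 / 6) * (2 / 3)]; this is what makes the rate [6] affordable. *)
rewrite -!exprMn -!exprVn !(exprM _ 2) -!exprMn; apply: lerXn2r; rewrite ?nnegrE.
- by apply: mulr_ge0; [exact: mulr_ge0|apply: mulr_ge0 => //; exact: divr_ge0].
- exact: sqr_ge0.
rewrite natrM.
have -> : 3 * p%:R * (p%:R / 256 * theta ^+ 2) = 3 / 256 * (p%:R ^+ 2 * theta ^+ 2) by ring.
have -> : (6^-1 * theta * (2 * p%:R / 3)) ^+ 2 = 1 / 81 * (p%:R ^+ 2 * theta ^+ 2) by field.
apply: ler_wpM2r; first exact: (mulr_ge0 (sqr_ge0 _) (sqr_ge0 _)).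
lra.
Qed.

End MomentConstants.

(** * Measurability of the projection error *)

Lemma cvg_bigsum (R : realType) (I : Type) (r : seq I) (f : I -> nat -> R) (a : I -> R) :
  (forall i, f i @ \oo --> a i) ->
  (fun N => \sum_(i <- r) f i N) @ \oo --> \sum_(i <- r) a i.
Proof.
move=> fa; elim: r => [|i r IH].
  by under eq_cvg do rewrite big_nil; rewrite big_nil; exact: cvg_cst.
by under eq_cvg do rewrite big_cons; rewrite big_cons; exact: cvgD.
Qed.

Section SpectralNorm.
Context {R : realType} {m n : nat}.
Implicit Types C : 'M[R]_(m, n).

Lemma enorm_mulmx_bounded C (x : 'cV[R]_n) :
  enorm (C *m x) ^+ 2 <= (\sum_i \sum_j C i j ^+ 2) * dot x x.
Proof.
rewrite sqr_enorm dot_sqr mulr_suml; apply: ler_sum => i _.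
by rewrite mxE dot_sqr; exact: sum_cauchy_schwarz.
Qed.

Lemma has_sup_spectral_norm C :
  has_sup [set enorm (C *m x) | x in [set x : 'cV[R]_n | enorm x <= 1]].
Proof.
split; first by exists (enorm (C *m 0)); exists 0; rewrite //= enorm0.
exists (1 + \sum_i \sum_j C i j ^+ 2) => _ [x /= x1 <-].
have S0 : 0 <= \sum_i \sum_j C i j ^+ 2.
  by apply: sumr_ge0 => i _; apply: sumr_ge0 => j _; exact: sqr_ge0.
have := enorm_mulmx_bounded C x; rewrite -sqr_enorm => h.
have x2 : enorm x ^+ 2 <= 1 by rewrite expr_le1 ?enorm_ge0.
rewrite -(@ler_pXn2r _ 2) ?nnegrE ?enorm_ge0 ?addr_ge0//; apply: (le_trans h).
have := ler_wpM2l S0 x2; have := sqr_ge0 (\sum_i \sum_j C i j ^+ 2).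
rewrite !expr2; lra.
Qed.

Lemma spectral_norm_ge0 C : 0 <= spectral_norm C.
Proof.
rewrite -(@enorm0 R m); apply: (ub_le_sup (proj2 (has_sup_spectral_norm C))).
by exists 0 => /=; rewrite ?mulmx0 ?enorm0.
Qed.

Lemma enorm_mulmx_le C x : enorm (C *m x) <= spectral_norm C * enorm x.
Proof.
have [->|x0] := eqVneq x 0; first by rewrite mulmx0 !enorm0 mulr0.
have e0 : 0 < enorm x by rewrite enormE sqrtr_gt0 dot_gt0.
rewrite -ler_pdivrMr//; apply: (ub_le_sup (proj2 (has_sup_spectral_norm C))).
exists ((enorm x)^-1 *: x) => /=.
  by rewrite enormZ ger0_norm ?invr_ge0 ?(ltW e0)// mulVf ?gt_eqF.
by rewrite -scalemxAr enormZ ger0_norm ?invr_ge0 ?(ltW e0)// mulrC.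
Qed.

Definition int_col (z : {ffun 'I_n -> int}) : 'cV[R]_n := \col_i (z i)%:~R.

(* By homogeneity integer vectors suffice, so that countably many conditions do. *)
Lemma spectral_norm_leP C c : 0 <= c -> spectral_norm C <= c <->
  forall z, dot (C *m int_col z) (C *m int_col z) <= c ^+ 2 * dot (int_col z) (int_col z).
Proof.
move=> c0; split=> [Cc z|H].
  rewrite -!sqr_enorm -exprMn; apply: lerXn2r; rewrite ?nnegrE ?mulr_ge0 ?enorm_ge0//.
  by apply: (le_trans (enorm_mulmx_le _ _)); rewrite ler_wpM2r ?enorm_ge0.
apply: spectral_norm_le => x x1.
suff h : dot (C *m x) (C *m x) <= c ^+ 2 * dot x x.
  rewrite -(@ler_pXn2r _ 2) ?nnegrE ?enorm_ge0// sqr_enorm (le_trans h)//.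
  by rewrite -sqr_enorm ler_piMr ?sqr_ge0// expr_le1 ?enorm_ge0.
pose z N : {ffun 'I_n -> int} := [ffun i => Num.floor (N.+1%:R * x i 0)].
pose y N : 'cV[R]_n := N.+1%:R^-1 *: int_col (z N).
have yx i : (fun N => y N i 0) @ \oo --> x i 0.
  apply: (@squeeze_cvgr _ _ _ _ (fun N => x i 0 - harmonic N) (fun=> x i 0)).
  - apply: nearW => N; have N0 : 0 < N.+1%:R :> R by [].
    rewrite /y !mxE ffunE /harmonic/= -(ler_pM2l N0) -[X in _ && X](ler_pM2l N0).
    rewrite mulrBr !mulrA divff ?gt_eqF// mul1r floor_le andbT.
    by rewrite lerBlDr ltW// -intrD1 floorD1_gt.
  - by rewrite -[X in _ --> X]subr0; apply: cvgB; [exact: cvg_cst|exact: cvg_harmonic].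
  - exact: cvg_cst.
have Hy N : dot (C *m y N) (C *m y N) <= c ^+ 2 * dot (y N) (y N).
  rewrite /y -scalemxAr !dotZr ![dot (_ *: _) _]dotC !dotZr !mulrA.
  have := H (z N); have i0 : 0 <= N.+1%:R^-1 ^+ 2 :> R by exact: sqr_ge0.
  by move=> /(ler_wpM2l i0); congr (_ <= _); ring.
have dcvg p (D : 'M[R]_(p, n)) : (fun N => dot (D *m y N) (D *m y N)) @ \oo --> dot (D *m x) (D *m x).
  have Dy i : (fun N => (D *m y N) i 0) @ \oo --> (D *m x) i 0.
    under eq_cvg do rewrite mxE; rewrite mxE.
    by apply: cvg_bigsum => j; apply: cvgM; [exact: cvg_cst|exact: yx].
  under eq_cvg do rewrite dotE; rewrite dotE.
  by apply: cvg_bigsum => i; apply: cvgM; exact: Dy.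
have rhs : (fun N => c ^+ 2 * dot (y N) (y N)) @ \oo --> c ^+ 2 * dot x x.
  apply: cvgM; first exact: cvg_cst.
  by have := dcvg _ 1%:M; rewrite mul1mx; under eq_cvg do rewrite mul1mx.
by apply: (ler_cvg_to (dcvg _ C) rhs); apply: nearW.
Qed.

Lemma measurable_spectral_norm d (T : measurableType d) (Z : T -> 'M[R]_(m, n)) :
  (forall i j, measurable_fun setT (fun w => Z w i j)) ->
  measurable_fun setT (fun w => spectral_norm (Z w)).
Proof.
move=> mZ; apply: (measurability _ (RGenOInfty.measurableE R)) => _ [_ [c ->] <-].
rewrite setTI; have -> : (fun w => spectral_norm (Z w)) @^-1` `]c, +oo[ =
    ~` [set w | spectral_norm (Z w) <= c].
  by apply/seteqP; split => w /=; rewrite in_itv/= andbT ltNge => /negP.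
apply: measurableC; have [c0|c0] := ltP c 0.
  rewrite (_ : [set _ | _] = set0)//; apply/seteqP; split => w //= h.
  by have := lt_le_trans (le_lt_trans h c0) (spectral_norm_ge0 (Z w)); rewrite ltxx.
(* Decoding natural numbers enumerates the integer vectors; a number that decodes to nothing imposes
   no condition. *)
pose F k := if unpickle k is Some z then [set w | dot (Z w *m int_col z) (Z w *m int_col z)
  <= c ^+ 2 * dot (int_col z) (int_col z)] else setT.
have -> : [set w | spectral_norm (Z w) <= c] = \bigcap_k F k.
  apply/seteqP; split => w /=.
    by move=> /(spectral_norm_leP _ c0) h k _; rewrite /F; case: unpickle => // z; exact: h.
  by move=> h; apply/(spectral_norm_leP _ c0) => z; have := h (pickle z) I; rewrite /F pickleK.
apply: bigcapT_measurable => k; rewrite /F; case: unpickle => // z.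
rewrite -[X in measurable X]setTI.
have mE i : measurable_fun setT (fun w => (Z w *m int_col z) i 0).
  under eq_fun do rewrite mxE; apply: measurable_sum => j.
  by apply: measurable_funM.
have : measurable_fun setT (fun w => dot (Z w *m int_col z) (Z w *m int_col z)).
  under eq_fun do rewrite dotE; apply: measurable_sum => i.
  by apply: measurable_funM.
move=> /(_ measurableT `]-oo, c ^+ 2 * dot (int_col z) (int_col z)]%classic) h.
have := h (measurable_itv _); congr measurable.
Qed.

End SpectralNorm.

Section MeasurableProjector.
Context {R : realType} {n l : nat}.
Implicit Types (Y : 'M[R]_(n, l)) (Pi : 'M[R]_n).

Let maskT_mul p (B : 'M[R]_(n, p)) : mask predT *m B = B.
Proof. by apply/matrixP => i j; rewrite mask_mulE mul1r. Qed.

Let maskT : mask predT = 1%:M :> 'M[R]_n.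
Proof. by rewrite -[LHS]mulmx1 maskT_mul. Qed.

Let gramT Y : gram predT Y = Y *m Y^T.
Proof. by rewrite /gram maskT mul1mx mulmx1. Qed.

(* [eps *: resolvent predT eps Y] tends to the projector onto the orthogonal of the
   range of [Y], and is a rational function of [Y]. *)
Lemma dot_resolvent_range eps Y (z : 'cV[R]_l) : 0 < eps ->
  4 * eps * dot (resolvent predT eps Y *m (Y *m z)) (resolvent predT eps Y *m (Y *m z)) <=
  dot z z.
Proof.
move=> eps0; set a := resolvent _ _ _ *m _.
have aE : dot a (Y *m z) = dot (Y^T *m a) (Y^T *m a) + eps * dot a a.
  have -> : Y *m z = ridge predT eps Y *m a by rewrite mulmxA resolventK// mul1mx.
  by rewrite dot_ridge dot_gram maskT_mul.
move: aE; rewrite dot_mulmx; set t := Y^T *m a => aE.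
(* By [aE] the pairing of [z] with [t] is [|t|^2 + eps |a|^2], so the terms in [|t|^2] cancel and
   [|z|^2 - 4 eps |a|^2 >= 0] is left. *)
have := dot_ge0 (z - 2 *: t).
rewrite dotBr dotZr ![dot (z - _) _]dotC !dotBr !dotZr (dotC z t) aE; lra.
Qed.

(** Write [Pi = Y E^T]. The regularised projector acts exactly on the kernel of [Pi], so the error
    is [eps *: resolvent *m Y *m E^T], of order [sqrt eps] by [dot_resolvent_range]; with
    [eps = t^2] the rate is linear in [t]. *)
Lemma resolvent_projector Y Pi : is_orth_projector Pi Y ->
  exists D : 'M[R]_(l, n), forall t i j, 0 < t ->
  `|t ^+ 2 * resolvent predT (t ^+ 2) Y i j - (1%:M - Pi) i j| <= t * enorm (col j D).
Proof.
move=> [PiT PiPi /eqmxP PiY].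
have /submxP[E PiE] : (Pi^T <= Y^T)%MS by rewrite PiY.
have /submxP[F YF] : (Y^T <= Pi^T)%MS by rewrite PiY.
exists E^T => t i j t0; have e0 : 0 < t ^+ 2 by rewrite exprn_gt0.
set eps := t ^+ 2 in e0 *.
have NE : 1%:M - Pi = eps *: (resolvent predT eps Y *m (1%:M - Pi)).
  have rN : ridge predT eps Y *m (1%:M - Pi) = eps *: (1%:M - Pi).
    rewrite mulmxDl gramT -mulmxA YF PiT -mulmxA mulmxBr mulmx1 PiPi subrr.
    by rewrite !mulmx0 add0r mul_scalar_mx.
  rewrite scalemxAr -rN mulmxA /resolvent mulVmx ?mul1mx//; exact: ridge_unit.
have -> : eps * resolvent predT eps Y i j - (1%:M - Pi) i j =
    eps * (resolvent predT eps Y *m (Y *m col j E^T)) i 0.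
  have -> : Y *m col j E^T = col j Pi.
    by rewrite -[Pi in RHS]trmxK PiE trmx_mul trmxK !colE mulmxA.
  have E1 : (resolvent predT eps Y *m (1%:M - Pi)) i j =
      resolvent predT eps Y i j - (resolvent predT eps Y *m Pi) i j.
    by rewrite mulmxBr mulmx1 [LHS]mxE [X in _ + X]mxE.
  have E2 : (resolvent predT eps Y *m col j Pi) i 0 = (resolvent predT eps Y *m Pi) i j.
    by rewrite colE mulmxA -colE mxE.
  have E3 := congr1 (fun M : 'M[R]_n => M i j) NE.
  by rewrite /= [RHS]mxE E1 in E3; rewrite E3 E2; ring.
set x := resolvent _ _ _ *m _.
have h := dot_resolvent_range Y (col j E^T) e0; rewrite -/x in h.
rewrite -(@ler_pXn2r _ 2) ?nnegrE ?mulr_ge0 ?enorm_ge0 ?(ltW t0)//.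
rewrite real_normK ?num_real// !exprMn sqr_enorm -/eps expr2 -mulrA ler_pM2l//.
have hx := sqr_le_dot x i; have hd := dot_ge0 x.
apply: le_trans h; apply: (@le_trans _ _ (eps * dot x x)); first by rewrite ler_pM2l.
by rewrite -mulrA; have := mulr_ge0 (ltW e0) hd; lra.
Qed.

(** The projectors are only specified pointwise; measurability comes from writing them as limits of
    regularised ones, which are measurable in [Y]. *)
Lemma measurable_projector d (T : measurableType d) (Y : T -> 'M[R]_(n, l))
    (Pi : T -> 'M[R]_n) :
  (forall i j, measurable_fun setT (fun w => Y w i j)) ->
  (forall w, is_orth_projector (Pi w) (Y w)) ->
  forall i j, measurable_fun setT (fun w => (1%:M - Pi w) i j).
Proof.
move=> mY PiP i j.
pose h N w := harmonic N ^+ 2 * resolvent predT (harmonic N ^+ 2) (Y w) i j.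
have h0 N : 0 < harmonic N :> R by rewrite /harmonic/= invr_gt0.
apply: (@measurable_fun_cvg _ _ _ _ h).
  move=> N; apply: measurable_funM => //.
  have e0 : 0 < harmonic N ^+ 2 :> R by rewrite exprn_gt0.
  by have [_ mR _] := @tame_resolvent R n l predT _ e0 i j; exact: mR.
move=> w _; have [D HD] := resolvent_projector (PiP w).
set c := enorm (col j D).
apply: (@squeeze_cvgr _ _ _ _ (fun N => (1%:M - Pi w) i j - harmonic N * c)
    (fun N => (1%:M - Pi w) i j + harmonic N * c)).
- by apply: nearW => N; rewrite -ler_distl; exact: HD.
- rewrite -[X in _ --> X]subr0 -(mul0r c); apply: cvgB; first exact: cvg_cst.
  by apply: cvgM; [exact: cvg_harmonic|exact: cvg_cst].
- rewrite -[X in _ --> X]addr0 -(mul0r c); apply: cvgD; first exact: cvg_cst.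
  by apply: cvgM; [exact: cvg_harmonic|exact: cvg_cst].
Qed.

End MeasurableProjector.

(** * The two bounds *)

Section ProjectionTail.
Context {d : measure_display} {T : measurableType d} {R : realType}
  (P : probability T R) {n k l q : nat} (V : 'M[R]_n) (lam : nat -> R) (mu : R)
  (X : 'I_l -> 'I_n -> {RV P >-> R}) (Pi : T -> 'M[R]_n).
Hypothesis VV : V^T *m V = 1%:M.
Hypothesis lam0 : forall i, 0 <= lam i.
Hypothesis lam_noninc : forall i j, (i <= j < n)%N -> lam j <= lam i.
Hypothesis lam_pos : 0 < lam k.-1.
Hypothesis mu0 : 0 <= mu.
Hypothesis lE : l = (2 * k + 2)%N.
Hypothesis k3 : (3 <= k)%N.
Hypothesis kn : (k <= n)%N.
Hypothesis gaussX : gaussian_matrix X.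
Local Notation A := (spec V lam).
Local Notation Amu := (A + mu%:M).
Hypothesis PiP : forall w, is_orth_projector (Pi w) (Amu *m (A ^+ q.+1 *m (random_mx X w)^T)).
Local Notation s i := ((lam i + mu) * lam i ^+ q.+1).
Local Notation sr := (stable_rank k (Amu ^+ 2 *m A ^+ (2 * q.+1))).

Let s0 i : 0 <= s i. Proof. by rewrite mulr_ge0 ?exprn_ge0 ?addr_ge0. Qed.

Let s_noninc i j : (i <= j < n)%N -> s j <= s i.
Proof.
move=> /lam_noninc ij; apply: ler_pM; rewrite ?exprn_ge0 ?addr_ge0 ?lerD2r//.
by apply: lerXn2r; rewrite ?nnegrE.
Qed.

Let k1n : (k.-1 < n)%N. Proof. by rewrite (leq_trans _ kn)// ltn_predL (leq_trans _ k3). Qed.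

Let sk0 : 0 < s k.-1.
Proof. by rewrite mulr_gt0 ?exprn_gt0// ltr_wpDr. Qed.

Lemma stable_rank_tail : sr * s k.-1 ^+ 2 = \sum_(i < n | ~~ (i < k.-1)%N) s i ^+ 2.
Proof.
rewrite (scalar_spec VV) spec_add !spec_exp// spec_mul//.
have -> : (fun i => (lam i + mu) ^+ 2 * lam i ^+ (2 * q.+1)) = (fun i => s i ^+ 2).
  by apply/funext => i; rewrite exprMn -exprM mulnC.
rewrite stable_rank_spec//.
- rewrite divfK ?expf_neq0 ?gt_eqF//; apply: eq_bigl => i; by rewrite -leqNgt.
- by rewrite kn andbT (leq_trans _ k3).
- by move=> i; exact: sqr_ge0.
- by move=> i j ij; apply: lerXn2r; rewrite ?nnegrE// s_noninc.
Qed.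

Lemma stable_rank_ge0 : 0 <= sr.
Proof.
rewrite -(pmulr_lge0 _ (exprn_gt0 2 sk0)) stable_rank_tail.
by apply: sumr_ge0 => i _; exact: sqr_ge0.
Qed.

Lemma projection_tail p : (0 < p)%N -> (2 * p <= k + 2)%N ->
  exists Psi : T -> \bar R,
  [/\ measurable_fun setT Psi, forall w, (0 <= Psi w)%E,
      (\int[P]_w Psi w <= (s k.-1 ^+ (2 * p) *
        \prod_(j < p) ((k.-1%:R + 2 * j%:R) * (sr + 2 * j%:R) /
          ((1 + 2 * j%:R) * (k%:R + 2 - 2 * j%:R))))%:E)%E &
      forall w, (Psi w < +oo)%E -> exists u, [/\ 0 <= u, u ^+ (2 * p) = fine (Psi w) &
        spectral_norm ((1%:M - Pi w) *m Amu) <=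
          mu + (s k.-1 + u / 2) `^ (1 / (q.+1%:R + 1))]].
Proof.
move=> p0 pk; have [indepX lawX] := gaussX.
have l0 : (0 < l)%N by rewrite lE addn2.
have sd0 : Num.sqrt (l%:R^-1) != 0 :> R by rewrite gt_eqF// sqrtr_gt0 invr_gt0 ltr0n.
have tau0 : 0 < Num.sqrt (l%:R^-1) ^+ 2 :> R by rewrite exprn_even_gt0.
have steinG := stein_rotation sd0 indepX lawX VV.
(* Indices are 0-based here: [lam k.-1] is the [k]-th eigenvalue, it belongs to the tail, and
   [s k.-1] is the largest tail weight, whence [S = s k.-1 ^+ 2]. *)
pose J : pred 'I_n := fun i => (i < k.-1)%N.
pose st (i : 'I_n) : R := if J i then 0 else s i.
have rE : \sum_(i | J i) (1 : R) = k.-1%:R.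
  rewrite -(big_ord_widen _ (fun=> 1))//; last by rewrite ltnW.
  by rewrite sumr_const card_ord.
have kp : k.-1%:R = k%:R - 1 :> R by rewrite -[in RHS](ltn_predK k3) -natr1 addrK.
have dofE j : l%:R - \sum_(i | J i) (1 : R) - 1 - 2 * j%:R = k%:R + 2 - 2 * j%:R.
  by rewrite rE lE natrD natrM kp; ring.
have dof j : (j < p)%N -> 0 < l%:R - \sum_(i | J i) (1 : R) - 1 - 2 * j%:R.
  move=> jp; rewrite dofE -natrM -natrD subr_gt0 ltr_nat; lia.
have stS i : st i ^+ 2 <= s k.-1 ^+ 2.
  rewrite /st /J; case: ltnP => ki; first by rewrite expr0n sqr_ge0.
  by apply: lerXn2r; rewrite ?nnegrE// s_noninc// ki ltn_ord.
have stJ i : J i -> st i = 0 by rewrite /st => ->.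
have st2 : \sum_i st i ^+ 2 = sr * s k.-1 ^+ 2.
  rewrite stable_rank_tail [RHS]big_mkcond; apply: eq_bigr => i _.
  by rewrite /st /J; case: ltnP => //; rewrite expr0n.
have [Psi [mPsi Psi0 intPsi PsiP]] := tail_variable tau0 steinG (Ordinal l0) (sqr_ge0 _) stS stJ p0 dof.
exists Psi; split=> //.
  apply: (le_trans intPsi); rewrite lee_fin le_eqVlt; apply/orP; left; apply/eqP.
  have -> : s k.-1 ^+ (2 * p) = \prod_(j < p) s k.-1 ^+ 2.
    by rewrite prodr_const card_ord exprM.
  rewrite -big_split/=; apply: eq_bigr => j _; rewrite dofE rE st2; ring.
move=> w Pfin; exists (fine (Psi w) `^ (1 / (2 * p)%:R)).
have u0 := powR_ge0 (fine (Psi w)) (1 / (2 * p)%:R).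
have f0 : 0 <= fine (Psi w) by exact: fine_ge0.
have uE : (fine (Psi w) `^ (1 / (2 * p)%:R)) ^+ (2 * p) = fine (Psi w).
  rewrite -powR_mulrn// -powRrM mul1r mulVf ?powRr1//.
  by rewrite pnatr_eq0 muln_eq0 negb_or/= -lt0n.
set u := _ `^ _ in u0 uE *; split=> //.
apply: (projection_error_le VV lam0 mu0 (PiP w)) => //.
  by move=> i ki; exact: lam_noninc.
move=> y Piy; set nu := V^T *m y.
pose a : 'cV[R]_n := \col_i (if J i then s i * nu i 0 else 0).
have Ja : mask J *m a = a.
  by apply/matrixP => i j; rewrite mask_mulE mxE; case: (J i); rewrite ?mul1r ?mulr0.
have aG b : \sum_i (a i 0 + st i * nu i 0) * (V^T *m (random_mx X w)^T) i b = 0.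
  rewrite -[RHS](projection_kernel VV (PiP w) b Piy); apply: eq_bigr => i _; congr (_ * _).
  by rewrite mxE /st; case: (J i); rewrite ?mul0r ?addr0 ?add0r.
have := PsiP w a (fun i => nu i 0) Pfin Ja aG.
have -> : dot a a = \sum_(i < n | (i < k.-1)%N) (s i * nu i 0) ^+ 2.
  rewrite dot_sqr [RHS]big_mkcond; apply: eq_bigr => i _; rewrite mxE /J.
  by case: ifP => //; rewrite expr0n.
rewrite -uE exprM -exprMn mulrC ler_pXn2r// ?nnegrE.
- by apply: sumr_ge0 => i _; exact: sqr_ge0.
- by rewrite mulr_ge0 ?sqr_ge0// sumr_ge0// => i _; exact: sqr_ge0.
Qed.

End ProjectionTail.

(** The tangent line at [c] of the convex function [a ^+ m.+1]. *)
Lemma bernoulli_tangent (R : realDomainType) (m : nat) (a c : R) : 0 <= a -> 0 <= c ->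
  m.+1%:R * c ^+ m * a <= a ^+ m.+1 + m%:R * c ^+ m.+1.
Proof.
move=> a0 c0; elim: m => [|m IH].
  by rewrite expr0 mul0r addr0 mulr1 mul1r expr1.
have h : 0 <= m.+1%:R * (c ^+ m * (a - c) ^+ 2).
  by apply: mulr_ge0 => //; apply: mulr_ge0; [exact: exprn_ge0|exact: sqr_ge0].
have := ler_wpM2l a0 IH; move: h.
rewrite !exprS -[m.+2%:R]natr1 -[m.+1%:R]natr1.
set x := a ^+ m; set y := c ^+ m; set z := m%:R; rewrite expr0; lra.
Qed.

(** * From the mean of [Psi] to the error, in probability and in expectation *)

Section ErrorBounds.
Context {d : measure_display} {T : measurableType d} {R : realType} (P : probability T R).
Variables (err : T -> R) (Psi : T -> \bar R) (p : nat) (mu s : R) (a : R).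
Hypothesis mPsi : measurable_fun setT Psi.
Hypothesis Psi0 : forall w, (0 <= Psi w)%E.
Hypothesis p0 : (0 < p)%N.
Hypothesis s0 : 0 < s.
Hypothesis merr : measurable_fun setT err.

Lemma error_probability (delta theta : R) : 0 < theta -> 0 <= a ->
  (\int[P]_w Psi w <= (delta * theta ^+ p)%:E)%E ->
  (forall w, (Psi w < +oo)%E -> exists u, [/\ 0 <= u, u ^+ p = fine (Psi w) &
    err w <= mu + (s + u / 2) `^ a]) ->
  ((1 - delta)%:E <= P [set w | (err w <= mu + (s + theta / 2) `^ a)%R])%E.
Proof.
move=> th0 a0 intPsi H; set t := theta ^+ p in intPsi.
have t0 : 0 < t by rewrite exprn_gt0.
(* This event contains the points where [Psi] is infinite, so on its complement the pointwise bound
   is available. *)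
pose B := [set w | (t%:E <= `|Psi w|)%E].
have mB : measurable B.
  rewrite -[B]setTI; apply: emeasurable_fun_c_infty => //.
  exact: measurableT_comp.
have PB : (P B <= delta%:E)%E.
  have := @le_integral_comp_abse _ _ _ P setT measurableT Psi t id.
  move=> /(_ (@measurable_id _ _ _) (fun r h => h) (fun x y _ _ h => h) mPsi t0).
  rewrite setTI => /le_trans => /(_ (delta * t)%:E) h.
  have : (t%:E * P B <= (delta * t)%:E)%E.
    apply: h; apply: le_trans intPsi.
    by under eq_integral do rewrite gee0_abs//.
  by rewrite muleC EFinM lee_pmul2r// lte_fin.
rewrite EFinB; apply: (@le_trans _ _ (1 - P B)%E); first exact: leeB.
rewrite -probability_setC//; apply: le_measure; rewrite ?inE//.
- exact: measurableC.
- rewrite -[X in measurable X]setTI.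
  have := merr measurableT (measurable_itv `]-oo, mu + (s + theta / 2) `^ a]).
  by congr measurable; apply/seteqP; split => w /=; rewrite in_itv.
move=> w /= /negP; rewrite -ltNge gee0_abs// => Pt.
have Pfin : (Psi w < +oo)%E by rewrite (lt_le_trans Pt)// leey.
have [u [u0 uE /le_trans]] := H w Pfin; apply; rewrite lerD2l.
have uth : u <= theta.
  rewrite -(@ler_pXn2r _ p) ?nnegrE// ?(ltW th0)// uE -lee_fin fineK ?ltW//.
  by rewrite ge0_fin_numE.
by apply: ge0_ler_powR => //; rewrite ?nnegrE ?addr_ge0 ?divr_ge0 ?(ltW s0) ?(ltW th0)// lerD2l ler_pM2r ?invr_gt0.
Qed.

Lemma error_expectation (q : nat) (b : R) : 0 < b -> (forall w, 0 <= err w) -> 0 <= mu ->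
  (\int[P]_w Psi w <= (b ^+ p)%:E)%E ->
  (forall w, (Psi w < +oo)%E -> exists u, [/\ 0 <= u, u ^+ p = fine (Psi w) &
    err w <= mu + (s + u / 2) `^ (1 / (q%:R + 1))]) ->
  ('E_P[err] <= (mu + (s + b / 2) `^ (1 / (q%:R + 1)))%:E)%E.
Proof.
move=> b0 err0 mu0 intPsi H; set c := s + b / 2.
have c0 : 0 < c by rewrite addr_gt0// divr_gt0.
have rootK x : 0 <= x -> (x `^ (1 / (q%:R + 1))) ^+ q.+1 = x.
  move=> x0; rewrite -powR_mulrn ?powR_ge0// -powRrM natr1 mul1r mulVf ?powRr1//.
set c' := c `^ _; have c'0 : 0 < c' by exact: powR_gt0.
(* The derivative of [Psi = u^p] with respect to [v = (s + u / 2)^(1 / (q + 1))] at [u = b]. Two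
   tangent inequalities then chain into [D (v - c') <= u^p - b^p], and the resulting affine bound
   persists where [Psi] is infinite. *)
pose D := q.+1%:R * c' ^+ q * (2 * (p%:R * b ^+ p.-1)).
have D0 : 0 < D.
  by rewrite !mulr_gt0 ?exprn_gt0// ltr0n.
have affine w : ((D * err w + b ^+ p)%:E <= (D * (mu + c'))%:E + Psi w)%E.
  have [Pfin|] := ltP (Psi w) +oo%E; last first.
    by rewrite leye_eq => /eqP ->; rewrite addey// leey.
  have [u [u0 uE eu]] := H w Pfin.
  have -> : Psi w = (u ^+ p)%:E by rewrite uE fineK// ge0_fin_numE.
  rewrite -EFinD lee_fin.
  set v := (s + u / 2) `^ _ in eu.
  have v0 : 0 <= v by exact: powR_ge0.
  have h1 := bernoulli_tangent q v0 (ltW c'0).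
  have h2 := bernoulli_tangent p.-1 u0 (ltW b0).
  rewrite !rootK ?addr_ge0 ?divr_ge0 ?(ltW s0) ?(ltW b0)// in h1.
  rewrite (prednK p0) in h2.
  have h3 : q.+1%:R * c' ^+ q * (v - c') <= (u - b) / 2.
    have E : q.+1%:R * c' ^+ q * c' = q.+1%:R * c by rewrite -mulrA -exprSr rootK// ltW.
    rewrite mulrBr E lerBlDr (le_trans h1)// /c -[q.+1%:R]natr1; lra.
  have h4 : p%:R * b ^+ p.-1 * (u - b) <= u ^+ p - b ^+ p.
    have E : p%:R * b ^+ p.-1 * b = p%:R * b ^+ p by rewrite -mulrA -exprSr prednK.
    rewrite mulrBr E lerBlDr (le_trans h2)//.
    by rewrite -[in leRHS](prednK p0) -natr1 prednK//; lra.
  have h5 : D * (v - c') <= u ^+ p - b ^+ p.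
    apply: le_trans h4; rewrite /D mulrAC.
    apply: (@le_trans _ _ ((u - b) / 2 * (2 * (p%:R * b ^+ p.-1)))).
      by rewrite ler_wpM2r// !mulr_ge0 ?exprn_ge0 ?(ltW b0).
    by rewrite le_eqVlt; apply/orP; left; apply/eqP; field.
  have := ler_wpM2l (ltW D0) eu; rewrite !mulrDr; move: h5; rewrite mulrBr; lra.
have I0 : (0 <= 'E_P[err])%E by rewrite unlock; apply: integral_ge0 => w _; rewrite lee_fin.
have PI (c1 : R) : (\int[P]_w c1%:E = c1%:E)%E.
  transitivity (c1%:E * P setT)%E; first exact: integral_cst.
  by rewrite probability_setT mule1.
have b'0 : 0 <= b ^+ p by rewrite exprn_ge0 ?ltW.
have : (D%:E * 'E_P[err] + (b ^+ p)%:E <= (D * (mu + c') + b ^+ p)%:E)%E.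
  have -> : (D%:E * 'E_P[err] + (b ^+ p)%:E = \int[P]_w (D * err w + b ^+ p)%:E)%E.
    under [RHS]eq_integral do rewrite EFinD EFinM.
    rewrite ge0_integralD//; last 2 first.
    - by move=> w _; rewrite lee_fin mulr_ge0// ltW.
    - by apply/measurable_EFinP; apply: measurable_funM.
    rewrite PI ge0_integralZl//; last 3 first.
    - exact/measurable_EFinP.
    - by move=> w _; rewrite lee_fin.
    - by rewrite lee_fin ltW.
    by rewrite unlock.
  apply: (@le_trans _ _ (\int[P]_w ((D * (mu + c'))%:E + Psi w))%E).
    apply: ge0_le_integral => //.
    - by move=> w _; rewrite lee_fin addr_ge0// mulr_ge0// ltW.
    - by apply/measurable_EFinP; apply: measurable_funD => //; apply: measurable_funM.
    - exact: emeasurable_funD.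
  rewrite ge0_integralD//; last first.
    move=> w _; rewrite lee_fin; apply: mulr_ge0; first exact: ltW.
    by apply: addr_ge0 => //; exact: ltW.
  by rewrite PI EFinD leeD2l.
case: ('E_P[err])%E I0 => [r| |] //= r0.
  by rewrite -EFinM -EFinD !lee_fin lerD2r ler_pM2l.
by rewrite gt0_muley ?lte_fin// addye.
Qed.

End ErrorBounds.

Lemma root_factor (R : realType) (q : nat) (C x y : R) : 0 <= C -> 0 <= x -> 0 <= y ->
  C `^ (1 / (q%:R + 1)) * x `^ (q%:R / (q%:R + 1)) * y `^ (1 / (q%:R + 1)) =
  (C * (y * x ^+ q)) `^ (1 / (q%:R + 1)).
Proof.
move=> C0 x0 y0; rewrite powRM// ?mulr_ge0 ?exprn_ge0// powRM ?exprn_ge0//.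
have -> : (x ^+ q) `^ (1 / (q%:R + 1)) = x `^ (q%:R / (q%:R + 1)).
  by rewrite -powR_mulrn// -powRrM mulrA mulr1.
by rewrite -mulrA; congr (_ * _); rewrite mulrC.
Qed.

Theorem proposition2p3 (R : realType) (d : measure_display)
    (T : measurableType d) (P : probability T R)
    (n k l q : nat) (A : 'M[R]_n) (mu : R)
    (X : 'I_l -> 'I_n -> {RV P >-> R}) (Pi : T -> 'M[R]_n) :
  let Amu : 'M[R]_n := A + mu%:M in
  let Omega (w : T) : 'M[R]_(n, l) := A ^+ q *m (random_mx X w)^T in
  let err (w : T) : R := spectral_norm ((1%:M - Pi w) *m Amu) in
  let bound (C1 C2 : R) : R :=
    mu + (C1 + C2 * Num.sqrt (stable_rank k (Amu ^+ 2 *m A ^+ (2 * q)) / k%:R))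
           `^ (1 / (q%:R + 1))
         * eigval A k `^ (q%:R / (q%:R + 1))
         * (eigval A k + mu) `^ (1 / (q%:R + 1)) in
  pos_def A ->
  0 <= mu ->
  l = (2 * k + 2)%N -> (8 <= l)%N -> (k <= n)%N ->
  gaussian_matrix X ->
  (1 <= q)%N ->
  (forall w, is_orth_projector (Pi w) (Amu *m Omega w)) ->
  [/\ measurable_fun setT err,
      ((1 - 6 ^- k)%:E
        <= P [set w | (err w <= bound 18 (8 * Num.sqrt 2))%R])%E
    & ('E_P[err] <= (bound 2 (Num.sqrt 2 * expR 1))%:E)%E].
Proof.
move=> Amu Omega err bound Apos mu0 lE l8 kn gaussX q1 PiP.
case: q @Omega @bound q1 PiP => // q Omega bound _ PiP.
have k3 : (3 <= k)%N by lia.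
have k0 : (0 < k)%N by exact: leq_trans k3.
have AT : A^T = A by case: Apos.
pose lam i := (eigenvalues A)`_i.
have [V VV AE] : exists2 V : 'M[R]_n, V^T *m V = 1%:M & A = spec V lam := symmetric_specE AT.
have lam_pos : 0 < lam k.-1 by apply: pos_def_eigenvalues; rewrite ?prednK.
have lam0 i : 0 <= lam i.
  have [ilt|ni] := ltnP i n; first exact/ltW/pos_def_eigenvalues.
  (* Beyond the spectrum the default value of [nth] is [0], so [lam] is nonnegative at every
     index. *)
  by rewrite /lam nth_default// size_eigenvalues.
have lam_noninc i j : (i <= j < n)%N -> lam j <= lam i by exact: eigenvalues_noninc.
have PiP' w : is_orth_projector (Pi w)
    ((spec V lam + mu%:M) *m (spec V lam ^+ q.+1 *m (random_mx X w)^T)).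
  by rewrite -AE; exact: PiP.
have tail := projection_tail VV lam0 lam_noninc lam_pos mu0 lE k3 kn gaussX PiP'.
have sr0 := stable_rank_ge0 (q := q) VV lam0 lam_noninc lam_pos mu0 k3 kn.
rewrite -AE -/Amu in tail sr0.
set s := (lam k.-1 + mu) * lam k.-1 ^+ q.+1 in tail.
have s0 : 0 < s by rewrite mulr_gt0 ?exprn_gt0// ltr_wpDr.
set y := Num.sqrt (stable_rank k (Amu ^+ 2 *m A ^+ (2 * q.+1)) / k%:R).
have y0 : 0 <= y by exact: sqrtr_ge0.
have boundE C1 C2 : 0 <= C1 -> 0 <= C2 ->
    bound C1 C2 = mu + ((C1 + C2 * y) * s) `^ (1 / (q.+1%:R + 1)).
  move=> C10 C20; congr (_ + _); rewrite root_factor//.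
  - by rewrite addr_ge0 ?mulr_ge0.
  - exact: lam0.
  - by rewrite addr_ge0// lam0.
have merr : measurable_fun setT err.
  apply: measurable_spectral_norm => i j.
  under eq_fun do rewrite mxE; apply: measurable_sum => b; apply: measurable_funM => //.
  apply: (measurable_projector _ PiP) => i' a.
  under eq_fun do rewrite mxE; apply: measurable_sum => c; apply: measurable_funM => //.
  under eq_fun do rewrite mxE; apply: measurable_sum => e; apply: measurable_funM => //.
  by under eq_fun do rewrite !mxE; exact: measurable_funPT.
split=> //.
- set C := 8 * Num.sqrt 2.
  have C0 : 0 <= C by rewrite mulr_ge0 ?sqrtr_ge0.
  have [||Psi [mPsi Psi0 intPsi PsiP]] := tail (k %/ 2).+1; [by []|lia|].
  have th0 : 0 < (34 + 2 * C * y) * s.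
    by rewrite mulr_gt0// ltr_wpDr ?mulr_ge0.
  rewrite boundE//.
  (* Of the [18], one unit is [s] itself and the other [17] are half of the [34] in
     [moment_constant_probability]. *)
  have -> : (18 + C * y) * s = s + (34 + 2 * C * y) * s / 2 by field.
  apply: (error_probability mPsi Psi0 _ s0 merr th0 _ _ PsiP) => //.
  apply: (le_trans intPsi); rewrite lee_fin (exprMn _ (34 + 2 * C * y)) mulrA mulrC ler_pM2r ?exprn_gt0//.
  exact: moment_constant_probability.
- set C := Num.sqrt 2 * expR 1.
  have C0 : 0 <= C by rewrite mulr_ge0 ?sqrtr_ge0 ?expR_ge0.
  have [||Psi [mPsi Psi0 intPsi PsiP]] := tail (k %/ 8).+1; [by []|lia|].
  have b0 : 0 < (2 + 2 * C * y) * s.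
    by rewrite mulr_gt0// ltr_wpDr ?mulr_ge0.
  rewrite boundE//.
  (* Likewise [2 = 1 + 2 / 2], with the constant of [moment_constant_expectation]. *)
  have -> : (2 + C * y) * s = s + (2 + 2 * C * y) * s / 2 by field.
  apply: (error_expectation mPsi Psi0 _ s0 merr b0 _ mu0 _ PsiP) => //.
  + by move=> w; exact: spectral_norm_ge0.
  apply: (le_trans intPsi); rewrite lee_fin (exprMn _ (2 + 2 * C * y)) mulrC ler_pM2r ?exprn_gt0//.
  exact: moment_constant_expectation.
Qed.
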